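(* Let $d$ be an odd integer. The fixed point set of the involution $(-I,\pm i)\in\{\pm I\}\times\mathrm{SO}(3)$ on $M^7_d$ is a $3$-dimensional lens space with fundamental group $\mathbb{Z}_{|d|}$. Hence, for odd integers $d,d'$, $M^7_d$ is $\{\pm I\}\times\mathrm{SO}(3)$-equivariantly homeomorphic to $M^7_{d'}$ if and only if $d=\pm d'$. Moreover, for $|d|>3$ none of the $M^7_d$ is $\{\pm I\}\times\mathrm{SO}(3)$-equivariantly homeomorphic to any of the $\Sigma^7_n$, $n\in\mathbb{Z}$.
   Context: Let $\mathbb{H}$ be the quaternions, $\mathbb{S}^3$ the unit quaternions, $\mathrm{SO}(3)=\mathbb{S}^3/\{\pm1\}$, $I$ the $2\times 2$ identity matrix. Milnor spheres: for integers $k,l$ with $k+l=1$, $M^7_{k,l}$ is obtained by gluing two copies of $\mathbb{H}\times\mathbb{S}^3$ along $(\mathbb{H}\setminus\{0\})\times\mathbb{S}^3$ by the map $(u,v)\mapsto\bigl(\tfrac{u}{|u|^2},(\tfrac{u}{|u|})^k\,v\,(\tfrac{u}{|u|})^l\bigr)$. For odd $d$ put $M^7_d=M^7_{k,l}$ with $d=k-l$, $k+l=1$. $\mathrm{SO}(3)$ acts on $M^7_d$ in both charts by $\pm q\bullet(u,v)=(qu\bar q,qv\bar q)$, and $-I$ acts in both charts by the commuting involution $(u,v)\mapsto(u,-v)$; this gives the $\{\pm I\}\times\mathrm{SO}(3)$-action on $M^7_d$. Here $\pm i\in\mathrm{SO}(3)$ is the class of the unit quaternion $i$. $\mathbb{Z}_1$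 is the trivial group, $\mathbb S^3$ being regarded as a lens space. Generalized Gromoll-Meyer spheres: let $\mathbb{S}^7\subset\mathbb{H}^2$ be the unit sphere (columns) and $\langle\langle u,v\rangle\rangle=\bar u^{\mathrm t}v$. For $n\in\mathbb{Z}$ define $\rho_n:\mathbb{S}^7\to\mathbb{S}^7$ by $$\rho_n\begin{pmatrix}\cos t+p\sin t\\ w\sin t\end{pmatrix}=\begin{pmatrix}\cos nt+p\sin nt\\ w\sin nt\end{pmatrix},$$ where $t\in\mathbb{R}$, $p\in\operatorname{Im}\mathbb{H}$, $w\in\mathbb{H}$, $|p|^2+|w|^2=1$. Put $E_n^{10}=\{(u,v)\in\mathbb{S}^7\times\mathbb{S}^7 : \langle\langle\rho_n(u),v\rangle\rangle=0\}$, with the free $\mathbb{S}^3$-action $q\star(u,v)=(qu\bar q,qv)$ (both components of $u$ are conjugated by $q$), and let $\Sigma^7_n=E_n^{10}/\mathbb{S}^3$ be the $\star$-quotient. The actions $(-I)\bullet(u,v)=(-u,-v)$ and $q\bullet(u,v)=(u,v\bar q)$ ($q\in\mathbb{S}^3$) on $E_n^{10}$ commute with $\star$ and induce the $\{\pm I\}\times\mathrm{SO}(3)$-action on $\Sigma^7_n$. *)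

(* Defs.v *)
From HB Require Import structures.
From mathcomp Require Import all_boot all_order all_algebra.
From mathcomp Require Import all_classical all_reals all_analysis.
From mathcomp Require Import homotopy.
From mathcomp Require Import ring lra zify.

Set Implicit Arguments.
Unset Strict Implicit.
Unset Printing Implicit Defensive.

Import Order.TTheory GRing.Theory Num.Theory.
Import numFieldNormedType.Exports.

Local Open Scope classical_set_scope.
Local Open Scope ring_scope.
Local Open Scope quotient_scope.

Record quat (R : Type) := Quat { qre : R; qi : R; qj : R; qk : R }.

Definition quat_coord (R : Type) (x : quat R) : R * R * R * R :=
  (qre x, qi x, qj x, qk x).

Definition quat_of_coord (R : Type) (c : R * R * R * R) : quat R :=
  Quat c.1.1.1 c.1.1.2 c.1.2 c.2.

Lemma quat_coordK (R : Type) : cancel (@quat_coord R) (@quat_of_coord R).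
Proof. by case. Qed.

HB.instance Definition _ (R : choiceType) :=
  Choice.copy (quat R) (can_type (@quat_coordK R)).

HB.instance Definition _ (R : realType) :=
  Topological.copy (quat R) (initial_topology (@quat_coord R)).

Section Quaternions.
Variable R : realType.
Implicit Types x y z : quat R.

Definition qadd x y :=
  Quat (qre x + qre y) (qi x + qi y) (qj x + qj y) (qk x + qk y).
Definition qopp x := Quat (- qre x) (- qi x) (- qj x) (- qk x).
Definition qzero : quat R := Quat 0 0 0 0.
Definition qone : quat R := Quat 1 0 0 0.
Definition qmul x y :=
  Quat (qre x * qre y - qi x * qi y - qj x * qj y - qk x * qk y)
       (qre x * qi y + qi x * qre y + qj x * qk y - qk x * qj y)
       (qre x * qj y - qi x * qk y + qj x * qre y + qk x * qi y)
       (qre x * qk y + qi x * qj y - qj x * qi y + qk x * qre y).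
Definition qscale (a : R) x := Quat (a * qre x) (a * qi x) (a * qj x) (a * qk x).

Definition qconj x := Quat (qre x) (- qi x) (- qj x) (- qk x).
Definition qnorm2 x := qre x ^+ 2 + qi x ^+ 2 + qj x ^+ 2 + qk x ^+ 2.
Definition qnorm x := Num.sqrt (qnorm2 x).

Fact quat_eq x y : qre x = qre y -> qi x = qi y -> qj x = qj y -> qk x = qk y ->
  x = y.
Proof. by case: x y => [a b c d] [a' b' c' d'] /= -> -> -> ->. Qed.

Fact qaddA : associative qadd.
Proof. by move=> x y z; apply: quat_eq => /=; rewrite addrA. Qed.
Fact qaddC : commutative qadd.
Proof. by move=> x y; apply: quat_eq => /=; rewrite addrC. Qed.
Fact qadd0 : left_id qzero qadd.
Proof. by move=> x; apply: quat_eq => /=; rewrite add0r. Qed.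
Fact qaddN : left_inverse qzero qopp qadd.
Proof. by move=> x; apply: quat_eq => /=; rewrite addNr. Qed.

HB.instance Definition _ :=
  GRing.isZmodule.Build (quat R) qaddA qaddC qadd0 qaddN.

Fact qmulA : associative qmul.
Proof. by move=> x y z; apply: quat_eq => /=; ring. Qed.
Fact qmul1x : left_id qone qmul.
Proof. by move=> x; apply: quat_eq => /=; ring. Qed.
Fact qmulx1 : right_id qone qmul.
Proof. by move=> x; apply: quat_eq => /=; ring. Qed.
Fact qmulDl : left_distributive qmul +%R.
Proof. by move=> x y z; apply: quat_eq => /=; ring. Qed.
Fact qmulDr : right_distributive qmul +%R.
Proof. by move=> x y z; apply: quat_eq => /=; ring. Qed.
Fact qone_neq0 : qone != 0.
Proof. by apply/eqP => -[] /eqP; rewrite oner_eq0. Qed.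

HB.instance Definition _ := GRing.Zmodule_isNzRing.Build (quat R)
  qmulA qmul1x qmulx1 qmulDl qmulDr qone_neq0.

Fact qscaleA a b x : qscale a (qscale b x) = qscale (a * b) x.
Proof. by apply: quat_eq => /=; rewrite mulrA. Qed.
Fact qscale1 : left_id 1 qscale.
Proof. by move=> x; apply: quat_eq => /=; rewrite mul1r. Qed.
Fact qscaleDr : right_distributive qscale +%R.
Proof. by move=> a x y; apply: quat_eq => /=; rewrite mulrDr. Qed.
Fact qscaleDl x : {morph qscale^~ x : a b / a + b}.
Proof. by move=> a b; apply: quat_eq => /=; rewrite mulrDl. Qed.

HB.instance Definition _ := GRing.Zmodule_isLmodule.Build R (quat R)
  qscaleA qscale1 qscaleDr qscaleDl.

Fact qscaleAl (a : R) x y : a *: (x * y) = (a *: x) * y.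
Proof. by apply: quat_eq => /=; ring. Qed.
HB.instance Definition _ := GRing.Lmodule_isLalgebra.Build R (quat R) qscaleAl.

Fact qscaleAr (a : R) x y : a *: (x * y) = x * (a *: y).
Proof. by apply: quat_eq => /=; ring. Qed.
HB.instance Definition _ := GRing.Lalgebra_isAlgebra.Build R (quat R) qscaleAr.

Lemma qnorm2_ge0 x : 0 <= qnorm2 x.
Proof. by rewrite /qnorm2; do !apply: addr_ge0; exact: sqr_ge0. Qed.

Lemma qnorm2_eq0 x : (qnorm2 x == 0) = (x == 0).
Proof.
apply/idP/eqP => [|->]; last by rewrite /qnorm2 /= !expr0n /= !addr0.
rewrite /qnorm2 !paddr_eq0 ?addr_ge0 ?sqr_ge0// !sqrf_eq0.
by move=> /andP[/andP[/andP[/eqP ? /eqP ?] /eqP ?] /eqP ?]; exact: quat_eq.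
Qed.

Lemma mulqC x : x * qconj x = (qnorm2 x)%:A.
Proof. by apply: quat_eq => /=; rewrite /qnorm2; ring. Qed.

Lemma mulCq x : qconj x * x = (qnorm2 x)%:A.
Proof. by apply: quat_eq => /=; rewrite /qnorm2; ring. Qed.

Definition qinv x := (qnorm2 x)^-1 *: qconj x.

Fact qmulVx : {in predC1 (0 : quat R), left_inverse 1 qinv *%R}.
Proof.
move=> x x0; rewrite /qinv -scalerAl mulCq scalerA mulVf ?scale1r//.
by rewrite qnorm2_eq0.
Qed.
Fact qmulxV : {in predC1 (0 : quat R), right_inverse 1 qinv *%R}.
Proof.
move=> x x0; rewrite /qinv -scalerAr mulqC scalerA mulVf ?scale1r//.
by rewrite qnorm2_eq0.
Qed.
Fact qunitP x y : y * x = 1 /\ x * y = 1 -> predC1 (0 : quat R) x.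
Proof.
move=> [yx _] /=; apply/eqP => x0; move: yx; rewrite x0 mulr0 => /esym/eqP.
by rewrite oner_eq0.
Qed.
Fact qinv_out : {in [predC predC1 (0 : quat R)], qinv =1 id}.
Proof.
by move=> x; rewrite !inE negbK => /eqP ->; apply: quat_eq => /=;
  rewrite ?oppr0 mulr0.
Qed.

HB.instance Definition _ := GRing.NzRing_hasMulInverse.Build (quat R)
  qmulVx qmulxV qunitP qinv_out.

Lemma quat_unitE x : (x \is a GRing.unit) = (x != 0).
Proof. by []. Qed.

Lemma qnorm2M x y : qnorm2 (x * y) = qnorm2 x * qnorm2 y.
Proof. by rewrite /qnorm2 /=; ring. Qed.

Lemma qnorm2_conj x : qnorm2 (qconj x) = qnorm2 x.
Proof. by rewrite /qnorm2 /= !sqrrN. Qed.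

Lemma qnorm2N x : qnorm2 (- x) = qnorm2 x.
Proof. by rewrite /qnorm2 /= !sqrrN. Qed.

Lemma qconjM x y : qconj (x * y) = qconj y * qconj x.
Proof. by apply: quat_eq => /=; ring. Qed.

Lemma qconjN x : qconj (- x) = - qconj x.
Proof. by []. Qed.

Lemma qconjK : involutive qconj.
Proof. by move=> x; apply: quat_eq => /=; rewrite ?opprK. Qed.

Lemma qnorm2Z (a : R) x : qnorm2 (a *: x) = a ^+ 2 * qnorm2 x.
Proof. by rewrite /qnorm2 /=; ring. Qed.

Lemma qconj1 : qconj 1 = 1.
Proof. by apply: quat_eq => //=; rewrite oppr0. Qed.

Lemma qnorm21 : qnorm2 1 = 1.
Proof. by rewrite /qnorm2 /= expr1n !expr0n /= !addr0. Qed.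

Lemma quatP x y : [/\ qre x = qre y, qi x = qi y, qj x = qj y & qk x = qk y] <->
  x = y.
Proof. by split => [[*]|->//]; exact: quat_eq. Qed.

End Quaternions.

Definition sphere3 (R : realType) : set (quat R) := [set q | qnorm2 q = 1].
Arguments sphere3 R : clear implicits.
Notation S3 R := (set_type (sphere3 R)).

Section UnitQuaternions.
Variable R : realType.
Implicit Types q v : S3 R.

Lemma S3P q : qnorm2 (val q) = 1.
Proof. exact: set_valP q. Qed.

Definition mkS3 (x : quat R) (x1 : qnorm2 x = 1) : S3 R :=
  exist _ x (mem_set x1).

Lemma S3_mulC q : val q * qconj (val q) = 1.
Proof. by rewrite mulqC S3P scale1r. Qed.

Lemma S3_Cmul q : qconj (val q) * val q = 1.
Proof. by rewrite mulCq S3P scale1r. Qed.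

Fact S3_i_subproof : qnorm2 (Quat 0 1 0 0 : quat R) = 1.
Proof. by rewrite /qnorm2 /= expr1n !expr0n /= !addr0 add0r. Qed.
Definition S3_i : S3 R := mkS3 S3_i_subproof.

Definition so3_rel : rel (S3 R) :=
  fun q q' => (val q' == val q) || (val q' == - val q).

Fact so3_rel_refl : reflexive so3_rel.
Proof. by move=> q; rewrite /so3_rel eqxx. Qed.
Fact so3_rel_sym : symmetric so3_rel.
Proof.
by move=> q q'; rewrite /so3_rel eq_sym; congr orb; rewrite -[RHS]eqr_oppLR eq_sym.
Qed.
Fact so3_rel_trans : transitive so3_rel.
Proof.
move=> q2 q1 q3; rewrite /so3_rel.
by move=> /orP[] /eqP-> /orP[] /eqP->; rewrite ?opprK eqxx ?orbT.
Qed.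

Canonical so3_equiv := EquivRel so3_rel so3_rel_refl so3_rel_sym so3_rel_trans.
Definition SO3 := {eq_quot so3_rel}.
HB.instance Definition _ := Choice.on SO3.
HB.instance Definition _ := EqQuotient.on SO3.

End UnitQuaternions.

(* The group {+-I} x SO(3); the boolean [e] stands for (-I)^e. *)
Definition pmSO3 (R : realType) := (bool * SO3 R)%type.

Definition neg_i (R : realType) : pmSO3 R := (true, \pi_(SO3 R) (S3_i R)).

Definition qsgn (R : realType) (e : bool) : quat R := (-1) ^+ e.

Section Conj.
Variable R : realType.
Implicit Types (e : bool) (q v : S3 R) (x y : quat R).

Definition qJ q x : quat R := val q * x * qconj (val q).

Lemma qnorm2_qJ q x : qnorm2 (qJ q x) = qnorm2 x.
Proof. by rewrite /qJ !qnorm2M qnorm2_conj S3P mul1r mulr1. Qed.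

Lemma qnorm2_sgn e x : qnorm2 (qsgn R e * x) = qnorm2 x.
Proof. by case: e; rewrite /qsgn ?mul1r // mulN1r qnorm2N. Qed.

Lemma qJM q x y : qJ q (x * y) = qJ q x * qJ q y.
Proof.
rewrite /qJ -!mulrA; congr (_ * (_ * _)).
by rewrite !mulrA S3_Cmul mul1r.
Qed.

Lemma qJ1 q : qJ q 1 = 1.
Proof. by rewrite /qJ mulr1 S3_mulC. Qed.

Lemma qJZ q (a : R) x : qJ q (a *: x) = a *: qJ q x.
Proof. by rewrite /qJ -scalerAr -scalerAl. Qed.

Lemma qJ_eq0 q x : (qJ q x == 0) = (x == 0).
Proof. by rewrite -!qnorm2_eq0 qnorm2_qJ. Qed.

Lemma qJX q x (z : int) : qJ q (x ^ z) = qJ q x ^ z.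
Proof.
have JX (n : nat) : qJ q (x ^+ n) = qJ q x ^+ n.
  by elim: n => [|n IHn]; rewrite ?expr0 ?qJ1 // !exprS qJM IHn.
case: z => n; first by rewrite -!exprnP JX.
rewrite NegzE -!exprnN -!exprVn.
have JV : qJ q x^-1 = (qJ q x)^-1.
  have [->|x0] := eqVneq x 0.
    by rewrite invr0 /qJ mulr0 mul0r invr0.
  have Jx0 : qJ q x \is a GRing.unit by rewrite quat_unitE qJ_eq0.
  apply: (mulrI Jx0); rewrite divrr // -qJM divrr ?qJ1 //.
rewrite -JV; elim: n.+1 => [|m IHm]; rewrite ?expr0 ?qJ1 // !exprS qJM IHm //.
Qed.

Lemma qJ_inj q : injective (qJ q).
Proof.
move=> x y /(congr1 (fun z => qconj (val q) * z * val q)).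
by rewrite /qJ !mulrA !S3_Cmul !mul1r -!mulrA !S3_Cmul !mulr1.
Qed.

Lemma qsgnC e x : qsgn R e * x = x * qsgn R e.
Proof. by case: e; rewrite /qsgn ?mul1r ?mulr1 ?mulN1r ?mulrN1. Qed.

Lemma qsgn_inj e : injective (fun x => qsgn R e * x).
Proof. by case: e => x y; rewrite /qsgn ?mul1r // !mulN1r => /oppr_inj. Qed.

Lemma qJ_sgn e q x : qJ q (qsgn R e * x) = qsgn R e * qJ q x.
Proof. by rewrite /qJ mulrA -qsgnC !mulrA. Qed.

Lemma qJ_so3 q q' : so3_rel q q' -> qJ q' =1 qJ q.
Proof.
move=> /orP[] /eqP qq' x; rewrite /qJ qq' //.
by rewrite qconjN mulNr mulNr mulrN opprK.
Qed.

End Conj.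

Section Milnor.
Variables (R : realType) (k l : int).

(* The disjoint union of two copies of H x S^3: [false] tags the source chart
   of the gluing map and [true] its target chart. *)
Definition charts := (bool * (quat R * S3 R))%type.

Definition glued (x y : quat R * S3 R) : Prop :=
  let u := x.1 in let s := (qnorm u)^-1 *: u in
  [/\ u != 0,
      y.1 = (qnorm u ^+ 2)^-1 *: u
    & val y.2 = s ^ k * val x.2 * s ^ l].

Definition milnor_rel : rel charts := fun x y =>
  `[< match x.1, y.1 with
      | false, true => glued x.2 y.2
      | true, false => glued y.2 x.2
      | _, _ => x.2 = y.2
      end >].

Lemma qnorm_gt0 (x : quat R) : x != 0 -> 0 < qnorm x.
Proof. by move=> x0; rewrite sqrtr_gt0 lt0r qnorm2_eq0 x0 qnorm2_ge0. Qed.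

Lemma qnorm2_dir (x : quat R) : x != 0 -> qnorm2 ((qnorm x)^-1 *: x) = 1.
Proof.
move=> x0; rewrite qnorm2Z exprVn /qnorm sqr_sqrtr ?qnorm2_ge0 // mulVf //.
by rewrite qnorm2_eq0.
Qed.

Fact glued_inj x x' y : glued x y -> glued x' y -> x = x'.
Proof.
case: x x' => [u v] [u' v'] [/= u0 yu yv] [/= u'0 yu' yv'].
have uu' : u = u'.
  have n0 (w : quat R) : w != 0 -> qnorm w ^+ 2 != 0.
    by move=> w0; rewrite expf_neq0 // gt_eqF // qnorm_gt0.
  have nE (w : quat R) : w != 0 ->
      w = (qnorm2 ((qnorm w ^+ 2)^-1 *: w))^-1 *: ((qnorm w ^+ 2)^-1 *: w).
    move=> w0; rewrite qnorm2Z scalerA.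
    have -> : qnorm2 w = qnorm w ^+ 2 by rewrite sqr_sqrtr // qnorm2_ge0.
    have := n0 _ w0; set a := qnorm w ^+ 2 => a0.
    by rewrite -[LHS]scale1r; congr (_ *: _); field.
  by rewrite (nE u u0) (nE u' u'0) -yu -yu'.
subst u'; congr pair; apply: val_inj => /=.
have s1 : (qnorm u)^-1 *: u \is a GRing.unit.
  by rewrite quat_unitE -qnorm2_eq0 qnorm2_dir // oner_eq0.
by apply: (mulrI (unitrXz k s1)); apply: (mulIr (unitrXz l s1)); rewrite -yv.
Qed.

Fact glued_fun x y y' : glued x y -> glued x y' -> y = y'.
Proof.
case: y y' => [a b] [a' b'] [/= _ -> yv] [/= _ -> yv']; congr pair.
by apply: val_inj; rewrite /= yv yv'.
Qed.

Fact milnor_rel_refl : reflexive milnor_rel.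
Proof. by case=> -[] x; apply/asboolP. Qed.
Fact milnor_rel_sym : symmetric milnor_rel.
Proof. by case=> -[] x [[] y]; apply/asboolP/asboolP => /=. Qed.
Fact milnor_rel_trans : transitive milnor_rel.
Proof.
case=> b y [a x] [c z] /asboolP + /asboolP; case: a b c => -[] [] /=;
  try by move=> -> xz; apply/asboolP.
- by move=> xy yz; apply/asboolP; rewrite /= (glued_fun xy yz).
- by move=> xy <-; apply/asboolP.
- by move=> xy <-; apply/asboolP.
- by move=> xy zy; apply/asboolP; rewrite /= (glued_inj xy zy).
Qed.

Canonical milnor_equiv :=
  EquivRel milnor_rel milnor_rel_refl milnor_rel_sym milnor_rel_trans.

Definition milnor := quotient_topology {eq_quot milnor_rel}.
HB.instance Definition _ := Topological.on milnor.
HB.instance Definition _ := Quotient.on milnor.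

Fact chart_act_subproof e (q v : S3 R) :
  qnorm2 (qsgn R e * qJ q (val v)) = 1.
Proof. by rewrite qnorm2_sgn qnorm2_qJ S3P. Qed.

Definition chart_act (e : bool) (q : S3 R) (x : charts) : charts :=
  (x.1, (qJ q x.2.1, mkS3 (chart_act_subproof e q x.2.2))).

(* The representatives are immaterial: see [milnor_actE]. *)
Definition milnor_act (g : pmSO3 R) (x : milnor) : milnor :=
  \pi_milnor (chart_act g.1 (repr g.2) (repr x)).

Lemma chart_act_rel e q q' x y : so3_rel q q' -> milnor_rel x y ->
  milnor_rel (chart_act e q x) (chart_act e q' y).
Proof.
move=> /qJ_so3 qq'.
have -> : chart_act e q' y = chart_act e q y.
  by rewrite /chart_act qq'; congr (_, (_, _)); apply: val_inj; rewrite /= qq'.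
have gl (z t : quat R * S3 R) a b : glued z t ->
    glued (chart_act e q (a, z)).2 (chart_act e q (b, t)).2.
  case: z t => [u v] [u' v'] [u0 u'E v'E].
  have {}u'E : u' = (qnorm u ^+ 2)^-1 *: u := u'E.
  have {}v'E : val v' =
    ((qnorm u)^-1 *: u) ^ k * val v * ((qnorm u)^-1 *: u) ^ l := v'E.
  have nJ : qnorm (qJ q u) = qnorm u by rewrite /qnorm qnorm2_qJ.
  have sgJ A V B : A * (qsgn R e * V) * B = qsgn R e * (A * V * B).
    by rewrite mulrA -qsgnC !mulrA.
  have JE w : (qnorm w)^-1 *: qJ q w = qJ q ((qnorm w)^-1 *: w).
    by rewrite qJZ.
  split.
  - by change (qJ q u != 0); rewrite qJ_eq0.
  - change (qJ q u' = (qnorm (qJ q u) ^+ 2)^-1 *: qJ q u).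
    by rewrite u'E qJZ nJ.
  - change (qsgn R e * qJ q (val v') =
      ((qnorm (qJ q u))^-1 *: qJ q u) ^ k * (qsgn R e * qJ q (val v)) *
      ((qnorm (qJ q u))^-1 *: qJ q u) ^ l).
    by rewrite v'E sgJ nJ JE -!qJX -!qJM.
case: x y => [a x] [b y] /asboolP; case: a b => -[] /= xy; apply/asboolP => /=;
  by [rewrite xy | exact: (gl _ _ true true)].
Qed.

Lemma milnor_actE e q x :
  milnor_act (e, \pi_(SO3 R) q) (\pi_milnor x) = \pi_milnor (chart_act e q x).
Proof.
apply/eqmodP/chart_act_rel => /=.
  by apply/eqmodP; rewrite reprK.
by apply/eqmodP; rewrite reprK.
Qed.

End Milnor.

(* For odd [d], these are the k, l with k + l = 1 and k - l = d. *)
Definition milnor_k (d : int) : int := ((1 + d) %/ 2)%Z.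
Definition milnor_l (d : int) : int := ((1 - d) %/ 2)%Z.

Lemma milnor_klP (d : int) : odd `|d|%N ->
  milnor_k d + milnor_l d = 1 /\ milnor_k d - milnor_l d = d.
Proof. by rewrite /milnor_k /milnor_l; lia. Qed.

Definition M7 (R : realType) (d : int) := milnor R (milnor_k d) (milnor_l d).
HB.instance Definition _ R d := Topological.on (M7 R d).
Definition M7_act (R : realType) (d : int) : pmSO3 R -> M7 R d -> M7 R d :=
  @milnor_act R (milnor_k d) (milnor_l d).

Section GromollMeyer.
Variables (R : realType) (n : int).
Implicit Types (u v : quat R * quat R) (e : bool) (q : S3 R).

Definition sphere7 : set (quat R * quat R) :=
  [set u | qnorm2 u.1 + qnorm2 u.2 = 1].

Definition hprod u v : quat R := qconj u.1 * v.1 + qconj u.2 * v.2.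

Definition S7_polar (t : R) (p w : quat R) : quat R * quat R :=
  ((cos t)%:A + sin t *: p, sin t *: w).

(* [rho u] is the value prescribed by any polar decomposition of u: one exists
   on the unit sphere by [S7_polarP], and [rhoE] shows that the choice is
   irrelevant.  The default value u of [xget] is only used off the sphere. *)
Definition rho u : quat R * quat R :=
  xget u [set y | exists t p w, [/\ qre p = 0, qnorm2 p + qnorm2 w = 1,
                    u = S7_polar t p w & y = S7_polar (n%:~R * t) p w]].

Fact cos_sin_mulz (t t' c s : R) : c ^+ 2 = 1 -> s ^+ 2 = 1 ->
  cos t = c * cos t' -> sin t = c * s * sin t' ->
  cos (n%:~R * t) = c ^+ `|n|%N * cos (n%:~R * t') /\
  sin (n%:~R * t) = c ^+ `|n|%N * s * sin (n%:~R * t').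
Proof.
move=> c1 s1 ct st.
have N (m : nat) : cos (m%:R * t) = c ^+ m * cos (m%:R * t') /\
    sin (m%:R * t) = c ^+ m * s * sin (m%:R * t').
  elim: m => [|m [IHc IHs]]; first by rewrite !mul0r cos0 sin0 expr0 !mulr1 mulr0.
  rewrite -natr1 !mulrDl !mul1r !cosD !sinD IHc IHs ct st exprS; split.
    rewrite mulrBr; congr (_ - _); first by ring.
    transitivity (s ^+ 2 * (c * c ^+ m * (sin (m%:R * t') * sin t'))).
      by ring.
    by rewrite s1 mul1r.
  by ring.
case: n => m; first exact: N.
rewrite NegzE !mulrNz !mulNr !cosN !sinN.
by have [-> ->] := N m.+1; rewrite mulrN.
Qed.

Lemma S7_polarP u : sphere7 u -> exists t p w,
  [/\ qre p = 0, qnorm2 p + qnorm2 w = 1 & u = S7_polar t p w].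
Proof.
case: u => [[a b c d] [a' b' c' d']]; rewrite /sphere7 /qnorm2 /= => u1.
have a1 : -1 <= a <= 1.
  by rewrite -ler_norml -[leRHS]normr1 -ler_sqr ?nnegrE // !real_normK ?num_real //
    expr1n; move: u1; nra.
have ca := acosK a1; set t := acos a in ca *.
have st := cos2Dsin2 t; rewrite ca in st.
have [s0|s0] := eqVneq (sin t) 0.
  exists t, (Quat 0 1 0 0), 0; split=> //.
    by rewrite /qnorm2 /= !expr0n expr1n /= !addr0 add0r.
  have E : b ^+ 2 + c ^+ 2 + d ^+ 2 + a' ^+ 2 + b' ^+ 2 + c' ^+ 2 + d' ^+ 2 = 0.
    by rewrite s0 expr0n addr0 /= in st; move: u1; rewrite st; lra.
  move: E => /eqP; rewrite !paddr_eq0 ?addr_ge0 ?sqr_ge0 // !sqrf_eq0.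
  do 6 (move=> /andP[+ /eqP ?]); move=> /eqP ?; subst b c d a' b' c' d'.
  congr pair; apply/quatP; split=> /=; rewrite s0 ?ca; by ring.
exists t, (Quat 0 (b / sin t) (c / sin t) (d / sin t)),
  ((sin t)^-1 *: Quat a' b' c' d'); split=> //.
  have ss : sin t ^+ 2 = b ^+ 2 + c ^+ 2 + d ^+ 2 +
      (a' ^+ 2 + b' ^+ 2 + c' ^+ 2 + d' ^+ 2) by move: u1 st; lra.
  transitivity ((b ^+ 2 + c ^+ 2 + d ^+ 2 +
      (a' ^+ 2 + b' ^+ 2 + c' ^+ 2 + d' ^+ 2)) / sin t ^+ 2).
    by rewrite /qnorm2 /=; field.
  by rewrite -ss divff // sqrf_eq0.
congr pair; first by apply/quatP; split=> /=; rewrite ?ca; field.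
by rewrite scalerA divff // scale1r.
Qed.

Lemma rhoE t p w : qre p = 0 -> qnorm2 p + qnorm2 w = 1 ->
  rho (S7_polar t p w) = S7_polar (n%:~R * t) p w.
Proof.
move=> p0 pw1; rewrite /rho; case: xgetP => [y _|/(_ (S7_polar (n%:~R * t) p w))];
  last by move=> []; exists t, p, w.
move=> [t' [p' [w' [p'0 pw'1 tt' ->]]]].
have [ct [sp sw]] : cos t' = cos t /\ sin t' *: p' = sin t *: p /\
    sin t' *: w' = sin t *: w.
  move/pair_equal_spec: tt' => [e1 e2]; have ct : cos t' = cos t.
    have := congr1 (@qre R) e1; rewrite /= p0 p'0 !mulr0 !addr0 !mulr1.
    by move=> ->.
  split=> //; split; last by rewrite e2.
  by apply: (addrI (cos t)%:A); rewrite e1 ct.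
have sE (x : R) (p1 w1 : quat R) : qnorm2 p1 + qnorm2 w1 = 1 ->
    qnorm2 (x *: p1) + qnorm2 (x *: w1) = x ^+ 2.
  by move=> E; rewrite !qnorm2Z -mulrDr E mulr1.
have s2 : sin t' ^+ 2 = sin t ^+ 2 by rewrite -(sE _ p' w') // sp sw sE.
have [s0|s0] := eqVneq (sin t) 0.
  have s'0 : sin t' = 0 by apply/eqP; rewrite -sqrf_eq0 s2 s0 expr0n.
  have [||||ctn _] := @cos_sin_mulz t' t 1 1.
  - by rewrite expr1n.
  - by rewrite expr1n.
  - by rewrite mul1r.
  - by rewrite s0 s'0 mulr0.
  have snt0 (x : R) : sin x = 0 -> sin (n%:~R * x) = 0.
    move=> x0; have [||||_] := @cos_sin_mulz x x 1 (-1).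
    - by rewrite expr1n.
    - by rewrite sqrrN expr1n.
    - by rewrite mul1r.
    - by rewrite x0 mulr0.
    by rewrite expr1n; lra.
  by rewrite /S7_polar ctn !snt0 // !scale0r expr1n mul1r.
have [s ss1 ss] : exists2 s, s ^+ 2 = 1 & sin t' = s * sin t.
  exists (sin t' / sin t); last by rewrite divfK.
  by rewrite exprMn exprVn s2 divff // sqrf_eq0.
have [||||ctn stn] := @cos_sin_mulz t' t 1 s.
- by rewrite expr1n.
- by [].
- by rewrite mul1r.
- by rewrite mul1r.
have sK (a b : quat R) : sin t' *: a = sin t *: b -> s *: a = b.
  move=> ab; apply: (scalerI s0); rewrite -ab ss !scalerA; congr (_ *: _).
  by rewrite mulrC.
rewrite /S7_polar ctn stn expr1n !mul1r -(sK _ _ sp) -(sK _ _ sw) !scalerA.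
by rewrite [s * _]mulrC.
Qed.

Lemma rhoN u : sphere7 u -> rho (- u.1, - u.2) =
  ((-1) ^+ `|n|%N *: (rho u).1, (-1) ^+ `|n|%N *: (rho u).2).
Proof.
move=> /S7_polarP[t [p [w [p0 pw1 ->]]]]; rewrite (rhoE t p0 pw1).
have -> : (- (S7_polar t p w).1, - (S7_polar t p w).2) = S7_polar (t + pi) p w.
  by rewrite /S7_polar cosDpi sinDpi /= !scaleNr opprD.
rewrite (rhoE _ p0 pw1) /S7_polar.
have [||||-> ->] := @cos_sin_mulz (t + pi) t (-1) 1.
- by rewrite sqrrN expr1n.
- by rewrite expr1n.
- by rewrite cosDpi mulN1r.
- by rewrite sinDpi mulr1 mulN1r.
by rewrite mulr1 /= scalerDr !scalerA.
Qed.

Definition E10 : set ((quat R * quat R) * (quat R * quat R)) :=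
  [set x | [/\ sphere7 x.1, sphere7 x.2 & hprod (rho x.1) x.2 = 0]].

Definition star q (x : (quat R * quat R) * (quat R * quat R)) :=
  ((qJ q x.1.1, qJ q x.1.2), (val q * x.2.1, val q * x.2.2)).

Lemma rho_qJ q u : sphere7 u ->
  rho (qJ q u.1, qJ q u.2) = (qJ q (rho u).1, qJ q (rho u).2).
Proof.
move=> /S7_polarP[t [p [w [p0 pw1 ->]]]]; rewrite (rhoE t p0 pw1).
have JA (a : R) : qJ q a%:A = a%:A by rewrite qJZ qJ1.
have JD x y : qJ q (x + y) = qJ q x + qJ q y by rewrite /qJ mulrDr mulrDl.
have Jp s : (qJ q (S7_polar s p w).1, qJ q (S7_polar s p w).2) =
    S7_polar s (qJ q p) (qJ q w) by rewrite /S7_polar /= JD JA !qJZ.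
rewrite !Jp rhoE ?qnorm2_qJ //.
have qC x : qconj (qJ q x) = qJ q (qconj x).
  by rewrite /qJ !qconjM qconjK mulrA.
have CE (x : quat R) : qre x = 0 <-> qconj x = - x.
  split=> [x0|/(congr1 (@qre R)) /= xN]; last by lra.
  by apply/quatP; split=> //=; rewrite x0 oppr0.
by apply/CE; rewrite qC (CE p).1 // /qJ mulrN mulNr.
Qed.

Lemma E10_star q x : E10 x -> E10 (star q x).
Proof.
case: x => [[a b] [c d]] [su sv uv]; split.
- change (qnorm2 (qJ q a) + qnorm2 (qJ q b) = 1).
  by rewrite !qnorm2_qJ; exact: su.
- change (qnorm2 (val q * c) + qnorm2 (val q * d) = 1).
  by rewrite !qnorm2M S3P !mul1r; exact: sv.
change (hprod (rho (qJ q a, qJ q b)) (val q * c, val q * d) = 0).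
rewrite (rho_qJ q su); move: (uv : hprod (rho (a, b)) (c, d) = 0).
case: rho => r1 r2; rewrite /hprod => E.
have JE x y : qconj (qJ q x) * (val q * y) = val q * (qconj x * y).
  by rewrite /qJ !qconjM qconjK -!mulrA (mulrA (qconj (val q))) S3_Cmul mul1r.
change (qconj (qJ q r1) * (val q * c) + qconj (qJ q r2) * (val q * d) = 0).
by rewrite !JE -mulrDr; move: E => /= ->; rewrite mulr0.
Qed.

Definition star_rel : rel E10 := fun x y =>
  `[< exists q, val y = star q (val x) >].

Fact star_rel_refl : reflexive star_rel.
Proof.
move=> x; apply/asboolP; exists (mkS3 (qnorm21 R)).
by case: (val x) => [[a b] [c d]]; rewrite /star /qJ /= qconj1 !mul1r !mulr1.
Qed.

Fact star_inv q (x y : (quat R * quat R) * (quat R * quat R)) :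
  y = star q x -> exists q', x = star q' y.
Proof.
move=> ->; have q'1 : qnorm2 (qconj (val q)) = 1 by rewrite qnorm2_conj S3P.
exists (mkS3 q'1); case: x => [[a b] [c d]].
rewrite /star /qJ; change (val (mkS3 q'1)) with (qconj (val q)).
by rewrite qconjK /= !mulrA !S3_Cmul !mul1r -!mulrA !S3_Cmul !mulr1.
Qed.

Fact star_rel_sym : symmetric star_rel.
Proof.
by move=> x y; apply/asboolP/asboolP => -[q /star_inv].
Qed.

Fact star_comp q q' x : exists q'', star q' (star q x) = star q'' x.
Proof.
have q1 : qnorm2 (val q' * val q) = 1 by rewrite qnorm2M !S3P mulr1.
exists (mkS3 q1); case: x => [[a b] [c d]].
rewrite /star /qJ; change (val (mkS3 q1)) with (val q' * val q).
by rewrite qconjM /= !mulrA.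
Qed.

Fact star_rel_trans : transitive star_rel.
Proof.
move=> y x z /asboolP[q yx] /asboolP[q' zy]; apply/asboolP.
by have [q'' E] := star_comp q q' (val x); exists q''; rewrite zy yx.
Qed.

Canonical star_equiv :=
  EquivRel star_rel star_rel_refl star_rel_sym star_rel_trans.

Definition gromoll_meyer := quotient_topology {eq_quot star_rel}.
HB.instance Definition _ := Topological.on gromoll_meyer.
HB.instance Definition _ := Quotient.on gromoll_meyer.

Definition bullet e q (x : (quat R * quat R) * (quat R * quat R)) :=
  ((qsgn R e * x.1.1, qsgn R e * x.1.2),
   (qsgn R e * x.2.1 * qconj (val q), qsgn R e * x.2.2 * qconj (val q))).

Fact bullet_subproof e q (x : E10) : E10 (bullet e q (val x)).
Proof.
have [] : E10 (val x) := set_valP x.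
move: (val x) => [[a b] [c d]] su sv uv.
have q1 : qnorm2 (qconj (val q)) = 1 by rewrite qnorm2_conj S3P.
split.
- change (qnorm2 (qsgn R e * a) + qnorm2 (qsgn R e * b) = 1).
  by rewrite !qnorm2_sgn; exact: su.
- change (qnorm2 (qsgn R e * c * qconj (val q)) +
    qnorm2 (qsgn R e * d * qconj (val q)) = 1).
  rewrite !(qnorm2M (_ * _)) q1 !mulr1 !qnorm2_sgn; exact: sv.
have [s sE] : exists s : R, rho (qsgn R e * a, qsgn R e * b) =
    (s *: (rho (a, b)).1, s *: (rho (a, b)).2).
  case: e; last by exists 1; rewrite /qsgn !mul1r !scale1r; case: rho.
  by exists ((-1) ^+ `|n|%N); rewrite /qsgn !mulN1r -(rhoN su).
have CZ (r : quat R) : qconj (s *: r) = s *: qconj r.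
  by apply/quatP; split=> //=; rewrite mulrN.
have hE r1 r2 : hprod (s *: r1, s *: r2)
    (qsgn R e * c * qconj (val q), qsgn R e * d * qconj (val q)) =
    s *: (qsgn R e * hprod (r1, r2) (c, d) * qconj (val q)).
  have mE x1 x2 x3 : qconj (s *: x1) * (qsgn R e * x2 * x3) =
      s *: (qsgn R e * (qconj x1 * x2) * x3).
    by rewrite CZ -scalerAl; congr (_ *: _); rewrite !mulrA -qsgnC.
  by rewrite /hprod /= !mE -scalerDr -mulrDl -mulrDr.
have {}uv : hprod (rho (a, b)) (c, d) = 0 := uv.
change (hprod (rho (qsgn R e * a, qsgn R e * b))
  (qsgn R e * c * qconj (val q), qsgn R e * d * qconj (val q)) = 0).
rewrite sE hE; move: uv; case: rho => r1 r2 ->.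
by rewrite mulr0 mul0r scaler0.
Qed.

Definition E10_act e q (x : E10) : E10 :=
  exist _ (bullet e q (val x)) (mem_set (bullet_subproof e q x)).

(* The representatives are immaterial: see [gromoll_meyer_actE]. *)
Definition gromoll_meyer_act (g : pmSO3 R) (x : gromoll_meyer) :
    gromoll_meyer :=
  \pi_gromoll_meyer (E10_act g.1 (repr g.2) (repr x)).

Lemma gromoll_meyer_actE e q (x : E10) :
  gromoll_meyer_act (e, \pi_(SO3 R) q) (\pi_gromoll_meyer x) =
  \pi_gromoll_meyer (E10_act e q x).
Proof.
apply/eqmodP/asboolP; set q' := repr _; set y := repr _.
have [b q'E] : exists b, val q' = qsgn R b * val q.
  have /orP[] : so3_rel q q' by rewrite so3_rel_sym; apply/eqmodP; rewrite reprK.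
    by move=> /eqP ->; exists false; rewrite /qsgn mul1r.
  by move=> /eqP ->; exists true; rewrite /qsgn mulN1r.
have /asboolP[r xy] : star_rel y x by apply/eqmodP; rewrite reprK.
clearbody q' y.
have s1 : qnorm2 (qsgn R b * val r) = 1 by rewrite qnorm2_sgn S3P.
exists (mkS3 s1).
change (bullet e q (val x) = star (mkS3 s1) (bullet e q' (val y))).
rewrite xy; case: (val y) => [[u1 u2] [v1 v2]].
have Jb z : qJ (mkS3 s1) z = qJ r z.
  by apply: qJ_so3; case: b {q'E} s1 => s1; rewrite /so3_rel /= /qsgn
    ?mul1r ?mulN1r eqxx ?orbT.
have vE z : qsgn R e * (val r * z) * qconj (val q) =
    val (mkS3 s1) * (qsgn R e * z * qconj (val q')).
  rewrite q'E; change (val (mkS3 s1)) with (qsgn R b * val r).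
  case: b {q'E Jb s1}; case: e;
  by rewrite /qsgn ?mul1r ?mulN1r ?qconjN ?(mulNr, mulrN) ?opprK ?mulrA.
by congr (_, _, (_, _)); rewrite ?Jb ?qJ_sgn // vE.
Qed.

End GromollMeyer.

Definition homeomorphic (X Y : topologicalType) : Prop :=
  exists (f : X -> Y) (g : Y -> X),
    [/\ continuous f, continuous g, cancel f g & cancel g f].

Definition equivariantly_homeomorphic (G : Type) (X Y : topologicalType)
    (aX : G -> X -> X) (aY : G -> Y -> Y) : Prop :=
  exists (f : X -> Y) (g : Y -> X),
    [/\ continuous f, continuous g, cancel f g & cancel g f] /\
    forall a x, f (aX a x) = aY a (f x).

Definition fixed_points (G X : Type) (act : G -> X -> X) (a : G) : set X :=
  [set x | act a x = x].

Section Lens.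
Variables (R : realType) (p q : nat).

(* With H = C + Cj, this is the map z + wj |-> e^(is) z + e^(it) w j. *)
Definition biplane_rot (s t : R) (x : quat R) : quat R :=
  Quat (cos s * qre x - sin s * qi x) (sin s * qre x + cos s * qi x)
       (cos t * qj x - sin t * qk x) (sin t * qj x + cos t * qk x).

Lemma biplane_rotD s t s' t' x :
  biplane_rot s t (biplane_rot s' t' x) = biplane_rot (s + s') (t + t') x.
Proof. by apply/quatP; rewrite /= !cosD !sinD; split; ring. Qed.

Definition lens_angle (m : int) : R := m%:~R * (2 * pi / p%:R).

(* The orbits of Z/p acting on S^3 by (z, w) |-> (zeta^m z, zeta^(q m) w),
   zeta = e^(2 pi i / p). *)
Definition lens_rel : rel (S3 R) := fun x y =>
  `[< exists m : int,
      val y = biplane_rot (lens_angle m) (q%:R * lens_angle m) (val x) >].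

Fact lens_rel_refl : reflexive lens_rel.
Proof.
move=> x; apply/asboolP; exists 0; apply/quatP.
by rewrite /lens_angle /= !mul0r mulr0 cos0 sin0; split; ring.
Qed.
Fact lens_rel_sym : symmetric lens_rel.
Proof.
have L x y : lens_rel x y -> lens_rel y x.
  move=> /asboolP[m yx]; apply/asboolP; exists (- m).
  rewrite yx biplane_rotD /lens_angle mulrNz mulNr mulrN !addNr.
  by apply/quatP; rewrite /= cos0 sin0; split; ring.
by move=> x y; apply/idP/idP => /L.
Qed.
Fact lens_rel_trans : transitive lens_rel.
Proof.
move=> y x z /asboolP[m yx] /asboolP[m' zy]; apply/asboolP.
exists (m' + m); rewrite zy yx biplane_rotD /lens_angle.
by congr biplane_rot; rewrite ?intrD; ring.
Qed.

Canonical lens_equiv := EquivRel lens_rel lens_rel_refl lens_rel_sym lens_rel_trans.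

Definition lens_space := quotient_topology {eq_quot lens_rel}.
HB.instance Definition _ := Topological.on lens_space.
HB.instance Definition _ := Quotient.on lens_space.

End Lens.

(* The lens spaces L(p, q), including S^3 = L(1, q). *)
Definition is_lens_space (R : realType) (X : topologicalType) : Prop :=
  exists p q : nat, [/\ (0 < p)%N, coprime p q & homeomorphic X (lens_space R p q)].

Section UnitInterval.
Variable R : realType.

Definition unitI : Type := set_type `[0 : R, 1]%classic.
HB.instance Definition _ := Topological.copy unitI (set_type `[0 : R, 1]%classic).

Fact clampI_subproof (t : R) : `[0 : R, 1]%classic (Num.max 0 (Num.min t 1)).
Proof. by rewrite /= in_itv /= le_max lexx /= ge_max ler01 ge_min lexx orbT. Qed.
(* Retraction of the line onto [0, 1]; it lets affine changes of parameter be
   written without carrying bounds. *)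
Definition clampI (t : R) : unitI :=
  exist (fun x => x \in `[0 : R, 1]%classic) _ (mem_set (clampI_subproof t)).

Definition valI (s : unitI) : R := set_val s.

Lemma valI_itv s : 0 <= valI s <= 1.
Proof. by have := set_valP s; rewrite /= in_itv. Qed.

Lemma valI_continuous : continuous valI.
Proof. exact: initial_continuous. Qed.

Lemma clampI_continuous : continuous clampI.
Proof.
move=> t U /= [_ [[V oV <-] Vt VU]].
have cc : continuous ((fun=> 0 : R) \max ((id : R -> R) \min (fun=> 1 : R))).
  apply: max_fun_continuous; first exact: cst_continuous.
  by apply: min_fun_continuous => [x|]; [exact: cvg_id|exact: cst_continuous].
have Vm : nbhs (Num.max 0 (Num.min t 1)) V by exact: open_nbhs_nbhs.
suff : nbhs t (clampI @^-1` U) by [].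
apply: (@filterS _ (nbhs t) _ ((fun x => Num.max 0 (Num.min x 1)) @^-1` V)).
  by move=> s Vs; exact: VU.
exact: cc t V Vm.
Qed.

Lemma clampIK s : clampI (valI s) = s.
Proof.
apply: val_inj; have /andP[s0 s1] := valI_itv s.
change (Num.max 0 (Num.min (valI s) 1) = valI s).
by rewrite min_l // max_r.
Qed.

Lemma valIK t : 0 <= t <= 1 -> valI (clampI t) = t.
Proof.
move=> /andP[t0 t1]; change (Num.max 0 (Num.min t 1) = t).
by rewrite min_l // max_r.
Qed.

Fact unitI_neq : clampI 0 != clampI 1.
Proof.
apply/eqP => /(congr1 valI); rewrite !valIK ?lexx ?ler01 //.
by move=> /eqP; rewrite eq_sym oner_eq0.
Qed.
HB.instance Definition _ := isBiPointed.Build unitI unitI_neq.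

Lemma paste_continuous (S X : topologicalType) (h : S -> R) (F G : S -> X) :
  continuous h -> continuous F -> continuous G ->
  (forall s, h s = 2^-1 -> F s = G s) ->
  continuous (fun s => if h s <= 2^-1 then F s else G s).
Proof.
move=> ch cF cG FG; apply/continuous_subspace_setT.
have -> : setT = (h @^-1` [set x | x <= 2^-1]) `|` (h @^-1` [set x | 2^-1 <= x]).
  by apply/seteqP; split=> // s _ /=; apply/orP; exact: le_total.
apply: withinU_continuous.
- by apply: closed_comp => [? _|]; [exact: ch|exact: closed_le].
- by apply: closed_comp => [? _|]; [exact: ch|exact: closed_ge].
- apply: (@subspace_eq_continuous _ _ _ F); last exact: continuous_subspaceT.
  move=> s; rewrite inE => hs; have {}hs : h s <= 2^-1 := hs.
  by rewrite /from_subspace /= hs.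
- apply: (@subspace_eq_continuous _ _ _ G); last exact: continuous_subspaceT.
  move=> s; rewrite inE => hs; have {}hs : 2^-1 <= h s := hs.
  rewrite /from_subspace /=; case: ifPn => // hs'.
  by rewrite FG //; apply/le_anti; rewrite hs hs'.
Qed.

Fact pair_continuous (S T U : topologicalType) (f : S -> T) (g : S -> U) :
  continuous f -> continuous g -> continuous (fun s => (f s, g s)).
Proof.
move=> cf cg s; apply: (@cvg_pair _ _ _ (nbhs s) (nbhs (f s)) (nbhs (g s))
  _ _ _ f g (cf s) (cg s)).
Qed.

Fact comp_continuous (S T U : topologicalType) (f : S -> T) (g : T -> U) :
  continuous f -> continuous g -> continuous (fun s => g (f s)).
Proof. by move=> cf cg s; apply: continuous_comp; [exact: cf|exact: cg]. Qed.

Fact fst_continuous (S T : topologicalType) : continuous (@fst S T).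
Proof. by move=> s; exact: cvg_fst. Qed.

Fact snd_continuous (S T : topologicalType) : continuous (@snd S T).
Proof. by move=> s; exact: cvg_snd. Qed.

Lemma clamp_affine_continuous (S : topologicalType) (a b : R) (h : S -> R) :
  continuous h -> continuous (fun s => clampI (a * h s + b)).
Proof.
move=> ch s; apply: continuous_comp; last exact: clampI_continuous.
by apply: cvgD; [apply: cvgM; [exact: cvg_cst|exact: ch]|exact: cvg_cst].
Qed.

End UnitInterval.

Section Pi1.
Variables (R : realType) (X : topologicalType) (x0 : X).

Definition loop := {path (unitI R) from x0 to x0 in X}.

Definition loop_rel : rel loop := fun f g =>
  `[< exists H : unitI R * unitI R -> X,
      [/\ continuous H,
          forall s, H (s, zero) = f s,
          forall s, H (s, one) = g s
        & forall t, H (zero, t) = x0 /\ H (one, t) = x0] >].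

Fact loop_rel_refl : reflexive loop_rel.
Proof.
move=> f; apply/asboolP; exists (fun p => f p.1); split=> //.
  by apply: (comp_continuous (@fst_continuous _ _)) => x; exact: cts_fun.
by move=> t; rewrite path_zero path_one.
Qed.

Fact loop_rel_sym : symmetric loop_rel.
Proof.
have L f g : loop_rel f g -> loop_rel g f.
  move=> /asboolP[H [cH H0 H1 Hx]]; apply/asboolP.
  exists (fun p => H (p.1, clampI ((-1) * valI p.2 + 1))); split=> //=.
  - apply: (comp_continuous _ cH).
    apply: pair_continuous; first exact: fst_continuous.
    apply: clamp_affine_continuous.
    exact: (comp_continuous (@snd_continuous _ _) (@valI_continuous R)).
  - move=> s; rewrite -H1; congr (H (_, _)).
    by rewrite valIK ?lexx ?ler01 // mulr0 add0r.
  - move=> s; rewrite -H0; congr (H (_, _)).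
    by rewrite valIK ?lexx ?ler01 // mulr1 addNr.
by move=> f g; apply/idP/idP => /L.
Qed.

Fact half_lt1 : (2^-1 : R) < 1.
Proof. by rewrite invf_lt1 ?ltr1n. Qed.

Fact loop_rel_trans : transitive loop_rel.
Proof.
move=> g f h /asboolP[H [cH H0 H1 Hx]] /asboolP[K [cK K0 K1 Kx]].
apply/asboolP.
exists (fun p => if valI p.2 <= 2^-1 then H (p.1, clampI (2 * valI p.2 + 0))
                 else K (p.1, clampI (2 * valI p.2 + (-1)))).
have cv : continuous (fun p : unitI R * unitI R => valI p.2).
  exact: (comp_continuous (@snd_continuous _ _) (@valI_continuous R)).
split.
- apply: (paste_continuous cv) => [||p ->].
  + apply: (comp_continuous _ cH); apply: pair_continuous.
      exact: fst_continuous.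
    exact: clamp_affine_continuous.
  + apply: (comp_continuous _ cK); apply: pair_continuous.
      exact: fst_continuous.
    exact: clamp_affine_continuous.
  + by rewrite addr0 divff // subrr; rewrite H1 K0.
- by move=> s; rewrite /= valIK ?lexx ?ler01 // invr_ge0 ler0n mulr0 addr0 H0.
- move=> s; rewrite /= valIK ?lexx ?ler01 // leNgt half_lt1 /=.
  by rewrite mulr1 (_ : 2 - 1 = 1); [exact: K1|ring].
- by move=> t /=; case: ifP.
Qed.

Canonical loop_equiv := EquivRel loop_rel loop_rel_refl loop_rel_sym loop_rel_trans.

(* On its branch each argument of [clampI] already lies in [0, 1]. *)
Definition cat_fun (f g : unitI R -> X) : unitI R -> X := fun s =>
  if valI s <= 2^-1 then f (clampI (2 * valI s + 0))
  else g (clampI (2 * valI s + (-1))).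

Section Cat.
Variables f g : loop.
Fact cat_fun_continuous : continuous (cat_fun f g).
Proof.
apply: (paste_continuous (@valI_continuous R)) => [||s ->].
- apply: (comp_continuous _ (fun x => @cts_fun _ _ _ x)).
  exact/clamp_affine_continuous/valI_continuous.
- apply: (comp_continuous _ (fun x => @cts_fun _ _ _ x)).
  exact/clamp_affine_continuous/valI_continuous.
- by rewrite addr0 divff // subrr -/zero -/one path_one path_zero.
Qed.
Fact cat_fun0 : cat_fun f g zero = x0.
Proof.
rewrite /cat_fun valIK ?lexx ?ler01 // invr_ge0 ler0n mulr0 addr0.
exact: path_zero.
Qed.
Fact cat_fun1 : cat_fun f g one = x0.
Proof.
rewrite /cat_fun valIK ?lexx ?ler01 // leNgt half_lt1 /=.
rewrite mulr1 (_ : 2 - 1 = 1); last by ring.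
exact: path_one.
Qed.

Definition loop_cat : loop := mk_path cat_fun_continuous cat_fun0 cat_fun1.
End Cat.

Lemma loop_cat_rel f f' g g' : loop_rel f f' -> loop_rel g g' ->
  loop_rel (loop_cat f g) (loop_cat f' g').
Proof.
move=> /asboolP[H [cH H0 H1 Hx]] /asboolP[K [cK K0 K1 Kx]]; apply/asboolP.
exists (fun p => if valI p.1 <= 2^-1 then H (clampI (2 * valI p.1 + 0), p.2)
                 else K (clampI (2 * valI p.1 + (-1)), p.2)).
have cv : continuous (fun p : unitI R * unitI R => valI p.1).
  exact: (comp_continuous (@fst_continuous _ _) (@valI_continuous R)).
split.
- apply: (paste_continuous cv) => [||p ->].
  + apply: (comp_continuous _ cH); apply: pair_continuous.
      exact: clamp_affine_continuous.
    exact: snd_continuous.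
  + apply: (comp_continuous _ cK); apply: pair_continuous.
      exact: clamp_affine_continuous.
    exact: snd_continuous.
  + by rewrite addr0 divff // subrr; rewrite (Hx p.2).2 (Kx p.2).1.
- by move=> s /=; rewrite H0 K0.
- by move=> s /=; rewrite H1 K1.
- move=> t; split; rewrite /= valIK ?lexx ?ler01 //.
    by rewrite invr_ge0 ler0n mulr0 addr0 (Hx t).1.
  rewrite leNgt half_lt1 /= mulr1 (_ : 2 - 1 = 1); last by ring.
  by rewrite (Kx t).2.
Qed.

Definition pi1 := {eq_quot loop_rel}.
HB.instance Definition _ := Choice.on pi1.
HB.instance Definition _ := EqQuotient.on pi1.

Definition pi1_mul (a b : pi1) : pi1 := \pi_pi1 (loop_cat (repr a) (repr b)).

Lemma pi1_mulE f g : pi1_mul (\pi_pi1 f) (\pi_pi1 g) = \pi_pi1 (loop_cat f g).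
Proof.
by apply/eqmodP/loop_cat_rel; apply/eqmodP; rewrite reprK.
Qed.

End Pi1.

(* 'I_m.-1.+1 is the additive group Z/m for m > 0, the trivial group for
   m = 1. *)
Definition pi1_cyclic (R : realType) (X : topologicalType) (x0 : X) (m : nat) :
    Prop :=
  (0 < m)%N /\ exists phi : pi1 R x0 -> 'I_m.-1.+1,
    bijective phi /\ forall a b, phi (pi1_mul a b) = phi a + phi b.

(* Main.v *)
Require Import Defs.
From mathcomp Require Import all_boot all_order all_algebra.
From mathcomp Require Import all_classical all_reals all_analysis.
From mathcomp Require Import homotopy.
From mathcomp Require Import ring lra zify.

(** The fixed point set of the involution is computed in both families as a
    quotient of the 3-sphere of pairs [(z, w)] of complex numbers.

    A point [(u, v)] of a chart of [M7 R d] is fixed when [u] is complex and [v]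
    is a complex multiple of [j].  Since [j] conjugates complex numbers, the
    gluing map becomes [(u, x j) |-> (u / |u|^2, (u / |u|)^d x j)]: two solid
    tori glued with twist [d].  The map that sends [z + w j] to
    [(z / w, (w / |w|)^d j)] in one chart and to [(z / w / |z / w|^2,
    (z / |z|)^d j)] in the other is onto the fixed point set, and its fibres are
    the orbits of the diagonal action of the [|d|]-th roots of unity
    ([fixed_param_fibre], [fixed_param_surj]).  The Milnor manifold is Hausdorff
    ([milnor_hausdorff]) and the sphere is compact, so the fixed point set is
    the lens space [L(|d|, 1)] ([fixed_milnor_lens]).

    For a fixed point of the generalized Gromoll-Meyer sphere there is a unit
    quaternion [q] with [q u (conj q) = - u] and [q v = v i].  A change of
    representative makes [q] equal to [i] ([fixed_normal_form]); then [v] is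
    complex and [u = (z j, w j)] lies on the equator, where [rho n] is rotation
    by [n] right angles.  What remains is the action of the unit complex
    numbers, and the same recognition gives [L(1, 1)] for even [n] and
    [L(3, 1)] for odd [n] as soon as the fixed point set is Hausdorff
    ([fixed_gromoll_meyer_lens]); this holds when it is homeomorphic to that of
    a Milnor sphere.

    The spaces [L(p, 1)] are told apart by their fundamental groups.  Maps of a
    square into [L(p, 1)] lift to the sphere ([lens_lift]): cut the rays of the
    square into steps so short that there is only one nearby representative to
    move to.  The end point of the lift of a loop defines its degree in [Z/p].
    Loops of equal degree are homotopic because the 3-sphere is simply
    connected ([S3_loop_contractible]): a loop is close to a polygon, and a
    polygon in 4-space misses a ray from the origin.  Hence the fundamental
    group is cyclic of order [p] ([lens_pi1_cyclic]).

    An equivariant homeomorphism restricts to the fixed point sets, so it forces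
    [|d| = |d'|], respectively [|d| = 1] or [|d| = 3].  Conversely, conjugation
    in both coordinates exchanges the exponents [k] and [l] of the gluing map
    and so identifies [M7 R d] with [M7 R (- d)] ([milnor_conj_equivariant]). *)

Set Implicit Arguments.
Unset Strict Implicit.
Unset Printing Implicit Defensive.

Import Order.TTheory GRing.Theory Num.Theory.
Import numFieldNormedType.Exports.

Local Open Scope classical_set_scope.
Local Open Scope ring_scope.
Local Open Scope quotient_scope.

(** * Topology of the quaternions *)

Section InitialTopology.
Variables (S : choiceType) (T : topologicalType) (f : S -> T).

Lemma cvg_initial (F : set_system S) (s : S) : Filter F ->
  f x @[x --> F] --> f s -> F --> (s : initial_topology f).
Proof.
move=> FF Ff A /= [_ [[B oB <-] Bs BA]].
have /Ff FB : nbhs (f s) B by exact: open_nbhs_nbhs.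
exact: filterS BA FB.
Qed.

End InitialTopology.

Section QuatTopology.
Variable R : realType.
Implicit Types (x y : quat R) (X : topologicalType).

Lemma quat_coord_continuous : continuous (@quat_coord R).
Proof. exact: initial_continuous. Qed.

Lemma qre_continuous : continuous (@qre R).
Proof.
move=> x; apply: (@continuous_comp _ _ _ (@quat_coord R) (fun c => c.1.1.1)).
  exact: quat_coord_continuous.
apply: continuous_comp; last exact: cvg_fst.
by apply: continuous_comp; exact: cvg_fst.
Qed.

Lemma qi_continuous : continuous (@qi R).
Proof.
move=> x; apply: (@continuous_comp _ _ _ (@quat_coord R) (fun c => c.1.1.2)).
  exact: quat_coord_continuous.
apply: continuous_comp; last exact: cvg_snd.
by apply: continuous_comp; exact: cvg_fst.
Qed.

Lemma qj_continuous : continuous (@qj R).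
Proof.
move=> x; apply: (@continuous_comp _ _ _ (@quat_coord R) (fun c => c.1.2)).
  exact: quat_coord_continuous.
by apply: continuous_comp; [exact: cvg_fst|exact: cvg_snd].
Qed.

Lemma qk_continuous : continuous (@qk R).
Proof.
move=> x; apply: (@continuous_comp _ _ _ (@quat_coord R) (fun c => c.2)).
  exact: quat_coord_continuous.
exact: cvg_snd.
Qed.

Section Cvg.
Context {T : Type} (F : set_system T) {FF : Filter F}.
Implicit Types (f g : T -> quat R) (a : T -> R).

Lemma cvg_quat f x :
  qre (f t) @[t --> F] --> qre x -> qi (f t) @[t --> F] --> qi x ->
  qj (f t) @[t --> F] --> qj x -> qk (f t) @[t --> F] --> qk x ->
  f t @[t --> F] --> x.
Proof.
move=> c0 c1 c2 c3.
apply: (@cvg_initial _ _ (@quat_coord R) (f t @[t --> F]) x).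
exact: cvg_pair (cvg_pair (cvg_pair c0 c1) c2) c3.
Qed.

Lemma cvg_qcoord f x : f t @[t --> F] --> x ->
  [/\ qre (f t) @[t --> F] --> qre x, qi (f t) @[t --> F] --> qi x,
      qj (f t) @[t --> F] --> qj x & qk (f t) @[t --> F] --> qk x].
Proof.
move=> fx; split.
- exact: cvg_comp fx (@qre_continuous x).
- exact: cvg_comp fx (@qi_continuous x).
- exact: cvg_comp fx (@qj_continuous x).
- exact: cvg_comp fx (@qk_continuous x).
Qed.

Lemma cvg_qD f g x y : f t @[t --> F] --> x -> g t @[t --> F] --> y ->
  (f t + g t) @[t --> F] --> x + y.
Proof.
move=> /cvg_qcoord[f0 f1 f2 f3] /cvg_qcoord[g0 g1 g2 g3].
by apply: cvg_quat; exact: cvgD.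
Qed.

Lemma cvg_qN f x : f t @[t --> F] --> x -> (- f t) @[t --> F] --> - x.
Proof.
by move=> /cvg_qcoord[f0 f1 f2 f3]; apply: cvg_quat; exact: cvgN.
Qed.

Lemma cvg_qZ a f (b : R) x : a t @[t --> F] --> b -> f t @[t --> F] --> x ->
  (a t *: f t) @[t --> F] --> b *: x.
Proof.
by move=> ab /cvg_qcoord[f0 f1 f2 f3]; apply: cvg_quat; exact: cvgM.
Qed.

Lemma cvg_qM f g x y : f t @[t --> F] --> x -> g t @[t --> F] --> y ->
  (f t * g t) @[t --> F] --> x * y.
Proof.
move=> /cvg_qcoord[f0 f1 f2 f3] /cvg_qcoord[g0 g1 g2 g3].
apply: cvg_quat => /=.
- exact: cvgB (cvgB (cvgB (cvgM f0 g0) (cvgM f1 g1)) (cvgM f2 g2)) (cvgM f3 g3).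
- exact: cvgB (cvgD (cvgD (cvgM f0 g1) (cvgM f1 g0)) (cvgM f2 g3)) (cvgM f3 g2).
- exact: cvgD (cvgD (cvgB (cvgM f0 g2) (cvgM f1 g3)) (cvgM f2 g0)) (cvgM f3 g1).
- exact: cvgD (cvgB (cvgD (cvgM f0 g3) (cvgM f1 g2)) (cvgM f2 g1)) (cvgM f3 g0).
Qed.

Lemma cvg_qconj f x : f t @[t --> F] --> x ->
  qconj (f t) @[t --> F] --> qconj x.
Proof.
by move=> /cvg_qcoord[f0 f1 f2 f3]; apply: cvg_quat => //; exact: cvgN.
Qed.

Lemma cvg_qnorm2 f x : f t @[t --> F] --> x ->
  qnorm2 (f t) @[t --> F] --> qnorm2 x.
Proof.
move=> /cvg_qcoord[f0 f1 f2 f3].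
exact: cvgD (cvgD (cvgD (cvgM f0 f0) (cvgM f1 f1)) (cvgM f2 f2)) (cvgM f3 f3).
Qed.

Lemma cvg_qnorm f x : f t @[t --> F] --> x ->
  qnorm (f t) @[t --> F] --> qnorm x.
Proof.
by move=> /cvg_qnorm2 fx; apply: cvg_comp fx _; exact: sqrt_continuous.
Qed.

Lemma cvg_qX f x n : f t @[t --> F] --> x ->
  (f t ^+ n) @[t --> F] --> x ^+ n.
Proof.
move=> fx; elim: n => [|n IHn].
  exact: cvg_cst.
rewrite exprS; under eq_cvg do rewrite exprS.
exact: cvg_qM.
Qed.

Lemma cvg_qV f x : x != 0 -> f t @[t --> F] --> x ->
  (f t)^-1 @[t --> F] --> x^-1.
Proof.
move=> x0 fx; change ((qinv (f t)) @[t --> F] --> qinv x).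
apply: cvg_qZ; last exact: cvg_qconj.
by apply: cvgV; [rewrite qnorm2_eq0|exact: cvg_qnorm2].
Qed.

Lemma cvg_qXz f x (n : int) : x != 0 -> f t @[t --> F] --> x ->
  (f t ^ n) @[t --> F] --> x ^ n.
Proof.
case: n => n x0 fx; first exact: cvg_qX.
have E y : y ^ Negz n = y^-1 ^+ n.+1 by rewrite NegzE -exprnN exprVn.
rewrite E; under eq_cvg do rewrite E.
by apply: cvg_qX; exact: cvg_qV.
Qed.

End Cvg.

Section Continuous.
Context {X : topologicalType}.
Implicit Types (f g : X -> quat R) (a : X -> R).

Lemma continuous_quatP f : continuous f <->
  [/\ continuous (fun t => qre (f t)), continuous (fun t => qi (f t)),
      continuous (fun t => qj (f t)) & continuous (fun t => qk (f t))].
Proof.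
split=> [cf|[c0 c1 c2 c3] t]; last exact: (cvg_quat (c0 t) (c1 t) (c2 t) (c3 t)).
split=> t; have [c0 c1 c2 c3] := cvg_qcoord (cf t).
- exact: c0.
- exact: c1.
- exact: c2.
- exact: c3.
Qed.

Lemma continuous_qD f g : continuous f -> continuous g ->
  continuous (fun t => f t + g t).
Proof. by move=> cf cg t; exact: cvg_qD (cf t) (cg t). Qed.

Lemma continuous_qN f : continuous f -> continuous (fun t => - f t).
Proof. by move=> cf t; exact: cvg_qN (cf t). Qed.

Lemma continuous_qZ a f : continuous a -> continuous f ->
  continuous (fun t => a t *: f t).
Proof. by move=> ca cf t; exact: cvg_qZ (ca t) (cf t). Qed.

Lemma continuous_qM f g : continuous f -> continuous g ->
  continuous (fun t => f t * g t).
Proof. by move=> cf cg t; exact: cvg_qM (cf t) (cg t). Qed.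

Lemma continuous_qconj f : continuous f -> continuous (fun t => qconj (f t)).
Proof. by move=> cf t; exact: cvg_qconj (cf t). Qed.

Lemma continuous_qnorm2 f : continuous f -> continuous (fun t => qnorm2 (f t)).
Proof. by move=> cf t; exact: cvg_qnorm2 (cf t). Qed.

End Continuous.

End QuatTopology.

(** * Separation and compactness *)

(** Disjoint neighbourhoods of two distinct values of a function pull back. *)
Lemma hausdorff_of_separating (R : realType) (X : topologicalType) :
  (forall x y : X, (forall f : X -> R, continuous f -> f x = f y) -> x = y) ->
  hausdorff_space X.
Proof.
move=> sep x y xy; apply: sep => f cf.
apply: (@Rhausdorff R) => A B fA fB.
have [z [Az Bz]] := xy (f @^-1` A) (f @^-1` B) (cf x A fA) (cf y B fB).
by exists (f z).
Qed.

Lemma eq_quat_of_separating (R : realType) (X : topologicalType) (x y : X) :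
  (forall f : X -> R, continuous f -> f x = f y) ->
  forall f : X -> quat R, continuous f -> f x = f y.
Proof.
move=> E f cf; apply/quatP; split.
- by apply: (E (fun z => qre (f z))) => z; case: (cvg_qcoord (cf z)).
- by apply: (E (fun z => qi (f z))) => z; case: (cvg_qcoord (cf z)).
- by apply: (E (fun z => qj (f z))) => z; case: (cvg_qcoord (cf z)).
- by apply: (E (fun z => qk (f z))) => z; case: (cvg_qcoord (cf z)).
Qed.

Lemma hausdorff_injective (X Y : topologicalType) (f : X -> Y) :
  injective f -> continuous f -> hausdorff_space Y -> hausdorff_space X.
Proof.
move=> f_inj cf hY x y xy; apply: f_inj; apply: hY => A B fA fB.
have [z [Az Bz]] := xy (f @^-1` A) (f @^-1` B) (cf x A fA) (cf y B fB).
by exists (f z).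
Qed.

Lemma hausdorff_homeomorphic (X Y : topologicalType) :
  homeomorphic X Y -> hausdorff_space Y -> hausdorff_space X.
Proof.
move=> [f [g [cf _ fK _]]]; exact: hausdorff_injective (can_inj fK) cf.
Qed.

Lemma homeomorphic_sym (X Y : topologicalType) :
  homeomorphic X Y -> homeomorphic Y X.
Proof. by move=> [f [g []]]; exists g, f. Qed.

Lemma homeomorphic_trans (X Y Z : topologicalType) :
  homeomorphic X Y -> homeomorphic Y Z -> homeomorphic X Z.
Proof.
move=> [f [g [cf cg fK gK]]] [f' [g' [cf' cg' fK' gK']]].
exists (fun x => f' (f x)), (fun z => g (g' z)); split.
- exact: comp_continuous.
- exact: comp_continuous.
- by move=> x; rewrite fK' fK.
- by move=> x; rewrite gK gK'.
Qed.

(** A continuous bijection from a compact space to a Hausdorff space is closed,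
    because it maps closed sets to compact sets. *)
Lemma compact_hausdorff_homeomorphic (X Y : topologicalType) (f : X -> Y)
    (g : Y -> X) :
  compact [set: X] -> hausdorff_space Y -> continuous f ->
  cancel f g -> cancel g f -> homeomorphic X Y.
Proof.
move=> cX hY cf fK gK; exists f, g; split=> //.
apply/continuous_closedP => A cA.
have -> : g @^-1` A = f @` A.
  apply/seteqP; split=> [y Agy|_ [x Ax <-]]; last by rewrite /= fK.
  by exists (g y) => //; rewrite gK.
apply: (compact_closed hY); apply: continuous_compact.
  exact: continuous_subspaceT.
exact: (subclosed_compact cA cX).
Qed.

Lemma compact_set_type (T : topologicalType) (A : set T) :
  compact A -> compact [set: set_type A].
Proof.
move=> cA F FF _.
have [|x [Ax clx]] := cA (set_val @ F) _.
  by apply: (@filterS _ F _ setT) => [u _|]; [exact: set_valP|exact: filterT].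
exists (exist _ x (mem_set Ax)); split=> //= U V FU [_ [[B oB <-] Bx BV]].
have FU' : (set_val @ F) (set_val @` U).
  by apply: (@filterS _ F _ U) => // u Uu; exists u.
have [_ [[u Uu <-] Bu]] := clx _ B FU' (open_nbhs_nbhs (conj oB Bx)).
by exists u; split=> //; exact: BV.
Qed.

Lemma cvg_set_type (T : topologicalType) (A : set T) (S : Type)
    (F : set_system S) (f : S -> set_type A) (a : set_type A) : Filter F ->
  (set_val (f s) @[s --> F] --> set_val a) -> f s @[s --> F] --> a.
Proof.
move=> FF fa; exact: (@cvg_initial _ _ (set_val : set_type A -> T)).
Qed.

Lemma continuous_set_type (X T : topologicalType) (A : set T)
    (f : X -> set_type A) :
  continuous (fun x => set_val (f x)) -> continuous f.
Proof. by move=> cf x; exact: (@cvg_set_type T A X (nbhs x) f (f x) (nbhs_filter x) (cf x)). Qed.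

Lemma continuous_at_near_eq (X Y : topologicalType) (f g : X -> Y) x :
  (\forall y \near x, g y = f y) -> {for x, continuous g} -> {for x, continuous f}.
Proof.
move=> gf cg; have E : g x = f x := nbhs_singleton gf.
change (f @ nbhs x --> f x); rewrite -E.
by apply: cvg_trans cg; exact: near_eq_cvg.
Qed.

Lemma continuous_at_pair (X Y Z : topologicalType) (f : X -> Y) (g : X -> Z) x :
  {for x, continuous f} -> {for x, continuous g} ->
  {for x, continuous (fun z => (f z, g z))}.
Proof.
move=> cf cg.
exact: (@cvg_pair _ _ _ (nbhs x) (nbhs (f x)) (nbhs (g x)) _ _ _ f g cf cg).
Qed.

Lemma nbhs_continuous_lt (R : realType) (X : topologicalType) (f : X -> R) x e :
  continuous f -> f x < e -> nbhs x [set y | f y < e].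
Proof. by move=> cf fx; exact: (cvgr_lt _ (cf x) _ fx). Qed.

Section Sphere.
Variable R : realType.
Implicit Types x y : quat R.

Lemma S3_val_continuous : continuous (val : S3 R -> quat R).
Proof. exact: initial_continuous. Qed.

Lemma continuous_S3 (X : topologicalType) (f : X -> S3 R) :
  continuous (fun t => val (f t)) -> continuous f.
Proof. exact: continuous_set_type. Qed.

Lemma S3_compact : compact [set: S3 R].
Proof.
apply: compact_set_type.
pose I1 := `[(-1) : R, 1]%classic.
pose box := @quat_of_coord R @` (((I1 `*` I1) `*` I1) `*` I1).
have cI : compact I1 by exact: segment_compact.
have cbox : compact box.
  apply: continuous_compact.

    2: exact: compact_setX (compact_setX (compact_setX cI cI) cI) cI.
  apply: continuous_subspaceT => c; apply: cvg_quat => /=.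
  - apply: (@continuous_comp _ _ _ (fun c => c.1.1) fst); last exact: cvg_fst.
    by apply: continuous_comp; exact: cvg_fst.
  - apply: (@continuous_comp _ _ _ (fun c => c.1.1) snd); last exact: cvg_snd.
    by apply: continuous_comp; exact: cvg_fst.
  - by apply: (@continuous_comp _ _ _ fst snd); [exact: cvg_fst|exact: cvg_snd].
  - exact: cvg_snd.
apply: (subclosed_compact _ cbox).
  have -> : sphere3 R = (@qnorm2 R) @^-1` [set 1] by [].
  apply: closed_comp; last exact: closed_eq.
  by move=> x _; exact: (cvg_qnorm2 (@cvg_id _ (nbhs x))).
move=> [a b c d] /= x1; exists (a, b, c, d) => //=.
have I1P (z : R) : z ^+ 2 <= 1 -> I1 z.
  by move=> z1; rewrite /I1 /= in_itv /=; apply/andP; split; nra.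
have := sqr_ge0 a; have := sqr_ge0 b; have := sqr_ge0 c; have := sqr_ge0 d.
move: x1; rewrite /sphere3 /qnorm2 /= => x1 a0 b0 c0 d0.
by split; [split; [split|]|]; apply: I1P; rewrite -x1; lra.
Qed.

Definition S3_one : S3 R := mkS3 (qnorm21 R).

Definition qdir x : quat R := (qnorm x)^-1 *: x.

Lemma cvg_qdir (T : Type) (F : set_system T) (f : T -> quat R) x : Filter F ->
  x != 0 -> f t @[t --> F] --> x -> qdir (f t) @[t --> F] --> qdir x.
Proof.
move=> FF x0 fx; apply: cvg_qZ => //; apply: cvgV; last exact: cvg_qnorm.
by rewrite gt_eqF // qnorm_gt0.
Qed.

Lemma qdir_id x : qnorm2 x = 1 -> qdir x = x.
Proof. by move=> x1; rewrite /qdir /qnorm x1 sqrtr1 invr1 scale1r. Qed.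

(** Radial retraction onto the unit sphere; the value at 0 is a dummy. *)
Definition S3_dir x : S3 R :=
  if pselect (x != 0) is left x0 then mkS3 (qnorm2_dir x0) else S3_one.

Lemma S3_dirE x : x != 0 -> val (S3_dir x) = qdir x.
Proof. by rewrite /S3_dir; case: pselect. Qed.

Lemma S3_dir_val (x : S3 R) : S3_dir (val x) = x.
Proof.
have x1 := S3P x; apply: val_inj.
by rewrite S3_dirE ?qdir_id // -qnorm2_eq0 x1 oner_eq0.
Qed.

Lemma nbhs_neq0 x : x != 0 -> \forall y \near x, y != 0.
Proof.
move=> x0.
have gt0 : 0 < qnorm2 x by rewrite lt0r qnorm2_eq0 x0 qnorm2_ge0.
apply: filterS (cvgr_gt _ (cvg_qnorm2 (@cvg_id _ (nbhs x))) _ gt0) => y.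
by rewrite lt0r qnorm2_eq0 => /andP[].
Qed.

Lemma cvg_S3_dir (T : Type) (F : set_system T) (f : T -> quat R) x : Filter F ->
  x != 0 -> f t @[t --> F] --> x -> S3_dir (f t) @[t --> F] --> S3_dir x.
Proof.
move=> FF x0 fx; apply: cvg_set_type.
change (val (S3_dir (f t)) @[t --> F] --> val (S3_dir x)); rewrite S3_dirE //.
apply: (@cvg_trans _ (qdir (f t) @[t --> F])); last exact: cvg_qdir.
apply: near_eq_cvg.
near=> t; rewrite S3_dirE //; near: t; exact: fx _ (nbhs_neq0 x0).
Unshelve. all: by end_near.
Qed.

Lemma continuous_at_S3_dir (X : topologicalType) (f : X -> quat R) t :
  f t != 0 -> {for t, continuous f} -> {for t, continuous (fun t => S3_dir (f t))}.
Proof. by move=> ft0 cf; exact: cvg_S3_dir ft0 cf. Qed.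

Lemma qnorm2B_lt (x : quat R) (e : R) : 0 < e ->
  nbhs x [set y : quat R | qnorm2 (y - x) < e].
Proof.
move=> e0; have c : continuous (fun y : quat R => qnorm2 (y - x)).
  apply/continuous_qnorm2/continuous_qD; last exact: cst_continuous.
  by move=> y; exact: cvg_id.
apply: (cvgr_lt _ (c x) _ _).
by rewrite subrr (_ : qnorm2 0 = 0) //; apply/eqP; rewrite qnorm2_eq0.
Qed.

(** A form of the triangle inequality that avoids square roots: the
    parallelogram law without its nonnegative second term. *)
Lemma qnorm2_triangle x y z :
  qnorm2 (x - z) <= 2 * (qnorm2 (x - y) + qnorm2 (y - z)).
Proof.
rewrite /qnorm2 /=.
case: x y z => [a b c d] [a' b' c' d'] [a2 b2 c2 d2] /=.
have H (u v w : R) : (u - w) ^+ 2 <= 2 * ((u - v) ^+ 2 + (v - w) ^+ 2).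
  by have := sqr_ge0 (u - v - (v - w)); nra.
have := H a a' a2; have := H b b' b2; have := H c c' c2; have := H d d' d2.
lra.
Qed.

End Sphere.

(** * Unit complex numbers among the quaternions *)

Section Cis.
Variable R : realType.
Implicit Types (s t : R) (x : quat R).

Definition cis t : quat R := Quat (cos t) (sin t) 0 0.

Lemma cis0 : cis 0 = 1.
Proof. by rewrite /cis cos0 sin0. Qed.

Lemma cisD s t : cis (s + t) = cis s * cis t.
Proof. by apply/quatP; rewrite /= cosD sinD; split; ring. Qed.

Lemma qnorm2_cis t : qnorm2 (cis t) = 1.
Proof. by rewrite /qnorm2 /= !expr0n /= !addr0 cos2Dsin2. Qed.

Lemma cis_unit t : cis t \is a GRing.unit.
Proof. by rewrite quat_unitE -qnorm2_eq0 qnorm2_cis oner_eq0. Qed.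

Lemma cisN t : cis (- t) = (cis t)^-1.
Proof.
apply: (mulrI (cis_unit t)); rewrite -cisD subrr cis0 divrr //; exact: cis_unit.
Qed.

Lemma qconj_cis t : qconj (cis t) = cis (- t).
Proof. by apply/quatP; rewrite /= cosN sinN; split; rewrite ?oppr0. Qed.

Lemma cisX t (n : nat) : cis t ^+ n = cis (n%:R * t).
Proof.
elim: n => [|n IHn]; first by rewrite mul0r cis0.
by rewrite exprS IHn -cisD -natr1 mulrDl mul1r addrC.
Qed.

Lemma cisXz t (n : int) : cis t ^ n = cis (n%:~R * t).
Proof.
case: n => n; first exact: cisX.
by rewrite NegzE -exprnN cisX mulrNz mulNr cisN.
Qed.

Lemma cis2pi : cis (2 * pi) = 1.
Proof. by rewrite mulr_natl /cis cos2pi sin2pi. Qed.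

Lemma cis_eq1 t : cis t = 1 -> exists n : int, t = n%:~R * (2 * pi).
Proof.
have pi0 := @pi_gt0 R; have pi20 : 0 < 2 * pi :> R by rewrite mulr_gt0.
pose n := Num.floor (t / (2 * pi)); pose s := t - n%:~R * (2 * pi) => t1.
have s1 : cos s = 1.
  have : cis s = 1.
    by rewrite /s cisD t1 mul1r -mulNr -mulrNz -cisXz cis2pi exp1rz.
  by case.
have /andP[s0 s2] : 0 <= s < 2 * pi.
  rewrite /s subr_ge0 -ler_pdivlMr // Num.Theory.floor_le_tmp /=.
  have := Num.Theory.floorD1_gt (t / (2 * pi)).
  by rewrite ltr_pdivrMr // intrD mulrDl mul1r ltrBlDl.
have I0 : (0 : R) \in `[0, pi] by rewrite in_itv /= lexx ltW.
exists n; apply/eqP; rewrite -subr_eq0 -/s; apply/eqP.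
have [spi|pis] := leP s pi.
  by apply: cos_inj => //; rewrite ?in_itv /= ?s0 ?cos0.
suff : 2 * pi - s = 0 by lra.
apply: cos_inj => //; first by rewrite in_itv /=; lra.
by rewrite cosB mulr_natl cos2pi sin2pi cos0 s1; ring.
Qed.

Lemma cis_surj (a b : R) : a ^+ 2 + b ^+ 2 = 1 ->
  exists t, Quat a b 0 0 = cis t.
Proof.
move=> ab1; have a1 : -1 <= a <= 1 by apply/andP; split; nra.
have ca := acosK a1; have sa := sin_acos a1.
have {}sa : sin (acos a) = `|b|.
  by rewrite sa -sqrtr_sqr; congr Num.sqrt; rewrite -ab1; ring.
have [b0|b0] := leP 0 b.
  by exists (acos a); rewrite /cis ca sa ger0_norm.
by exists (- acos a); rewrite /cis cosN sinN ca sa ltr0_norm // opprK.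
Qed.

Lemma cis_continuous (X : topologicalType) (f : X -> R) :
  continuous f -> continuous (fun z => cis (f z)).
Proof.
move=> cf; apply/continuous_quatP; split=> [|||];
  try exact: cst_continuous.
- exact: (comp_continuous cf (@continuous_cos R)).
- exact: (comp_continuous cf (@continuous_sin R)).
Qed.

Lemma biplane_rotE t x : biplane_rot t t x = cis t * x.
Proof. by apply/quatP; rewrite /=; split; ring. Qed.

End Cis.

(** * Diagonal lens spaces *)

Section DiagonalLens.
Variables (R : realType) (p : nat).
Hypothesis p_gt0 : (0 < p)%N.
Implicit Types (m : int) (x y : S3 R).

Definition zeta m : quat R := cis (lens_angle R p m).

Lemma zetaD m n : zeta (m + n) = zeta m * zeta n.
Proof. by rewrite /zeta /lens_angle intrD mulrDl cisD. Qed.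

Lemma zeta0 : zeta 0 = 1.
Proof. by rewrite /zeta /lens_angle mul0r cis0. Qed.

Lemma pnat_neq0 : p%:R != 0 :> R.
Proof. by rewrite pnatr_eq0 -lt0n. Qed.

Lemma zeta_eq1 m : zeta m = 1 <-> (p %| m)%Z.
Proof.
have p0 := pnat_neq0; have pi0 := @pi_gt0 R.
split=> [/cis_eq1[n]|/dvdzP[n ->]].
  rewrite /lens_angle => E; apply/dvdzP; exists n; apply: (@intr_inj R).
  rewrite intrM; apply: (mulIf (lt0r_neq0 pi0)); apply: (mulfI (x := 2 / p%:R)).
    by rewrite mulf_neq0 // invr_eq0.
  transitivity (m%:~R * (2 * pi / p%:R) : R); first by field.
  by rewrite E; field.
rewrite /zeta /lens_angle intrM (_ : _ * _ = n%:~R * (2 * pi)); last first.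
  by rewrite -pmulrn; field.
by rewrite -cisXz cis2pi exp1rz.
Qed.

Lemma zeta_mod m : zeta (m %% p)%Z = zeta m.
Proof.
have -> : zeta m = zeta ((m %/ p)%Z * p) * zeta (m %% p)%Z.
  by rewrite -zetaD -divz_eq.
by rewrite (zeta_eq1 ((m %/ p)%Z * p)).2 ?mul1r // dvdz_mull.
Qed.

Fact zeta_act_subproof m x : qnorm2 (zeta m * val x) = 1.
Proof. by rewrite qnorm2M qnorm2_cis S3P mulr1. Qed.

Definition zeta_act m x : S3 R := mkS3 (zeta_act_subproof m x).

Lemma zeta_actD m n x : zeta_act (m + n) x = zeta_act m (zeta_act n x).
Proof. by apply: val_inj; rewrite /= zetaD mulrA. Qed.

Lemma zeta_act_continuous m : continuous (zeta_act m).
Proof.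
apply: continuous_S3; apply: continuous_qM; first exact: cst_continuous.
exact: S3_val_continuous.
Qed.

Lemma zeta_act_eq m n x : zeta_act m x = zeta_act n x -> (m = n %[mod p])%Z.
Proof.
move=> /(congr1 val) /= E.
have x_unit : val x \is a GRing.unit.
  by rewrite quat_unitE -qnorm2_eq0 S3P oner_eq0.
have {}E := mulIr x_unit E; apply/eqP; rewrite eqz_mod_dvd.
apply/zeta_eq1; rewrite zetaD E -zetaD subrr; exact: zeta0.
Qed.

Definition lens_pi x : lens_space R p 1 := \pi_(lens_space R p 1) x.

Lemma lens_piP x y : lens_pi x = lens_pi y <-> exists m, y = zeta_act m x.
Proof.
have rotE m z : biplane_rot (lens_angle R p m) (1%:R * lens_angle R p m) z =
    zeta m * z by rewrite mul1r biplane_rotE.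
split=> [/eqmodP/asboolP[m]|[m ->]].
  by rewrite rotE => yE; exists m; exact: val_inj.
by apply/eqmodP/asboolP; exists m; rewrite rotE.
Qed.

Lemma lens_piE m x : lens_pi (zeta_act m x) = lens_pi x.
Proof. by apply/esym/lens_piP; exists m. Qed.

Lemma lens_pi_surj (l : lens_space R p 1) : exists x, lens_pi x = l.
Proof. by exists (repr l); exact: reprK. Qed.

Lemma lens_pi_continuous : continuous lens_pi.
Proof. exact: pi_continuous. Qed.

Lemma lens_pi_open x (V : set (S3 R)) : nbhs x V -> nbhs (lens_pi x) (lens_pi @` V).
Proof.
rewrite nbhsE => -[B [oB Bx] BV].
apply: (@filterS _ _ _ (lens_pi @` B)).
  by move=> _ [y /BV Vy <-]; exists y.
apply: open_nbhs_nbhs; split; last by exists x.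
change (open (lens_pi @^-1` (lens_pi @` B))).
have -> : lens_pi @^-1` (lens_pi @` B) =
    \bigcup_(m in [set: int]) (zeta_act m @^-1` B).
  apply/seteqP; split=> [y [b Bb /esym/lens_piP[m bE]]|y [m _ By]].
    by exists m => //=; rewrite -bE.
  by exists (zeta_act m y) => //; exact: lens_piE.
apply: bigcup_open => m _; apply: open_comp => // y _.
exact: zeta_act_continuous.
Qed.

(** A root of unity moves all points of the sphere by the same distance, and
    only finitely many roots of unity are involved. *)
Lemma lens_gap : exists2 e : R, 0 < e &
  forall x y, lens_pi x = lens_pi y -> x <> y -> e <= qnorm2 (val x - val y).
Proof.
pose f (i : 'I_p) : R := if zeta i%:Z == 1 then 1 else qnorm2 (1 - zeta i%:Z).
exists (\big[Order.min/1]_(i < p) f i).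
  apply/bigmin_gtP; split=> // i _; rewrite /f; case: ifPn => // i1.
  by rewrite lt0r qnorm2_ge0 qnorm2_eq0 subr_eq0 eq_sym i1.
move=> x y /lens_piP[m ->] xy.
have p0 : p%:Z != 0 by rewrite eqz_nat -lt0n.
have i_lt : (`|(m %% p)%Z|%N < p)%N by have := modz_ge0 m p0; have := ltz_pmod m (d := p); lia.
pose i := Ordinal i_lt.
have iE : zeta i%:Z = zeta m.
  by rewrite -[RHS]zeta_mod; congr zeta; rewrite /= gez0_abs // modz_ge0.
apply: (@le_trans _ _ (f i)); first exact: bigmin_le_cond.
have -> : qnorm2 (val x - val (zeta_act m x)) = qnorm2 (1 - zeta m).
  by rewrite -[X in X - _]mul1r -mulrBl qnorm2M S3P mulr1.
rewrite /f iE; case: eqP => // m1; case: xy.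
by apply: val_inj; rewrite /= m1 mul1r.
Qed.

End DiagonalLens.

(** * Lifting maps to the sphere *)

Section Lifting.
Variables (R : realType) (p : nat).
Hypothesis p_gt0 : (0 < p)%N.
Local Notation S := (S3 R).
Local Notation L := (lens_space R p 1).
Local Notation ppi := (@lens_pi R p).
Implicit Types (x y : S) (l : L).

Definition sdist2 x y : R := qnorm2 (val x - val y).

Lemma sdist2_refl x : sdist2 x x = 0.
Proof. by apply/eqP; rewrite /sdist2 subrr qnorm2_eq0. Qed.

Lemma sdist2_sym x y : sdist2 x y = sdist2 y x.
Proof. by rewrite /sdist2 -qnorm2N opprB. Qed.

Lemma sdist2_triangle x y z : sdist2 x z <= 2 * (sdist2 x y + sdist2 y z).
Proof. exact: qnorm2_triangle. Qed.

Lemma sdist2_zeta m x y : sdist2 (zeta_act p m x) (zeta_act p m y) = sdist2 x y.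
Proof. by rewrite /sdist2 /= -mulrBr qnorm2M qnorm2_cis mul1r. Qed.

Lemma sdist2_continuous : continuous (fun z : S * S => sdist2 z.1 z.2).
Proof.
apply/continuous_qnorm2/continuous_qD; last apply: continuous_qN.
  exact: (comp_continuous (@fst_continuous _ _) (@S3_val_continuous R)).
exact: (comp_continuous (@snd_continuous _ _) (@S3_val_continuous R)).
Qed.

Lemma sdist2_lt x (e : R) : 0 < e -> nbhs x [set y | sdist2 y x < e].
Proof. by move=> e0; exact: (S3_val_continuous (qnorm2B_lt (val x) e0)). Qed.

(** Two representatives at distance less than a quarter of the gap from the
    same point are closer to each other than the gap, hence equal.  The nearest
    representative depends continuously on the point and on the orbit because
    the quotient map is open. *)
Lemma nearest_lift (e : R) : 0 < e ->
  (forall x y, ppi x = ppi y -> x <> y -> e <= sdist2 x y) ->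
  exists n : S * L -> S, forall x y, sdist2 x y < e / 16 ->
    n (x, ppi y) = y /\ {for (x, ppi y), continuous n}.
Proof.
move=> e0 gap.
pose n (z : S * L) := xget z.1 [set y | ppi y = z.2 /\ sdist2 z.1 y < e / 16].
have nE x y : sdist2 x y < e / 16 -> n (x, ppi y) = y.
  move=> xy; rewrite /n; case: xgetP => [y' _ [/= y'y xy']|/(_ y) []//].
  apply: contrapT => ne; have := gap _ _ y'y ne.
  have := sdist2_triangle y' x y; rewrite (sdist2_sym y' x).
  by lra.
exists n => x y xy; split; first exact: nE.
move=> U; rewrite nE // => Uy.
have := @nbhs_continuous_lt R _ (fun z : S * S => sdist2 z.1 z.2) (x, y)
  (e / 16) sdist2_continuous xy.
move=> [[A B] [/= Ax By] AB].
have BUy : nbhs y (B `&` U) by exact: filterI.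
exists (A, ppi @` (B `&` U)) => /=; first by split; last exact: lens_pi_open.
move=> [x' l'] [/= Ax' [y' [By' Uy'] <-]].
by rewrite /= nE //; exact: (AB (x', y')).
Qed.

(** Maps from a compact contractible space lift: along each ray of the
    contraction the map moves in finitely many short steps, uniformly in the
    ray, and each step is lifted to the nearest representative. *)
Lemma lens_lift (K : topologicalType) (k0 : K) (c : K * R -> K) (h : K -> L) x0 :
  compact [set: K] -> continuous c -> (forall k, c (k, 0) = k0) ->
  (forall k, c (k, 1) = k) -> (forall r, c (k0, r) = k0) ->
  continuous h -> ppi x0 = h k0 ->
  exists H : K -> S, [/\ continuous H, forall k, ppi (H k) = h k & H k0 = x0].
Proof.
move=> cK cc c0 c1 ck0 ch hx0; have [e e0 gap] := @lens_gap R p p_gt0.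
have [n nP] := nearest_lift e0 gap.
pose h' z := h (c z); have ch' : continuous h' by exact: comp_continuous.
pose close (d : R) (z : K * R) := exists a b,
  [/\ ppi a = h' z, ppi b = h' (z.1, z.2 + d) & sdist2 a b < e / 16].
have cKI : compact ([set: K] `*` `[0 : R, 1]%classic).
  by apply: compact_setX => //; exact: segment_compact.
(* By compactness one step length works for all points and all times. *)
have near0 : \forall d \near (0 : R), ([set: K] `*` `[0 : R, 1]%classic) `<=` close d.
  apply: ((compact_near_coveringP _).1 cKI R (nbhs (0 : R)) close).
  move=> [k r] _; have [y0 y0E] := lens_pi_surj (h' (k, r)).
  have e64 : 0 < e / 64 by rewrite divr_gt0.
  pose V := [set y | sdist2 y y0 < e / 64].
  have W : nbhs (h' (k, r)) (ppi @` V).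
    by rewrite -y0E; apply: lens_pi_open => //; exact: sdist2_lt.
  pose sh (z : (K * R) * R) := h' (z.1.1, z.1.2 + z.2).
  have csh : continuous sh.
    apply: (comp_continuous _ ch'); apply: pair_continuous.
      exact: (comp_continuous (@fst_continuous _ _) (@fst_continuous _ _)).
    move=> z; apply: cvgD; last exact: cvg_snd.
    exact: (comp_continuous (@fst_continuous _ _) (@snd_continuous _ _)).
  have W1 : nbhs ((k, r), 0 : R) [set z | (ppi @` V) (h' z.1)].
    have cf : continuous (fun z : (K * R) * R => h' z.1).
      exact: (comp_continuous (@fst_continuous _ _) ch').
    exact: (cf ((k, r), 0 : R) _ W).
  have W2 : nbhs ((k, r), 0 : R) [set z | (ppi @` V) (sh z)].
    by apply: (csh ((k, r), 0 : R)); rewrite /sh /= addr0.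
  apply: filterS (filterI W1 W2) => -[[k' r'] d] /= [[a Va aE] [b Vb bE]].
  exists a, b; split=> //; rewrite /V /= in Va Vb.
  by have := sdist2_triangle a y0 b; rewrite (sdist2_sym y0); lra.
have [N NP] : exists N, forall k r, 0 <= r <= 1 -> close N.+1%:R^-1 (k, r).
  have nearN : \forall N \near \oo,
      ([set: K] `*` `[0 : R, 1]%classic) `<=` close N.+1%:R^-1.
    exact: cvg_harmonic near0.
  have [N NP] := filter_ex nearN.
  by exists N => k r r01; apply: NP; split=> //; rewrite /= in_itv.
(* [X j k] lifts the value of [h] at the [j]-th stop on the ray to [k]. *)
pose t (j : nat) : R := j%:R / N.+1%:R.
pose X := fix X j k := if j is i.+1 then n (X i k, h' (k, t i.+1)) else x0.
have XP j : (j <= N.+1)%N ->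
    [/\ continuous (X j), forall k, ppi (X j k) = h' (k, t j) & X j k0 = x0].
  elim: j => [_|j IHj jN].
    split=> //; first exact: cst_continuous.
    by move=> k; rewrite /= hx0 /h' /t mul0r c0.
  have [cX Xh Xk0] := IHj (ltnW jN).
  have tE : t j.+1 = t j + N.+1%:R^-1 by rewrite /t -natr1 mulrDl mul1r.
  have t01 : 0 <= t j <= 1.
    by rewrite /t divr_ge0 //= ler_pdivrMr ?ltr0n // mul1r ler_nat ltnW.
  have step k : exists2 b, ppi b = h' (k, t j.+1) & sdist2 (X j k) b < e / 16.
    have [a [b [aE bE ab]]] := NP k _ t01.
    have /lens_piP[m ->] : ppi a = ppi (X j k) by rewrite aE Xh.
    exists (zeta_act p m b); last by rewrite sdist2_zeta.
    by rewrite lens_piE bE tE.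
  split.
  - move=> k; have [b bE kb] := step k.
    have [_] := nP _ _ kb; rewrite bE.
    apply: (@continuous_comp _ _ _ (fun k => (X j k, h' (k, t j.+1))) n k).
    apply: pair_continuous => //.
    apply: (comp_continuous _ ch'); apply: pair_continuous.
      by move=> ?; exact: cvg_id.
    exact: cst_continuous.
  - move=> k; have [b bE kb] := step k.
    by rewrite /= -bE (nP _ _ kb).1.
  - rewrite /= Xk0 /h' ck0 -hx0; apply: (nP _ _ _).1.
    by rewrite sdist2_refl divr_gt0.
have [cX Xh Xk0] := XP N.+1 (leqnn _).
exists (X N.+1); split=> // k; rewrite Xh /h' /t divff ?c1 //.
Qed.

Local Notation I := (unitI R).

Lemma valI0 : valI (zero : I) = 0.
Proof. by apply: valIK; rewrite lexx ler01. Qed.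

Lemma valI1 : valI (one : I) = 1.
Proof. by apply: valIK; rewrite lexx ler01. Qed.

Lemma unitI_compact : compact [set: I].
Proof. exact: compact_set_type (@segment_compact R 0 1). Qed.

Lemma square_lift (h : I * I -> L) x0 : continuous h ->
  ppi x0 = h (zero, zero) ->
  exists H : I * I -> S,
    [/\ continuous H, forall k, ppi (H k) = h k & H (zero, zero) = x0].
Proof.
pose c (z : (I * I) * R) : I * I :=
  (clampI (z.2 * valI z.1.1), clampI (z.2 * valI z.1.2)).
apply: (@lens_lift _ (zero, zero) c).
- rewrite -[setT]setXTT; apply: compact_setX; exact: unitI_compact.
- have cv : continuous (fun z : (I * I) * R => valI z.1.1).
    apply: (comp_continuous _ (@valI_continuous R)).
    exact: (comp_continuous (@fst_continuous _ _) (@fst_continuous _ _)).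
  have cv' : continuous (fun z : (I * I) * R => valI z.1.2).
    apply: (comp_continuous _ (@valI_continuous R)).
    exact: (comp_continuous (@fst_continuous _ _) (@snd_continuous _ _)).
  apply: pair_continuous; apply: (comp_continuous _ (@clampI_continuous R)).
    by move=> z; apply: cvgM; [exact: cvg_snd|exact: cv].
  by move=> z; apply: cvgM; [exact: cvg_snd|exact: cv'].
- by move=> k; rewrite /c /= !mul0r.
- by move=> [s t]; rewrite /c /= !mul1r !clampIK.
- by move=> r; rewrite /c /= valI0 mulr0.
Qed.

Lemma path_lift (f : I -> L) x0 : continuous f -> ppi x0 = f zero ->
  exists A : I -> S, [/\ continuous A, forall s, ppi (A s) = f s & A zero = x0].
Proof.
move=> cf fx0.
have cg : continuous (fun z : I * I => f z.1).
  exact: (comp_continuous (@fst_continuous _ _) cf).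
have [H [cH Hf H0]] := square_lift cg fx0.
exists (fun s => H (s, zero)); split; [|by move=> s; rewrite Hf|by []].
apply: (comp_continuous _ cH); apply: pair_continuous.
  by move=> ?; exact: cvg_id.
exact: cst_continuous.
Qed.

(** The distance of two lifts is continuous and omits the interval from 0 to
    the gap. *)
Lemma lift_unique (A B : I -> S) : continuous A -> continuous B ->
  (forall s, ppi (A s) = ppi (B s)) -> A zero = B zero -> A =1 B.
Proof.
move=> cA cB AB AB0 s; have [e e0 gap] := @lens_gap R p p_gt0.
apply: contrapT => ABs.
pose f (r : R) := sdist2 (A (clampI r)) (B (clampI r)).
have cf : continuous f.
  apply: (comp_continuous (f := fun r => (A (clampI r), B (clampI r)))
    _ sdist2_continuous).
  by apply: pair_continuous; apply: (comp_continuous (@clampI_continuous R)).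
have /andP[s0 s1] := valI_itv s.
have fs : e <= f (valI s) by rewrite /f clampIK; exact: gap.
have f0 : f 0 = 0 by rewrite /f -/zero AB0 sdist2_refl.
have [||r _ fr] := @IVT R f 0 (valI s) (e / 2) s0.
- exact: continuous_subspaceT.
- by rewrite f0 min_l ?max_r; lra.
have [E|ne] := pselect (A (clampI r) = B (clampI r)).
  by move: fr; rewrite /f E sdist2_refl; lra.
have : e <= f r by exact: gap (AB (clampI r)) ne.
by rewrite fr; lra.
Qed.

End Lifting.

(** * The 3-sphere is simply connected *)

Section Avoidance.
Variable R : realType.
Implicit Types (a b w x y : quat R) (t : R).

Definition qdot x y : R :=
  qre x * qre y + qi x * qi y + qj x * qj y + qk x * qk y.

Lemma qdot_comb w a b s t :
  qdot w (s *: a + t *: b) = s * qdot w a + t * qdot w b.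
Proof. by rewrite /qdot /=; ring. Qed.

(** Left multiplication by [a] maps the imaginary quaternions onto the
    orthogonal complement of [a]; this leaves one linear condition on a
    3-dimensional space. *)
Lemma orthogonal_to_pair a b : exists w, [/\ w != 0, qdot w a = 0 & qdot w b = 0].
Proof.
have imag y : exists m, [/\ m != 0, qre m = 0 & qdot m y = 0].
  have [/eqP y1|y1] := eqVneq (qi y) 0.
    exists (Quat 0 1 0 0); split=> //; last by rewrite /qdot /= (eqP y1); ring.
    by apply/eqP => /(congr1 (@qi R)) /eqP; rewrite oner_eq0.
  exists (Quat 0 (qj y) (- qi y) 0); split=> //; last by rewrite /qdot /=; ring.
  by apply/eqP => /(congr1 (@qj R)) /eqP; rewrite oppr_eq0 (negPf y1).
have [->|a0] := eqVneq a 0.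
  have [m [m0 _ mb]] := imag b; exists m; split=> //.
  by rewrite /qdot /= !mulr0 !addr0.
have [m [m0 rm mb]] := imag (qconj a * b); exists (a * m); split.
- by rewrite -qnorm2_eq0 qnorm2M mulf_neq0 // qnorm2_eq0.
- by transitivity (qnorm2 a * qre m); [rewrite /qdot /qnorm2 /=; ring|rewrite rm mulr0].
- by rewrite -mb /qdot /=; ring.
Qed.

(** The moment curve meets every hyperplane through the origin in finitely
    many points. *)
Definition moment t := Quat 1 t (t ^+ 2) (t ^+ 3).

Lemma nonroot_exists (P : {poly R}) : P != 0 -> exists t, P.[t] != 0.
Proof.
move=> P0; apply: contrapT => all0.
pose rs := [seq n%:R : R | n <- iota 0 (size P)].
have : (size rs < size P)%N.
  apply: max_poly_roots => //.
    apply/allP => _ /mapP[n _ ->]; rewrite rootE; apply: contrapT => n0.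
    by apply: all0; exists n%:R; exact/negP.
  rewrite map_inj_uniq ?iota_uniq // => m n /eqP.
  by rewrite eqr_nat => /eqP.
by rewrite size_map size_iota ltnn.
Qed.

(** Each of the planes lies in a hyperplane, which the moment curve meets in the
    zeros of a nonzero polynomial.  A non-zero of the product of these
    polynomials gives a point off all of them. *)
Lemma avoid_planes (ps : seq (quat R * quat R)) : exists2 c, c != 0 &
  forall pq, pq \in ps -> forall s t, c <> s *: pq.1 + t *: pq.2.
Proof.
suff [P P0 PP] : exists2 P : {poly R}, P != 0 & forall u, P.[u] != 0 ->
    forall pq, pq \in ps -> forall s t, moment u <> s *: pq.1 + t *: pq.2.
  have [u u0] := nonroot_exists P0; exists (moment u); last exact: PP u0.
  by apply/eqP => /(congr1 (@qre R)) /eqP; rewrite oner_eq0.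
elim: ps => [|[a b] ps [P P0 IH]]; first by exists 1; rewrite ?oner_neq0.
have [w [w0 wa wb]] := orthogonal_to_pair a b.
pose Q := Poly [:: qre w; qi w; qj w; qk w].
have Q0 : Q != 0.
  apply: contra_neq w0 => Q0; have coefQ i : [:: qre w; qi w; qj w; qk w]`_i = 0.
    by rewrite -coef_Poly -/Q Q0 coef0.
  by apply/quatP; split; [exact: (coefQ 0%N)|exact: (coefQ 1%N)
    |exact: (coefQ 2%N)|exact: (coefQ 3%N)].
exists (Q * P); first by rewrite mulf_neq0.
move=> u; rewrite hornerM mulf_eq0 negb_or => /andP[Qu Pu] pq.
rewrite inE => /orP[/eqP -> s t /= E|]; last exact: IH.
have : qdot w (moment u) = 0 by rewrite E qdot_comb wa wb !mulr0 addr0.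
move: Qu; rewrite horner_Poly /= /qdot /= => /eqP Qu E0; apply: Qu; rewrite -[RHS]E0.
by ring.
Qed.

End Avoidance.

Section Polygon.
Variables (R : realType) (v : nat -> quat R).

(** The polygonal curve through [v 0, ..., v n], with one unit of time for each
    edge.  Writing it as a sum over the edges makes it visibly continuous. *)
Fixpoint polygon (n : nat) (s : R) : quat R :=
  if n is m.+1 then polygon m s + valI (clampI (s - m%:R)) *: (v m.+1 - v m)
  else v 0%N.

Lemma valI_clamp_le0 (s : R) : s <= 0 -> valI (clampI s) = 0.
Proof.
move=> s0; change (Num.max 0 (Num.min s 1) = 0).
by rewrite max_l // ge_min s0.
Qed.

Lemma valI_clamp_ge1 (s : R) : 1 <= s -> valI (clampI s) = 1.
Proof.
move=> s1; change (Num.max 0 (Num.min s 1) = 1).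
by rewrite min_r // max_r // ler01.
Qed.

Lemma polygon_continuous n : continuous (polygon n).
Proof.
elim: n => [|n IHn]; first exact: cst_continuous.
apply: continuous_qD => //; apply: continuous_qZ; last exact: cst_continuous.
apply: (comp_continuous _ (@valI_continuous R)).
apply: (comp_continuous _ (@clampI_continuous R)) => s.
by apply: cvgB; [exact: cvg_id|exact: cvg_cst].
Qed.

Lemma polygon_end n s : n%:R <= s -> polygon n s = v n.
Proof.
elim: n => //= n IHn; rewrite -natr1 => ns.
by rewrite IHn ?valI_clamp_ge1 ?scale1r ?subrKC //; lra.
Qed.

Lemma polygon_edge n j s : (j < n)%N -> j%:R <= s <= j%:R + 1 ->
  polygon n s = v j + (s - j%:R) *: (v j.+1 - v j).
Proof.
elim: n => // n IHn; rewrite ltnS leq_eqVlt => /orP[/eqP ->|jn] js /=.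
  by rewrite polygon_end ?valIK //; lra.
rewrite IHn // valI_clamp_le0 ?scale0r ?addr0 //.
have : j.+1%:R <= n%:R :> R by rewrite ler_nat.
by rewrite -natr1; lra.
Qed.

End Polygon.

Section SimplyConnected.
Variable R : realType.
Local Notation S := (S3 R).
Local Notation I := (unitI R).

Lemma polygonal_approx (f : R -> S) : continuous f ->
  exists (g : R -> quat R) (ps : seq (quat R * quat R)),
  [/\ continuous g, g 0 = val (f 0), g 1 = val (f 1) & forall s, 0 <= s <= 1 ->
    qnorm2 (g s - val (f s)) < 1 /\
    exists pq, pq \in ps /\ exists a b, g s = a *: pq.1 + b *: pq.2].
Proof.
move=> cf.
pose close (d : R) (z : R * R) := sdist2 (f z.1) (f (z.1 + z.2 * d)) < 4^-1.
(* By compactness one step length works along the whole interval. *)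
have near0 : \forall d \near (0 : R),
    (`[0 : R, 1]%classic `*` `[0 : R, 1]%classic) `<=` close d.
  have cI := @segment_compact R 0 1.
  apply: ((compact_near_coveringP _).1 (compact_setX cI cI) R (nbhs (0 : R)) close).
  move=> [r u] _.
  pose F (z : (R * R) * R) := sdist2 (f z.1.1) (f (z.1.1 + z.1.2 * z.2)).
  have c1 : continuous (fun z : (R * R) * R => z.1.1).
    exact: (comp_continuous (@fst_continuous _ _) (@fst_continuous _ _)).
  have c2 : continuous (fun z : (R * R) * R => z.1.2).
    exact: (comp_continuous (@fst_continuous _ _) (@snd_continuous _ _)).
  have cF : continuous F.
    apply: (comp_continuous
      (f := fun z : (R * R) * R => (f z.1.1, f (z.1.1 + z.1.2 * z.2)))
      _ (@sdist2_continuous R)).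
    apply: pair_continuous; apply: (comp_continuous _ cf) => // z.
    by apply: cvgD; [exact: c1|apply: cvgM; [exact: c2|exact: cvg_snd]].
  have F0 : F ((r, u), 0) < 4^-1 by rewrite /F /= mulr0 addr0 sdist2_refl.
  exact: (@nbhs_continuous_lt R _ F ((r, u), 0) 4^-1 cF F0).
have nearN : \forall N \near \oo,
    (`[0 : R, 1]%classic `*` `[0 : R, 1]%classic) `<=` close N.+1%:R^-1.
  exact: cvg_harmonic near0.
have [N NP] := filter_ex nearN.
pose M : R := N.+1%:R; have M0 : 0 < M by rewrite ltr0n.
pose v (j : nat) := val (f (j%:R / M)).
exists (fun s => polygon v N.+1 (s * M)), [seq (v j, v j.+1) | j <- iota 0 N.+1].
split.
- apply: (comp_continuous _ (@polygon_continuous R v N.+1)) => s.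
  by apply: cvgM; [exact: cvg_id|exact: cvg_cst].
- rewrite mul0r (@polygon_edge _ _ _ 0) //; last by lra.
  by rewrite subrr scale0r addr0 /v mul0r.
- by rewrite mul1r polygon_end // /v -/M divff // gt_eqF.
move=> s /andP[s0 s1].
have [j jN js] : exists2 j, (j < N.+1)%N & j%:R <= s * M <= j%:R + 1.
  have [E|s1'] := eqVneq s 1.
    by exists N => //; rewrite E /M -natr1; lra.
  have sM0 : 0 <= s * M by rewrite mulr_ge0 // ltW.
  have /andP[t1 t2] := Num.Theory.truncn_itv sM0.
  exists (Num.truncn (s * M)); last by rewrite t1 natr1 ltW.
  rewrite -(ltr_nat R); apply: (le_lt_trans t1).
  by rewrite -[X in _ < X]mul1r ltr_pM2r // lt_neqAle s1'.
pose u := s * M - j%:R.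
have u01 : 0 <= u <= 1 by rewrite /u; lra.
have gE : polygon v N.+1 (s * M) = v j + u *: (v j.+1 - v j).
  exact: polygon_edge.
have jM : 0 <= j%:R / M <= 1.
  rewrite divr_ge0 ?(ltW M0) //= ler_pdivrMr // mul1r ler_nat; exact: ltnW.
have near (w : R) : 0 <= w <= 1 -> qnorm2 (v j - val (f ((j%:R + w) / M))) < 4^-1.
  move=> w01; have := NP (j%:R / M, w); rewrite /close /sdist2 /= mulrDl; apply.
  by rewrite !in_itv.
split; last first.
  exists (v j, v j.+1); split; first by apply/mapP; exists j => //; rewrite mem_iota.
  exists (1 - u), u; rewrite gE; move: (v j) (v j.+1) => a b.
  by apply/quatP; split=> /=; ring.
have sE : (j%:R + u) / M = s by rewrite /u subrKC mulfK // gt_eqF.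
have n1 := near u u01; rewrite sE in n1.
have := near 1; rewrite natr1 -/(v j.+1) lexx ler01 => /(_ isT) n2.
have := qnorm2_triangle (polygon v N.+1 (s * M)) (v j) (val (f s)).
have -> : qnorm2 (polygon v N.+1 (s * M) - v j) =
    u ^+ 2 * qnorm2 (v j - v j.+1).
  by rewrite gE addrAC subrr add0r qnorm2Z -[in LHS]qnorm2N opprB.
have /andP[u0 u1] := u01; have := qnorm2_ge0 (v j - v j.+1).
move: (qnorm2 (v j - v j.+1)) n2 => D n2 D0 h.
have : u ^+ 2 * D <= D by rewrite ler_piMl // expr_le1.
by move: (qnorm2 _) n1 h => E n1 h; lra.
Qed.

Fact S3_mul_subproof (x y : S) : qnorm2 (val x * val y) = 1.
Proof. by rewrite qnorm2M !S3P mulr1. Qed.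

Definition S3_mul x y : S := mkS3 (S3_mul_subproof x y).

Fact S3_inv_subproof (x : S) : qnorm2 (qconj (val x)) = 1.
Proof. by rewrite qnorm2_conj S3P. Qed.

Definition S3_inv x : S := mkS3 (S3_inv_subproof x).

Lemma S3_mulKV (x y : S) : S3_mul (S3_mul x (S3_inv y)) y = x.
Proof. by apply: val_inj; rewrite /= -mulrA S3_Cmul mulr1. Qed.

Lemma S3_mulVV (x y : S) : S3_mul (S3_mul x (S3_inv x)) y = y.
Proof. by apply: val_inj; rewrite /= S3_mulC mul1r. Qed.

Lemma S3_mul_continuous (X : topologicalType) (f g : X -> S) :
  continuous f -> continuous g -> continuous (fun t => S3_mul (f t) (g t)).
Proof.
move=> cf cg; apply: continuous_S3; apply: continuous_qM.
- exact: (comp_continuous cf (@S3_val_continuous R)).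
- exact: (comp_continuous cg (@S3_val_continuous R)).
Qed.

Lemma S3_inv_continuous (X : topologicalType) (f : X -> S) :
  continuous f -> continuous (fun t => S3_inv (f t)).
Proof.
move=> cf; apply: continuous_S3; apply: continuous_qconj.
exact: (comp_continuous cf (@S3_val_continuous R)).
Qed.

(** A loop is close to a polygon, a polygon misses some ray [c], and the radial
    projections of the segments from the polygon to [c] contract it.  The
    contraction moves the base point; multiplying on the right by the inverse
    of its track brings it back. *)
Lemma S3_loop_contractible (f : I -> S) :
  continuous f -> f zero = f one ->
  exists H : I * I -> S, [/\ continuous H, forall s, H (s, zero) = f s,
    forall s, H (s, one) = f zero &
    forall t, H (zero, t) = f zero /\ H (one, t) = f zero].
Proof.
move=> cf f01.
have [|g [ps [cg g0 g1 gf]]] := @polygonal_approx (fun s => f (clampI s)).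
  exact: (comp_continuous (@clampI_continuous R) cf).
have [c c0 cps] := avoid_planes ps.
have gnz s (a b : R) : 0 <= s <= 1 -> a *: g s + b *: c = 0 -> b = 0.
  move=> s01 E; apply: contrapT => /eqP b0.
  have [_ [pq [pq_ps [a' [b' gE]]]]] := gf s s01.
  apply: (cps pq pq_ps (- a / b * a') (- a / b * b')).
  have -> : c = (- a / b) *: g s.
    apply: (scalerI b0); rewrite scalerA mulrCA divff // mulr1 scaleNr.
    by apply/eqP; rewrite -subr_eq0 opprK addrC E.
  rewrite gE; move: (pq.1) (pq.2) => x y.
  by apply/quatP; split=> /=; ring.
have unit01 (s : I) := valI_itv s.
pose a (t : I) := valI (clampI (2 * valI t + 0)).
pose b (t : I) := valI (clampI (2 * valI t + (-1))).
(* [a] runs from 0 to 1 before [b] starts: first from [f] to the polygon, then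
   from the polygon to [c]. *)
pose Q (z : I * I) : quat R := (1 - b z.2) *:
  ((1 - a z.2) *: val (f z.1) + a z.2 *: g (valI z.1)) + b z.2 *: c.
have Q_neq0 z : Q z != 0.
  apply/eqP; case: z => s t; rewrite /Q /=.
  have [t2|t2] := leP (valI t) 2^-1.
    have -> : b t = 0 by rewrite /b valI_clamp_le0 //; lra.
    rewrite scale0r addr0 subr0 scale1r.
    have [near_gf _] := gf _ (unit01 s); rewrite clampIK in near_gf.
    have /andP[at0 at1] := unit01 (clampI (2 * valI t + 0)).
    rewrite -!/(a t) in at0 at1 * => E.
    have : qnorm2 (val (f s)) = a t ^+ 2 * qnorm2 (g (valI s) - val (f s)).
      rewrite -qnorm2Z -[LHS]qnorm2N; congr qnorm2; apply/esym/eqP.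
      rewrite -subr_eq0 opprK; apply/eqP; rewrite -[RHS]E.
      by move=> /=; move: (sval (f s)) (g _) => x y; apply/quatP; split=> /=; ring.
    rewrite S3P; have := qnorm2_ge0 (g (valI s) - val (f s)).
    move: (qnorm2 _) near_gf => D D1 D0 E1.
    have : a t ^+ 2 * D <= D by rewrite ler_piMl // expr_le1.
    by rewrite -E1; lra.
  have -> : a t = 1 by rewrite /a valI_clamp_ge1 //; lra.
  rewrite subrr scale0r add0r scale1r => E.
  have b0 := gnz _ _ _ (unit01 s) E.
  move: E; rewrite b0 subr0 scale1r scale0r addr0 => gs0.
  have [+ _] := gf _ (unit01 s); rewrite clampIK gs0 sub0r qnorm2N S3P.
  by rewrite ltxx.
have c_a : continuous (fun z : I * I => a z.2).
  apply: (comp_continuous _ (@valI_continuous R)).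
  apply: clamp_affine_continuous.
  exact: (comp_continuous (@snd_continuous _ _) (@valI_continuous R)).
have c_b : continuous (fun z : I * I => b z.2).
  apply: (comp_continuous _ (@valI_continuous R)).
  apply: clamp_affine_continuous.
  exact: (comp_continuous (@snd_continuous _ _) (@valI_continuous R)).
have c_1B (h : I * I -> R) : continuous h -> continuous (fun z => 1 - h z).
  by move=> ch z; apply: cvgB; [exact: cvg_cst|exact: ch].
have cQ : continuous Q.
  apply: continuous_qD; apply: continuous_qZ => //; [exact: c_1B| |exact: cst_continuous].
  apply: continuous_qD; apply: continuous_qZ => //; first exact: c_1B.
    apply: (comp_continuous _ (@S3_val_continuous R)).
    exact: (comp_continuous (@fst_continuous _ _) cf).
  apply: (comp_continuous _ cg).
  exact: (comp_continuous (@fst_continuous _ _) (@valI_continuous R)).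
pose D z := S3_dir (Q z).
have cD : continuous D by move=> z; exact: continuous_at_S3_dir (Q_neq0 z) (cQ z).
pose D0 (z : I * I) := D (zero, z.2).
have cD0 : continuous D0.
  apply: (comp_continuous _ cD); apply: pair_continuous.
    exact: cst_continuous.
  exact: snd_continuous.
have D1 t : D (one, t) = D (zero, t).
  by rewrite /D /Q /= valI0 valI1 g0 g1 -/zero -/one f01.
have Dz s : D (s, zero) = f s.
  have a0 : a zero = 0 by rewrite /a valI0 mulr0 addr0 valI_clamp_le0.
  have b0 : b zero = 0.
    by rewrite /b valI0 mulr0 add0r valI_clamp_le0 // oppr_le0 ler01.
  by rewrite /D /Q /= a0 b0 !subr0 !scale0r !addr0 !scale1r S3_dir_val.
have Do s : D (s, one) = S3_dir c.
  have b1 : b one = 1 by rewrite /b valI1 mulr1 valI_clamp_ge1 //; lra.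
  by rewrite /D /Q /= b1 subrr scale0r add0r scale1r.
exists (fun z => S3_mul (S3_mul (D z) (S3_inv (D0 z))) (f zero)); split.
- apply: S3_mul_continuous; last exact: cst_continuous.
  by apply: S3_mul_continuous => //; exact: S3_inv_continuous.
- by move=> s; rewrite /D0 /= !Dz S3_mulKV.
- by move=> s; rewrite /D0 /= !Do S3_mulVV.
- by move=> t; rewrite /D0 /= D1 S3_mulVV.
Qed.

(** The pointwise quotient of two paths with the same ends is a loop. *)
Lemma S3_path_homotopy (f g : I -> S) : continuous f -> continuous g ->
  f zero = g zero -> f one = g one ->
  exists H : I * I -> S, [/\ continuous H, forall s, H (s, zero) = f s,
    forall s, H (s, one) = g s &
    forall t, H (zero, t) = f zero /\ H (one, t) = f one].
Proof.
move=> cf cg fg0 fg1; pose q s := S3_mul (f s) (S3_inv (g s)).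
have cq : continuous q by apply: S3_mul_continuous => //; exact: S3_inv_continuous.
have q01 : q zero = q one.
  by apply: val_inj; rewrite /q fg0 fg1 /= !S3_mulC.
have [H [cH H0 H1 Hq]] := S3_loop_contractible cq q01.
exists (fun z => S3_mul (H z) (g z.1)); split.
- apply: S3_mul_continuous => //; exact: (comp_continuous (@fst_continuous _ _) cg).
- by move=> s; rewrite /= H0 S3_mulKV.
- by move=> s; rewrite /= H1 /q fg0 S3_mulVV.
- move=> t; have [-> ->] := Hq t; rewrite /q fg0 !S3_mulVV fg1; split=> //.
Qed.

End SimplyConnected.

(** * The fundamental group of a diagonal lens space *)

Section LensPi1.
Variables (R : realType) (p : nat).
Hypothesis p_gt0 : (0 < p)%N.
Local Notation S := (S3 R).
Local Notation L := (lens_space R p 1).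
Local Notation ppi := (@lens_pi R p).
Local Notation I := (unitI R).
Variables (x0 : S) (l : L).
Hypothesis x0l : ppi x0 = l.
Implicit Types (f g : loop R l) (A B : I -> S).

Definition is_lift f A : Prop :=
  [/\ continuous A, forall s, ppi (A s) = f s & A zero = x0].

Lemma lift_exists f : exists A, is_lift f A.
Proof. by apply: path_lift => //; [exact: cts_fun|rewrite path_zero]. Qed.

Lemma deg_exists f : exists i : 'I_p.-1.+1,
  forall A, is_lift f A -> A one = zeta_act p i%:Z x0.
Proof.
have [A [cA Af A0]] := lift_exists f.
have /lens_piP[m A1] : ppi x0 = ppi (A one) by rewrite Af path_one.
have p0 : p%:Z != 0 by rewrite eqz_nat -lt0n.
have i_lt : (`|(m %% p)%Z|%N < p.-1.+1)%N.
  by have := modz_ge0 m p0; have := ltz_pmod m (d := p); lia.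
exists (Ordinal i_lt) => B [cB Bf B0].
rewrite -(@lift_unique _ _ p_gt0 A B) //; last by rewrite A0.
  apply: val_inj; rewrite A1 /=; congr (_ * _).
  by rewrite gez0_abs ?modz_ge0 // zeta_mod.
by move=> s; rewrite Af Bf.
Qed.

(** The deck transformation that carries the start of a lift to its end. *)
Definition deg f : 'I_p.-1.+1 := projT1 (cid (deg_exists f)).

Lemma degP f A : is_lift f A -> A one = zeta_act p (deg f)%:Z x0.
Proof. exact: projT2 (cid (deg_exists f)) A. Qed.

Lemma zeta_act_ord_inj (i j : 'I_p.-1.+1) :
  zeta_act p i%:Z x0 = zeta_act p j%:Z x0 -> i = j.
Proof.
move=> /(zeta_act_eq p_gt0) E; apply: val_inj.
have small (k : 'I_p.-1.+1) : (k%:Z %% p)%Z = k.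
  by apply: modz_small; have := ltn_ord k; lia.
by move: E; rewrite !small => -[].
Qed.

(** The vertical sides of a lifted homotopy lift constant paths, hence are
    constant. *)
Lemma deg_homotopic f g : loop_rel f g -> deg f = deg g.
Proof.
move=> /asboolP[H [cH Hf Hg Hl]]; apply: zeta_act_ord_inj.
have H00 : ppi x0 = H (zero, zero) by rewrite Hf path_zero.
have [K [cK KH K00]] := square_lift p_gt0 cH H00.
have slice (k : I -> I * I) : continuous k -> continuous (fun s => K (k s)).
  by move=> ck; exact: (comp_continuous ck cK).
have ch (t : I) : continuous (fun s : I => (s, t)).
  by apply: pair_continuous; [move=> ?; exact: cvg_id|exact: cst_continuous].
have cv (s : I) : continuous (fun t : I => (s, t)).
  by apply: pair_continuous; [exact: cst_continuous|move=> ?; exact: cvg_id].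
have const (s : I) : s = zero \/ s = one -> forall t, K (s, t) = K (s, zero).
  move=> s01 t.
  apply: (@lift_unique _ _ p_gt0 (fun t => K (s, t)) (fun=> K (s, zero))) => //.
  - exact: slice.
  - exact: cst_continuous.
  - move=> u; rewrite !KH; have [a b] := Hl u; have [c d] := Hl zero.
    by case: s01 => ->; rewrite ?a ?b ?c ?d.
rewrite -(@degP f (fun s => K (s, zero))); last first.
  by split=> //; [exact: slice|move=> s; rewrite KH Hf].
rewrite -(@degP g (fun s => K (s, one))); first by rewrite (const one) //; right.
split; first exact: slice.
  by move=> s; rewrite KH Hg.
by rewrite (const zero) //; left.
Qed.

(** Lifts with the same ends are homotopic in the simply connected sphere. *)
Lemma deg_inj f g : deg f = deg g -> loop_rel f g.
Proof.
move=> fg; have [A Af] := lift_exists f; have [B Bg] := lift_exists g.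
have A1 := degP Af; have B1 := degP Bg.
have [cA A_f A0] := Af; have [cB B_g B0] := Bg.
have [||H [cH HA HB Hx]] := S3_path_homotopy cA cB.
- by rewrite A0 B0.
- by rewrite A1 B1 fg.
apply/asboolP; exists (fun z => ppi (H z)); split.
- exact: (comp_continuous cH (@lens_pi_continuous R p)).
- by move=> s; rewrite HA A_f.
- by move=> s; rewrite HB B_g.
- move=> t; have [-> ->] := Hx t; rewrite A1 A0 lens_piE //.
Qed.

(** A lift of the second loop is translated to the end of the lift of the
    first; this does not change its degree because the group is abelian. *)
Lemma deg_cat f g : deg (loop_cat f g) = deg f + deg g.
Proof.
have [A Af] := lift_exists f; have [B Bg] := lift_exists g.
have A1 := degP Af; have B1 := degP Bg.
have [cA A_f A0] := Af; have [cB B_g B0] := Bg.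
pose B' s := zeta_act p (deg f)%:Z (B s).
have cB' : continuous B' by apply: (comp_continuous cB); exact: zeta_act_continuous.
have lift : is_lift (loop_cat f g) (cat_fun A B').
  split.
  - apply: (paste_continuous (@valI_continuous R)) => [||s ->].
    + apply: (comp_continuous _ cA).
      exact/clamp_affine_continuous/valI_continuous.
    + apply: (comp_continuous _ cB').
      exact/clamp_affine_continuous/valI_continuous.
    + by rewrite addr0 divff // subrr -/zero -/one A1 /B' B0.
  - move=> s; change (ppi (cat_fun A B' s) = cat_fun f g s); rewrite /cat_fun.
    by case: ifP => _; rewrite ?A_f // /B' lens_piE.
  - by rewrite /cat_fun valI0 invr_ge0 ler0n mulr0 addr0.
apply: zeta_act_ord_inj; rewrite -(degP lift) /cat_fun valI1.
rewrite leNgt half_lt1 /= mulr1 (_ : 2 - 1 = 1); last by ring.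
rewrite -/one /B' B1 -zeta_actD.
apply: val_inj => /=; congr (_ * _).
rewrite -(zeta_mod R p_gt0) -PoszD modz_nat; congr zeta; congr Posz.
by move: (nat_of_ord (deg f) + deg g)%N => k /=; rewrite prednK.
Qed.

Lemma deg_surj i : exists f, deg f = i.
Proof.
pose A (s : I) : S := S3_mul (mkS3 (qnorm2_cis (valI s * lens_angle R p i%:Z))) x0.
have cA : continuous A.
  apply: S3_mul_continuous; last exact: cst_continuous.
  apply: continuous_S3.
  apply: (@cis_continuous R I (fun s => valI s * lens_angle R p i%:Z)) => s.
  exact: (cvgM (@valI_continuous R s) (cvg_cst _)).
have A0 : A zero = x0.
  by apply: val_inj; rewrite /= valI0 mul0r cis0 mul1r.
have A1 : A one = zeta_act p i%:Z x0.
  by apply: val_inj; rewrite /= valI1 mul1r.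
have cf : continuous (fun s => ppi (A s)).
  exact: (comp_continuous cA (@lens_pi_continuous R p)).
have f0 : ppi (A zero) = l by rewrite A0.
have f1 : ppi (A one) = l by rewrite A1 lens_piE.
pose f : loop R l := mk_path cf f0 f1.
by exists f; apply: zeta_act_ord_inj; rewrite -A1 -(@degP f A).
Qed.

Lemma lens_pi1_cyclic : pi1_cyclic R l p.
Proof.
split=> //; pose phi (a : pi1 R l) := deg (repr a).
have phiE f : phi (\pi_(pi1 R l) f) = deg f.
  by apply: deg_homotopic; apply/eqmodP; rewrite reprK.
exists phi; split; last first.
  by move=> a b; rewrite /pi1_mul phiE deg_cat.
pose psi i : pi1 R l := \pi_(pi1 R l) (projT1 (cid (deg_surj i))).
have psiK : cancel psi phi.
  by move=> i; rewrite /psi phiE; case: (cid _).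
exists psi => // a; rewrite -[RHS]reprK /psi; apply/eqmodP.
by apply: deg_inj; case: (cid _).
Qed.

End LensPi1.

Section Pi1Homeomorphic.
Variable R : realType.

Lemma pi1_cyclic_homeomorphic (X Y : topologicalType) (m : nat) :
  homeomorphic X Y -> (forall y : Y, pi1_cyclic R y m) ->
  forall x : X, pi1_cyclic R x m.
Proof.
move=> [f [g [cf cg fK gK]]] Ym x; have [m0 [phi [bij_phi phiM]]] := Ym (f x).
split=> //.
have push0 (k : loop R x) : f (k zero) = f x by rewrite path_zero.
have push1 (k : loop R x) : f (k one) = f x by rewrite path_one.
pose push (k : loop R x) : loop R (f x) :=
  mk_path (comp_continuous (@cts_fun _ _ k) cf) (push0 k) (push1 k).
have pull0 (k : loop R (f x)) : g (k zero) = x by rewrite path_zero.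
have pull1 (k : loop R (f x)) : g (k one) = x by rewrite path_one.
pose pull (k : loop R (f x)) : loop R x :=
  mk_path (comp_continuous (@cts_fun _ _ k) cg) (pull0 k) (pull1 k).
have push_rel k k' : loop_rel k k' -> loop_rel (push k) (push k').
  move=> /asboolP[H [cH H0 H1 Hx]]; apply/asboolP; exists (fun z => f (H z)); split.
  - exact: (comp_continuous cH cf).
  - by move=> s; rewrite H0.
  - by move=> s; rewrite H1.
  - by move=> t; have [-> ->] := Hx t.
have pull_rel k k' : loop_rel k k' -> loop_rel (pull k) (pull k').
  move=> /asboolP[H [cH H0 H1 Hx]]; apply/asboolP; exists (fun z => g (H z)); split.
  - exact: (comp_continuous cH cg).
  - by move=> s; rewrite H0.
  - by move=> s; rewrite H1.
  - by move=> t; have [-> ->] := Hx t.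
have pushK k : pull (push k) = k by apply/path_eqP => s; exact: fK.
have pullK k : push (pull k) = k by apply/path_eqP => s; exact: gK.
pose F (a : pi1 R x) : pi1 R (f x) := \pi_(pi1 R (f x)) (push (repr a)).
pose G (a : pi1 R (f x)) : pi1 R x := \pi_(pi1 R x) (pull (repr a)).
have FE k : F (\pi_(pi1 R x) k) = \pi_(pi1 R (f x)) (push k).
  by apply/eqmodP/push_rel; apply/eqmodP; rewrite reprK.
have GE k : G (\pi_(pi1 R (f x)) k) = \pi_(pi1 R x) (pull k).
  by apply/eqmodP/pull_rel; apply/eqmodP; rewrite reprK.
have FK : cancel F G.
  by move=> a; rewrite /F GE pushK reprK.
have GK : cancel G F.
  by move=> a; rewrite /G FE pullK reprK.
exists (fun a => phi (F a)); split; first by apply: bij_comp => //; exists G.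
move=> a b; rewrite -phiM; congr phi.
rewrite {1}/pi1_mul FE /F pi1_mulE; congr (\pi_(_) _); apply/path_eqP => s.
change (f (cat_fun (repr a) (repr b) s) = cat_fun (push (repr a)) (push (repr b)) s).
by rewrite /cat_fun; case: ifP.
Qed.

Lemma pi1_cyclic_inj (X : topologicalType) (x : X) m n :
  pi1_cyclic R x m -> pi1_cyclic R x n -> m = n.
Proof.
move=> [m0 [phi [[phi' phiK phi'K] _]]] [n0 [psi [[psi' psiK psi'K] _]]].
have /bij_eq_card : bijective (psi \o phi').
  by exists (phi \o psi') => i /=; rewrite ?psiK ?phiK ?phi'K ?psi'K.
by rewrite !card_ord !prednK.
Qed.

End Pi1Homeomorphic.

(** * Recognizing diagonal lens spaces *)

Section Recognition.
Variable R : realType.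

Lemma lens_compact p : compact [set: lens_space R p 1].
Proof.
have -> : [set: lens_space R p 1] = @lens_pi R p @` [set: S3 R].
  by apply/seteqP; split=> // l _; have [x <-] := lens_pi_surj l; exists x.
apply: continuous_compact; last exact: S3_compact.
by apply: continuous_subspaceT; exact: lens_pi_continuous.
Qed.

(** The bijection induced on the compact lens space is a homeomorphism. *)
Lemma lens_of_fibres (p : nat) (X : topologicalType) (f : S3 R -> X) :
  hausdorff_space X -> continuous f -> (forall y, exists x, f x = y) ->
  (forall x x', f x = f x' <-> exists m, x' = zeta_act p m x) ->
  homeomorphic (lens_space R p 1) X.
Proof.
move=> hX cf f_surj fP; pose F (l : lens_space R p 1) := f (repr l).
have FE x : F (lens_pi p x) = f x.
  by apply/fP/lens_piP; rewrite /lens_pi reprK.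
pose G y : lens_space R p 1 := lens_pi p (projT1 (cid (f_surj y))).
apply: (@compact_hausdorff_homeomorphic _ _ F G) => //.
- exact: lens_compact.
- apply/quotient_continuous; rewrite (_ : F \o _ = f) //.
  by apply/funext => x; exact: FE.
- move=> l; rewrite /G; case: (cid _) => x /= xE.
  by have [z zl] := lens_pi_surj l; rewrite -zl FE in xE *; apply/lens_piP/fP.
- by move=> y; rewrite /G FE; case: (cid _).
Qed.

End Recognition.

(** * Milnor spheres *)

Lemma continuous_bool_prod (X Y : topologicalType) (f : bool * X -> Y) :
  (forall b, continuous (fun x => f (b, x))) -> continuous f.
Proof.
move=> cf [b x] U fU; have Ux : nbhs x [set x' | U (f (b, x'))] := cf b x U fU.
exists ([set b], [set x' | U (f (b, x'))]); first by split.
by move=> [b' x'] [/= -> ].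
Qed.

Section MilnorTopology.
Variables (R : realType) (k l : int).
Local Notation M := (milnor R k l).
Local Notation MP := (\pi_(milnor R k l) : charts R -> M).
Implicit Types (u : quat R) (v : S3 R).

Lemma qnorm_sqr u : qnorm u ^+ 2 = qnorm2 u.
Proof. by rewrite sqr_sqrtr // qnorm2_ge0. Qed.

Lemma milnor_piP x y : MP x = MP y <-> milnor_rel k l x y.
Proof. by split=> [/eqmodP|xy]; last exact/eqmodP. Qed.

Lemma milnor_piP_same b (x y : quat R * S3 R) : MP (b, x) = MP (b, y) <-> x = y.
Proof. by split=> [/milnor_piP/asboolP|->//]; case: b. Qed.

Lemma milnor_glue x y : glued k l x y -> MP (false, x) = MP (true, y).
Proof. by move=> xy; apply/milnor_piP/asboolP. Qed.

Lemma qnorm2_qdir u : u != 0 -> qnorm2 (qdir u) = 1.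
Proof. exact: qnorm2_dir. Qed.

Lemma qdir_unit u : u != 0 -> qdir u \is a GRing.unit.
Proof. by move=> u0; rewrite quat_unitE -qnorm2_eq0 qnorm2_qdir // oner_eq0. Qed.

Lemma qnorm2_expz (x : quat R) (n : int) : qnorm2 x = 1 -> qnorm2 (x ^ n) = 1.
Proof.
move=> x1; have X (m : nat) : qnorm2 (x ^+ m) = 1.
  by elim: m => [|m IHm]; rewrite ?expr0 ?qnorm21 // exprS qnorm2M IHm x1 mulr1.
case: n => n; first exact: X.
have u : x ^+ n.+1 \is a GRing.unit by rewrite quat_unitE -qnorm2_eq0 X oner_eq0.
rewrite NegzE -exprnN; have := congr1 (@qnorm2 R) (divrr u).
by rewrite qnorm2M X mul1r qnorm21.
Qed.

Lemma milnor_descend (Z : topologicalType) (G : charts R -> Z) :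
  (forall b, continuous (fun z => G (b, z))) ->
  (forall x y, glued k l x y -> G (false, x) = G (true, y)) ->
  exists2 G' : M -> Z, continuous G' & forall c, G' (MP c) = G c.
Proof.
move=> cG GE; have E c : (G \o repr) (MP c) = G c.
  have /milnor_piP : MP (repr (MP c)) = MP c by rewrite reprK.
  rewrite /=; set r := repr (MP c); clearbody r.
  move: r c => [a x] [b y] /asboolP; case: a b => -[] /= xy.
  - by rewrite xy.
  - by rewrite (GE y x).
  - by rewrite (GE x y).
  - by rewrite xy.
exists (G \o repr) => //; apply/quotient_continuous.
rewrite (_ : _ \o _ = G); first exact: continuous_bool_prod.
by apply/funext => c; exact: E.
Qed.

(** Moving a fibre coordinate to the other chart makes no sense over the
    origin, but after damping by the square of the norm of the base
    coordinate it does. *)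
Definition damped (a b : int) (z : quat R * S3 R) : quat R :=
  qnorm2 z.1 *: (qdir z.1 ^ a * val z.2 * qdir z.1 ^ b).

Lemma cvg_q0 (T : Type) (F : set_system T) (f : T -> quat R) : Filter F ->
  qnorm2 (f t) @[t --> F] --> 0 -> f t @[t --> F] --> (0 : quat R).
Proof.
move=> FF f0.
have s0 : qnorm (f t) @[t --> F] --> 0.
  by rewrite -(@sqrtr0 R); apply: cvg_comp f0 _; exact: sqrt_continuous.
have sN0 : (- qnorm (f t)) @[t --> F] --> 0 by rewrite -oppr0; exact: cvgN.
have bound (a b : R) : a ^+ 2 <= b -> - Num.sqrt b <= a <= Num.sqrt b.
  move=> ab; rewrite -ler_norml -sqrtr_sqr ler_sqrt //.
  exact: le_trans (sqr_ge0 a) ab.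
apply: cvg_quat => /=; apply: squeeze_cvgr sN0 s0; near=> t; apply: bound;
  have := sqr_ge0 (qre (f t)); have := sqr_ge0 (qi (f t));
  have := sqr_ge0 (qj (f t)); have := sqr_ge0 (qk (f t));
  rewrite /qnorm2; lra.
Unshelve. all: by end_near. Qed.

(** The twisted fibre coordinate has norm 1 off the origin, so the damping
    factor makes the product tend to 0 there. *)
Lemma damped_continuous a b : continuous (damped a b).
Proof.
move=> [u v]; have c1 : continuous (fun z : quat R * S3 R => z.1).
  exact: fst_continuous.
have cN : continuous (fun z : quat R * S3 R => qnorm2 z.1).
  exact: continuous_qnorm2.
have [u0|u0] := eqVneq u 0; last first.
  apply: cvg_qZ; first exact: (cN (u, v)).
  have cd : qdir z.1 @[z --> (u, v)] --> qdir u.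
    by apply: cvg_qdir => //; exact: (c1 (u, v)).
  have d0 : qdir u != 0 by rewrite -quat_unitE qdir_unit.
  apply: cvg_qM; last exact: cvg_qXz.
  apply: cvg_qM; first exact: cvg_qXz.
  exact: (comp_continuous (@snd_continuous _ _) (@S3_val_continuous R)).
have N0 : qnorm2 (0 : quat R) = 0 by apply/eqP; rewrite qnorm2_eq0.
suff H : damped a b z @[z --> (u, v)] --> (0 : quat R).
  have E : damped a b (u, v) = 0 by rewrite /damped /= u0 N0 scale0r.
  by rewrite /continuous_at E.
apply: cvg_q0; rewrite (_ : (fun z => _) = fun z => qnorm2 z.1 ^+ 2).
  rewrite -[X in _ --> X](_ : qnorm2 u ^+ 2 = 0); last by rewrite u0 N0 expr0n.
  exact: (cvgM (cN (u, v)) (cN (u, v))).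
apply/funext => -[w x]; rewrite /damped /= qnorm2Z !qnorm2M S3P.
have [->|w0] := eqVneq w 0; first by rewrite N0 expr0n /= !mul0r.
by rewrite !qnorm2_expz ?qnorm2_qdir // !mulr1.
Qed.

Lemma glued_norm (x y : quat R * S3 R) : glued k l x y ->
  qnorm2 x.1 != 0 /\ qnorm2 y.1 = (qnorm2 x.1)^-1.
Proof.
move=> [x0 y1 _]; have N0 : qnorm2 x.1 != 0 by rewrite qnorm2_eq0.
by split=> //; rewrite y1 qnorm_sqr qnorm2Z; field.
Qed.

Lemma glued_dir (x y : quat R * S3 R) : glued k l x y -> qdir y.1 = qdir x.1.
Proof.
move=> xy; have [N0 yN] := glued_norm xy; have [x0 y1 _] := xy.
have n0 : qnorm x.1 != 0 by rewrite gt_eqF // qnorm_gt0.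
rewrite /qdir {2}y1 scalerA; congr (_ *: _).
rewrite {1}/qnorm yN sqrtrV ?qnorm2_ge0 // invrK -/(qnorm _).
by field.
Qed.

Lemma unglue u v : u != 0 ->
  exists x, MP (false, x) = MP (true, (u, v)).
Proof.
move=> u0; have N0 : qnorm2 u != 0 by rewrite qnorm2_eq0.
have v1 : qnorm2 (qdir u ^ (- k) * val v * qdir u ^ (- l)) = 1.
  by rewrite !qnorm2M S3P !qnorm2_expz ?qnorm2_qdir // !mulr1.
pose x := ((qnorm2 u)^-1 *: u, mkS3 v1); exists x; apply: milnor_glue.
have x0 : x.1 != 0 by rewrite /= scaler_eq0 negb_or invr_eq0 N0.
have xN : qnorm2 x.1 = (qnorm2 u)^-1 by rewrite /= qnorm2Z; field.
have xD : (qnorm x.1)^-1 *: x.1 = qdir u.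
  rewrite /= /qdir scalerA; congr (_ *: _).
  rewrite {1}/qnorm xN sqrtrV ?qnorm2_ge0 // invrK -/(qnorm _) -qnorm_sqr.
  by have := qnorm_gt0 u0; move: (qnorm u) => t t0; field; rewrite gt_eqF.
split=> //.
  by rewrite qnorm_sqr xN invrK /= scalerA divff // scale1r.
have du := qdir_unit u0.
rewrite xD /= !mulrA -exprzDr // subrr mul1r -!mulrA -exprzDr // addNr mulr1.
by [].
Qed.

Definition damping (z : quat R * S3 R) : R := (1 + qnorm2 z.1)^-1.

Lemma damping_gt0 (z : quat R * S3 R) : 0 < 1 + qnorm2 z.1.
Proof. by rewrite ltr_wpDr // qnorm2_ge0. Qed.

Lemma damping_continuous : continuous damping.
Proof.
move=> z; apply: cvgV; first by rewrite gt_eqF // damping_gt0.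
apply: cvgD; first exact: cvg_cst.
exact: (continuous_qnorm2 (@fst_continuous _ _)).
Qed.

Definition base_coord (c : charts R) : quat R := damping c.2 *: c.2.1.
Definition height_coord (c : charts R) : R :=
  (if c.1 then -1 else 1) * ((1 - qnorm2 c.2.1) * damping c.2).
Definition fibre_coord (b : bool) (c : charts R) : quat R :=
  damping c.2 *: (if c.1 == b then val c.2.2
    else if b then damped k l c.2 else damped (- k) (- l) c.2).

(** A point is determined by its image in the 4-sphere together with the two
    damped fibre coordinates. *)
Lemma milnor_hausdorff : hausdorff_space M.
Proof.
have [base_coord' cbase' baseE] : exists2 f : M -> quat R, continuous f &
    forall c, f (MP c) = base_coord c.
  apply: milnor_descend => [b|x y xy].
    exact: (continuous_qZ damping_continuous (@fst_continuous _ _)).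
  have [N0 yN] := glued_norm xy; have [x0 y1 _] := xy.
  have X1 := damping_gt0 x.
  rewrite /base_coord /damping /= yN y1 scalerA qnorm_sqr; congr (_ *: _).
  by field; rewrite N0 gt_eqF // addrC.
have [height_coord' cheight' heightE] : exists2 f : M -> R, continuous f &
    forall c, f (MP c) = height_coord c.
  apply: milnor_descend => [b z|x y xy].
    apply: cvgM; first exact: cvg_cst.
    apply: cvgM; last exact: damping_continuous.
    apply: cvgB; first exact: cvg_cst.
    exact: (continuous_qnorm2 (@fst_continuous _ _)).
  have [N0 yN] := glued_norm xy; have X1 := damping_gt0 x.
  rewrite /height_coord /damping /= yN.
  by field; rewrite N0 gt_eqF // addrC.
have [fibre_coord' cfibre' fibreE] : exists2 f : bool -> M -> quat R,
    (forall b, continuous (f b)) & forall b c, f b (MP c) = fibre_coord b c.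
  suff H b : exists2 f : M -> quat R, continuous f & forall c, f (MP c) = fibre_coord b c.
    exists (fun b => projT1 (cid2 (H b))) => b; by case: (cid2 (H b)).
  apply: milnor_descend => [a|x y xy].
    apply: (continuous_qZ damping_continuous).
    have cv := comp_continuous (@snd_continuous (quat R) (S3 R)) (@S3_val_continuous R).
    by case: a; case: b; do [exact: cv|exact: damped_continuous].
  have [N0 yN] := glued_norm xy; have yD := glued_dir xy; have X1 := damping_gt0 x.
  have [x0 _ yv] := xy; have du := qdir_unit x0.
  have dE : damping y = qnorm2 x.1 * damping x.
    by rewrite /damping yN; field; rewrite N0 gt_eqF // addrC.
  case: b; rewrite /fibre_coord /= /damped.
    by rewrite dE yv -/(qdir _) scalerA [_ * damping x]mulrC.
  rewrite yD dE scalerA yN mulrAC divff // mul1r yv -/(qdir _).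
  congr (_ *: _); rewrite !mulrA -exprzDr // addNr mul1r.
  by rewrite -!mulrA -exprzDr // subrr mulr1.
have heightE' (t : R) : 0 < 1 + t -> (1 - t) / (1 + t) = 2 * (1 + t)^-1 - 1.
  by move=> t0; field; rewrite gt_eqF.
apply: (@hausdorff_of_separating R) => p q.
suff same b x y : (forall f : M -> R, continuous f -> f (MP (b, x)) = f (MP (b, y))) ->
    x = y.
  rewrite -[p]reprK -[q]reprK.
  have flip x y : (forall f : M -> R, continuous f ->
      f (MP (false, x)) = f (MP (true, y))) -> MP (false, x) = MP (true, y).
    (* Over the origin of the second chart the height is -1, a value that the
       first chart does not attain. *)
    case: y => u v E; have [u0|u0] := eqVneq u 0.
      have := E _ cheight'; rewrite !heightE /height_coord /damping /= u0.
      have -> : qnorm2 (0 : quat R) = 0 by apply/eqP; rewrite qnorm2_eq0.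
      rewrite subr0 addr0 invr1 !mulr1 mul1r heightE' ?damping_gt0 // => E'.
      by exfalso; have := damping_gt0 x; rewrite -invr_gt0; lra.
    have [w wE] := unglue v u0; rewrite -wE; congr MP; congr pair.
    by apply: (same false) => f cf; rewrite wE E.
  case: (repr p) (repr q) => -[] x [[] y] E.
  - by rewrite (same true x y).
  - by apply/esym/flip => f cf; rewrite E.
  - exact: flip.
  - by rewrite (same false x y).
move=> E; have EQ := @eq_quat_of_separating R _ _ _ E.
have Eh := E _ cheight'; have Eb := EQ _ cbase'; have Ef := EQ _ (cfibre' b).
rewrite !heightE /height_coord /= in Eh; rewrite !baseE /base_coord /= in Eb.
rewrite !fibreE /fibre_coord /= eqxx in Ef.
have sgn0 : (if b then -1 else 1 : R) != 0 by case: (b); rewrite ?oppr_eq0 oner_eq0.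
have {Eh} := mulfI sgn0 Eh; rewrite /damping => Eh.
have NE : 1 + qnorm2 x.1 = 1 + qnorm2 y.1.
  have X0 := damping_gt0 x; have Y0 := damping_gt0 y.
  move: Eh; rewrite !heightE' // => /addIr /(mulfI _) H.
  by apply: invr_inj; apply: H; rewrite pnatr_eq0.
have d0 : (1 + qnorm2 y.1)^-1 != 0 by rewrite invr_eq0 gt_eqF // damping_gt0.
move: Eb Ef; rewrite /damping NE => /(scalerI d0) E1 /(scalerI d0) E2.
by rewrite [x]surjective_pairing E1 (val_inj E2) -surjective_pairing.
Qed.

End MilnorTopology.

(** * Complex coordinates on the 3-sphere *)

Section ComplexCoordinates.
Variable R : realType.
Implicit Types (x z u : quat R) (r s t a b : R).

Definition quat_j : quat R := Quat 0 0 1 0.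
Definition cpart1 x : quat R := Quat (qre x) (qi x) 0 0.
Definition cpart2 x : quat R := Quat (qj x) (qk x) 0 0.

(** The quaternion [z + w j] with [z = r e^(ia)] and [w = s e^(ib)]. *)
Definition polar r a s b : quat R := r *: cis a + s *: (cis b * quat_j).

Lemma cpart1_polar r a s b : cpart1 (polar r a s b) = r *: cis a.
Proof. by apply/quatP; split=> /=; ring. Qed.

Lemma cpart2_polar r a s b : cpart2 (polar r a s b) = s *: cis b.
Proof. by apply/quatP; split=> /=; ring. Qed.

Lemma qnorm2_polar r a s b : qnorm2 (polar r a s b) = r ^+ 2 + s ^+ 2.
Proof.
transitivity (r ^+ 2 * (cos a ^+ 2 + sin a ^+ 2) +
  s ^+ 2 * (cos b ^+ 2 + sin b ^+ 2)); first by rewrite /qnorm2 /=; ring.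
by rewrite !cos2Dsin2 !mulr1.
Qed.

Lemma cis_polar t r a s b : cis t * polar r a s b = polar r (t + a) s (t + b).
Proof. by apply/quatP; rewrite /= !cosD !sinD; split; ring. Qed.

Lemma qnorm2_Zcis r a : qnorm2 (r *: cis a) = r ^+ 2.
Proof. by rewrite qnorm2Z qnorm2_cis mulr1. Qed.

Lemma Zcis_eq0 r a : (r *: cis a == 0) = (r == 0).
Proof. by rewrite -qnorm2_eq0 qnorm2_Zcis sqrf_eq0. Qed.

Lemma qdir_Zcis r a : 0 < r -> qdir (r *: cis a) = cis a.
Proof.
move=> r0; rewrite /qdir /qnorm qnorm2_Zcis sqrtr_sqr gtr0_norm // scalerA.
by rewrite mulVf ?scale1r // gt_eqF.
Qed.

Lemma complex_polar z : qj z = 0 -> qk z = 0 ->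
  exists r a, 0 <= r /\ z = r *: cis a.
Proof.
move=> zj zk; have [z0|z0] := eqVneq z 0.
  by exists 0, 0; rewrite scale0r.
have n0 := qnorm_gt0 z0.
have [|a aE] := @cis_surj R (qre z / qnorm z) (qi z / qnorm z).
  rewrite !expr_div_n -mulrDl qnorm_sqr (_ : _ + _ = qnorm2 z).
    by rewrite divff // qnorm2_eq0.
  by rewrite /qnorm2 zj zk expr0n /= !addr0.
exists (qnorm z), a; split; first exact: ltW.
rewrite -aE; apply/quatP; rewrite /= zj zk !mulr0.
by split=> //; rewrite mulrC divfK // gt_eqF.
Qed.

Lemma quat_polar x : exists r a s b, [/\ 0 <= r, 0 <= s & x = polar r a s b].
Proof.
have [r [a [r0 x1]]] := @complex_polar (cpart1 x) erefl erefl.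
have [s [b [s0 x2]]] := @complex_polar (cpart2 x) erefl erefl.
exists r, a, s, b; split=> //; rewrite /polar -x1 scalerAl -x2.
by apply/quatP; split=> /=; ring.
Qed.

Lemma S3_polar (x : S3 R) : exists r a s b,
  [/\ 0 <= r, 0 <= s, r ^+ 2 + s ^+ 2 = 1 & val x = polar r a s b].
Proof.
have [r [a [s [b [r0 s0 xE]]]]] := quat_polar (val x); exists r, a, s, b.
by split=> //; rewrite -(S3P x) xE qnorm2_polar.
Qed.

Fact cis_j_subproof a : qnorm2 (cis a * quat_j) = 1.
Proof.
by rewrite qnorm2M qnorm2_cis mul1r /qnorm2 /= expr1n !expr0n /= !add0r addr0.
Qed.

Definition S3_cis_j a : S3 R := mkS3 (cis_j_subproof a).

Lemma cis_jC a : quat_j * cis a = cis (- a) * quat_j.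
Proof. by apply/quatP; rewrite /= cosN sinN; split; ring. Qed.

Lemma cis_j_inj a b : S3_cis_j a = S3_cis_j b -> cis a = cis b.
Proof.
move=> /(congr1 val) /quatP[_ _ /= cE sE]; apply/quatP; split=> //=; lra.
Qed.

Lemma S3_dir_cis_j a : S3_dir (cis a * quat_j) = S3_cis_j a.
Proof. exact: S3_dir_val (S3_cis_j a). Qed.

Lemma cis_eq a b : cis a = cis b -> exists n : int, b - a = n%:~R * (2 * pi).
Proof.
by move=> ab; apply: cis_eq1; rewrite cisD -ab cisN divrr // cis_unit.
Qed.

Lemma cpart1_continuous : continuous cpart1.
Proof.
apply/continuous_quatP; split; [exact: qre_continuous|exact: qi_continuous| |];
  exact: cst_continuous.
Qed.

Lemma cpart2_continuous : continuous cpart2.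
Proof.
apply/continuous_quatP; split; [exact: qj_continuous|exact: qk_continuous| |];
  exact: cst_continuous.
Qed.

Lemma qJ_i x : qJ (S3_i R) x = Quat (qre x) (qi x) (- qj x) (- qk x).
Proof. by apply/quatP; split=> /=; ring. Qed.

End ComplexCoordinates.

(** * The fixed point set in a Milnor sphere *)

Section FixedMilnor.
Variables (R : realType) (d : int).
Hypothesis d_odd : odd `|d|%N.
Local Notation k := (milnor_k d).
Local Notation l := (milnor_l d).
Local Notation MP := (\pi_(M7 R d) : charts R -> M7 R d).
Local Notation F := (fixed_points (@M7_act R d) (neg_i R)).
Implicit Types (r s t a b : R).

Lemma d_neq0 : d%:~R != 0 :> R.
Proof. by rewrite intr_eq0; apply: contraTneq d_odd => ->. Qed.

Lemma d_sgz_abs : d%:~R = (sgz d)%:~R * `|d|%N%:R :> R.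
Proof. by rewrite {1}[d]intEsg intrM -pmulrn. Qed.

Lemma sgz_d_sqr : sgz d * sgz d = 1.
Proof. by rewrite mulz_sg; case: eqP d_odd => // ->. Qed.

Lemma absd_gt0 : (0 < `|d|)%N.
Proof. by rewrite absz_gt0; apply: contraTneq d_odd => ->. Qed.

(** A point is fixed when [u] commutes and [v] anticommutes with [i]. *)
Lemma fixed_chart c (u : quat R) (v : S3 R) :
  F (MP (c, (u, v))) <-> exists t a b,
    [/\ 0 <= t, u = t *: cis a & v = S3_cis_j b].
Proof.
have -> : F (MP (c, (u, v))) = (MP (chart_act true (S3_i R) (c, (u, v))) = MP (c, (u, v))).
  by rewrite /fixed_points /= /M7_act /neg_i milnor_actE.
split=> [/milnor_piP_same [uE vE]|[t [a [b [_ -> ->]]]]]; last first.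
  apply/milnor_piP_same; congr pair.
    by rewrite qJ_i; apply/quatP; split=> /=; ring.
  apply: val_inj; rewrite /= qJ_i /qsgn mulN1r.
  by apply/quatP; split=> /=; ring.
have [t [a [t0 ta]]] : exists t a, 0 <= t /\ u = t *: cis a.
  by move: uE; rewrite qJ_i => /quatP[_ _ uj uk]; apply: complex_polar; move: uj uk => /=; lra.
have vE' : qre (val v) = 0 /\ qi (val v) = 0.
  have : qsgn R true * qJ (S3_i R) (val v) = val v := congr1 val vE.
  rewrite qJ_i /qsgn mulN1r => /quatP[/= vr vi _ _].
  by split; lra.
have [|b bE] := @cis_surj R (qj (val v)) (qk (val v)).
  by rewrite -(S3P v) /qnorm2 vE'.1 vE'.2 expr0n /= !add0r.
exists t, a, b; split=> //; apply: val_inj; rewrite /= -bE.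
by apply/quatP; rewrite vE'.1 vE'.2; split=> /=; ring.
Qed.

(** Complex numbers are conjugated when they pass [j], which turns the exponent
    [k + l] of the gluing map into [k - l = d]. *)
Lemma cis_glue a b t : cis a ^ k * (cis b * quat_j R) * cis a ^ l =
  cis (d%:~R * a + b) * quat_j R.
Proof.
have [_ kl] := milnor_klP d_odd.
rewrite !cisXz -!mulrA cis_jC !mulrA -!cisD; congr (cis _ * _).
by rewrite -[in RHS]kl intrB; ring.
Qed.

(** For [x = z + w j] these are the charts [(z / w, (w/|w|)^d j)] and
    [(z / w / |z / w|^2, (z/|z|)^d j)], written with [z / w] as
    [z (conj w) / |w|^2].  The phase of [z / w] carries one to the other. *)
Definition chart1 (x : quat R) : charts R :=
  (false, ((qnorm2 (cpart2 x))^-1 *: (cpart1 x * qconj (cpart2 x)),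
    S3_dir (qdir (cpart2 x) ^ d * quat_j R))).

Definition chart2 (x : quat R) : charts R :=
  (true, ((qnorm2 (cpart1 x))^-1 *: (cpart1 x * qconj (cpart2 x)),
    S3_dir (qdir (cpart1 x) ^ d * quat_j R))).

Lemma polar_ratio t r a s b :
  t *: (cpart1 (polar r a s b) * qconj (cpart2 (polar r a s b))) =
  (t * (r * s)) *: cis (a - b).
Proof.
rewrite cpart1_polar cpart2_polar; apply/quatP.
by rewrite /= cosB sinB; split; ring.
Qed.

Lemma chart1_polar r a s b : 0 < s -> chart1 (polar r a s b) =
  (false, ((r / s) *: cis (a - b), S3_cis_j (d%:~R * b))).
Proof.
move=> s0; rewrite /chart1 polar_ratio cpart2_polar qnorm2_Zcis.
rewrite qdir_Zcis // cisXz S3_dir_cis_j; congr (_, (_ *: _, _)).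
by field; rewrite gt_eqF.
Qed.

Lemma chart2_polar r a s b : 0 < r -> chart2 (polar r a s b) =
  (true, ((s / r) *: cis (a - b), S3_cis_j (d%:~R * a))).
Proof.
move=> r0; rewrite /chart2 polar_ratio cpart1_polar qnorm2_Zcis.
rewrite qdir_Zcis // cisXz S3_dir_cis_j; congr (_, (_ *: _, _)).
by field; rewrite gt_eqF.
Qed.

Lemma charts_agree r a s b : 0 < r -> 0 < s ->
  MP (chart1 (polar r a s b)) = MP (chart2 (polar r a s b)).
Proof.
move=> r0 s0; rewrite chart1_polar // chart2_polar //.
have rs0 : 0 < r / s by rewrite divr_gt0.
apply: milnor_glue; split=> /=.
- by rewrite Zcis_eq0 gt_eqF.
- rewrite qnorm_sqr qnorm2_Zcis scalerA; congr (_ *: _).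
  by field; rewrite !gt_eqF.
- by rewrite -/(qdir _) qdir_Zcis // cis_glue //; congr (cis _ * _); ring.
Qed.

Definition fixed_param (x : S3 R) : M7 R d :=
  if cpart2 (val x) != 0 then MP (chart1 (val x)) else MP (chart2 (val x)).

Lemma fixed_param1 x r a s b : val x = polar r a s b -> 0 < s ->
  fixed_param x = MP (false, ((r / s) *: cis (a - b), S3_cis_j (d%:~R * b))).
Proof.
move=> xE s0; rewrite /fixed_param xE cpart2_polar Zcis_eq0 gt_eqF //=.
by rewrite chart1_polar.
Qed.

Lemma fixed_param2 x r a s b : val x = polar r a s b -> 0 < r -> 0 <= s ->
  fixed_param x = MP (true, ((s / r) *: cis (a - b), S3_cis_j (d%:~R * a))).
Proof.
move=> xE r0 s0; rewrite /fixed_param xE cpart2_polar Zcis_eq0 -chart2_polar //.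
have [_|sn0] := eqVneq s 0; first by [].
by rewrite /=; apply: charts_agree; rewrite // lt0r sn0.
Qed.

Lemma eq0_or_gt0 s : 0 <= s -> s = 0 \/ 0 < s.
Proof. by rewrite le_eqVlt => /orP[/eqP <-|]; [left|right]. Qed.

Lemma polar_radius1 r s : 0 <= r -> r ^+ 2 + s ^+ 2 = 1 -> s = 0 -> r = 1.
Proof.
move=> r0 rs s0; move: rs; rewrite s0 expr0n addr0 => /eqP.
by rewrite sqrf_eq1 => /orP[/eqP//|/eqP rE]; move: r0; rewrite rE; lra.
Qed.

Lemma fixed_paramP x : F (fixed_param x).
Proof.
have [r [a [s [b [r0 s0 rs xE]]]]] := S3_polar x.
have [sz|sp] := eq0_or_gt0 s0.
  have r1 := polar_radius1 r0 rs sz.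
  rewrite (fixed_param2 xE) ?r1 //; apply/fixed_chart.
  by exists (s / 1), (a - b), (d%:~R * a); rewrite divr1.
rewrite (fixed_param1 xE) //; apply/fixed_chart.
by exists (r / s), (a - b), (d%:~R * b); rewrite divr_ge0.
Qed.

Lemma pi_M7_continuous : continuous MP.
Proof. exact: pi_continuous. Qed.

Lemma chart_continuous_at (X : topologicalType) (f g : X -> quat R) c x :
  continuous f -> continuous g -> f x != 0 ->
  {for x, continuous (fun z => MP (c, ((qnorm2 (f z))^-1 *: g z,
     S3_dir (qdir (f z) ^ d * quat_j R))))}.
Proof.
move=> cf cg fx0.
have dx0 : qdir (f x) != 0 by rewrite -quat_unitE qdir_unit.
apply: (@continuous_comp _ _ _ (fun z => (c, ((qnorm2 (f z))^-1 *: g z,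
     S3_dir (qdir (f z) ^ d * quat_j R)))) MP); last exact: pi_M7_continuous.
apply: continuous_at_pair; first exact: cst_continuous.
apply: continuous_at_pair.
  apply: cvg_qZ; last exact: cg.
  by apply: cvgV; [rewrite qnorm2_eq0|exact: continuous_qnorm2].
apply: continuous_at_S3_dir.
  rewrite -qnorm2_eq0 qnorm2M qnorm2_expz ?qnorm2_qdir // mul1r qnorm2_eq0.
  by apply/eqP => /quatP[_ _ /eqP]; rewrite oner_eq0.
apply: cvg_qM; last exact: cvg_cst.
by apply: cvg_qXz => //; apply: cvg_qdir => //; exact: cf.
Qed.

Lemma fixed_param_continuous : continuous fixed_param.
Proof.
have c1 := comp_continuous (@S3_val_continuous R) (@cpart1_continuous R).
have c2 := comp_continuous (@S3_val_continuous R) (@cpart2_continuous R).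
have c12 : continuous (fun x : S3 R => cpart1 (val x) * qconj (cpart2 (val x))).
  by apply: continuous_qM => //; exact: continuous_qconj.
move=> x; have [x2|x2] := eqVneq (cpart2 (val x)) 0; last first.
  apply: (@continuous_at_near_eq (S3 R) (M7 R d) fixed_param
    (fun y => MP (chart1 (val y)))).
    have near2 : nbhs x [set y : S3 R | cpart2 (val y) != 0].
      exact: (c2 x _ (nbhs_neq0 x2)).
    by apply: filterS near2 => y /= y2; rewrite /fixed_param y2.
  exact: chart_continuous_at.
have x1 : cpart1 (val x) != 0.
  apply/eqP => x1; have := S3P x; move/quatP: x1 => [/= a0 b0 _ _].
  move/quatP: x2 => [/= c0 d0 _ _]; rewrite /qnorm2 a0 b0 c0 d0 expr0n /= !addr0.
  by move/eqP; rewrite eq_sym oner_eq0.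
apply: (@continuous_at_near_eq (S3 R) (M7 R d) fixed_param
    (fun y => MP (chart2 (val y)))).
  have near1 : nbhs x [set y : S3 R | cpart1 (val y) != 0].
    exact: (c1 x _ (nbhs_neq0 x1)).
  apply: filterS near1 => y y1.
  have [r [a [s [b [r0 s0 rs yE]]]]] := S3_polar y.
  have rp : 0 < r.
    by rewrite lt0r r0 andbT; move: y1; rewrite /= yE cpart1_polar Zcis_eq0.
  by rewrite (fixed_param2 yE) // yE chart2_polar.
exact: chart_continuous_at.
Qed.

(** Rotating [z] and [w] by the same [d]-th root of unity changes neither their
    ratio nor their [d]-th powers. *)
Lemma fixed_param_zeta m x : fixed_param (zeta_act `|d|%N m x) = fixed_param x.
Proof.
have [r [a [s [b [r0 s0 rs xE]]]]] := S3_polar x.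
set w := lens_angle R `|d|%N m.
have yE : val (zeta_act `|d|%N m x) = polar r (w + a) s (w + b).
  by rewrite /= /zeta -/w xE cis_polar.
have wd t : S3_cis_j (d%:~R * (w + t)) = S3_cis_j (d%:~R * t) :> S3 R.
  apply: val_inj; congr (_ * _); rewrite mulrDr cisD.
  suff -> : cis (d%:~R * w) = 1 by rewrite mul1r.
  have [n nE] : exists n : int, d%:~R * w = n%:~R * (2 * pi).
    exists (sgz d * m); rewrite d_sgz_abs /w /lens_angle intrM.
    by field; exact: pnat_neq0 absd_gt0.
  by rewrite nE -cisXz cis2pi exp1rz.
have [sz|sp] := eq0_or_gt0 s0.
  have r1 : 0 < r by rewrite (polar_radius1 r0 rs sz).
  rewrite (fixed_param2 yE) // (fixed_param2 xE) // wd.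
  by rewrite (_ : w + a - (w + b) = a - b) //; ring.
rewrite (fixed_param1 yE) // (fixed_param1 xE) // wd.
by rewrite (_ : w + a - (w + b) = a - b) //; ring.
Qed.

(** The quotient of two [d]-th roots of the same number is a [|d|]-th root of
    unity. *)
Lemma angle_of_power a b : S3_cis_j (d%:~R * a) = S3_cis_j (d%:~R * b) :> S3 R ->
  exists m, b - a = lens_angle R `|d|%N m.
Proof.
move=> /cis_j_inj /cis_eq[n]; rewrite -mulrBr => E.
have p0 := pnat_neq0 R absd_gt0.
exists (sgz d * n); rewrite /lens_angle; apply: (mulfI p0).
transitivity ((sgz d)%:~R * (d%:~R * (b - a))).
  by rewrite d_sgz_abs !mulrA -intrM sgz_d_sqr mul1r.
by rewrite E intrM; field.
Qed.

Lemma same_ratio r s r' s' : 0 <= r -> 0 < s -> 0 <= r' -> 0 < s' ->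
  r ^+ 2 + s ^+ 2 = 1 -> r' ^+ 2 + s' ^+ 2 = 1 -> r / s = r' / s' ->
  r = r' /\ s = s'.
Proof.
move=> r0 s0 r'0 s'0 rs rs' E.
have X : r = (r' / s') * s by rewrite -E divfK // gt_eqF.
have Y : r' = (r' / s') * s' by rewrite divfK // gt_eqF.
move: (r' / s') X Y rs rs' => q -> ->; rewrite !exprMn => rs rs'.
suff -> : s = s' by [].
apply/eqP; rewrite -(@eqrXn2 _ 2) ?ltW //; apply/eqP.
have q0 : 1 + q ^+ 2 != 0 by rewrite gt_eqF // ltr_wpDr // sqr_ge0.
by apply: (mulfI q0); rewrite !mulrDl !mul1r; lra.
Qed.

Lemma Zcis_inj r r' a a' : 0 <= r -> 0 <= r' -> r *: cis a = r' *: cis a' -> r = r'.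
Proof.
move=> r0 r'0 /(congr1 (@qnorm2 R)); rewrite !qnorm2_Zcis => E.
by apply/eqP; rewrite -(@eqrXn2 _ 2) // E.
Qed.

(** The ratio of the two complex coordinates determines their moduli and the
    difference of their phases; the [d]-th power leaves one common phase
    undetermined up to a root of unity. *)
Lemma fixed_param_fibre x x' : fixed_param x = fixed_param x' ->
  exists m, x' = zeta_act `|d|%N m x.
Proof.
have [r [a [s [b [r0 s0 rs xE]]]]] := S3_polar x.
have [r' [a' [s' [b' [r'0 s'0 rs' xE']]]]] := S3_polar x'.
have [sz|sp] := eq0_or_gt0 s0; have [sz'|sp'] := eq0_or_gt0 s'0.
- have r1 := polar_radius1 r0 rs sz; have r1' := polar_radius1 r'0 rs' sz'.
  rewrite (fixed_param2 xE) ?r1 // (fixed_param2 xE') ?r1' //.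
  move=> /milnor_piP_same/pair_equal_spec[_ /angle_of_power[m mE]]; exists m.
  apply: val_inj; rewrite xE' /= xE cis_polar sz sz' r1 r1' /polar !scale0r.
  by congr (_ *: cis _ + _); rewrite -mE; ring.
- have r1 := polar_radius1 r0 rs sz.
  rewrite (fixed_param2 xE) ?r1 // (fixed_param1 xE') // sz mul0r scale0r.
  move=> /milnor_piP/asboolP[/= u0 E _]; move/esym/eqP: E.
  by rewrite scaler_eq0 (negPf u0) orbF invr_eq0 qnorm_sqr qnorm2_eq0 (negPf u0).
- have r1' := polar_radius1 r'0 rs' sz'.
  rewrite (fixed_param1 xE) // (fixed_param2 xE') ?r1' // sz' mul0r scale0r.
  move=> /milnor_piP/asboolP[/= u0 E _]; move/esym/eqP: E.
  by rewrite scaler_eq0 (negPf u0) orbF invr_eq0 qnorm_sqr qnorm2_eq0 (negPf u0).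
rewrite (fixed_param1 xE) // (fixed_param1 xE') //.
move=> /milnor_piP_same/pair_equal_spec[uE /angle_of_power[m mE]]; exists m.
have q0 : 0 <= r / s by rewrite divr_ge0.
have q0' : 0 <= r' / s' by rewrite divr_ge0.
have [rr ss] := same_ratio r0 sp r'0 sp' rs rs' (Zcis_inj q0 q0' uE).
apply: val_inj; rewrite xE' /= xE cis_polar -rr -ss -/(zeta _ _ _) -mE.
rewrite /polar; congr (_ + _ *: (cis _ * _)); last by ring.
move: uE; rewrite -rr -ss => uE.
have {}uE : r *: cis (a - b) = r *: cis (a' - b').
  apply: (scalerI (invr_neq0 (lt0r_neq0 sp))).
  by rewrite !scalerA [_^-1 * _]mulrC.
transitivity (cis b' * (r *: cis (a' - b'))).
  by rewrite -scalerAr -cisD; congr (_ *: cis _); ring.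
by rewrite -uE -scalerAr -cisD; congr (_ *: cis _); ring.
Qed.

(** A [d]-th root of the fibre coordinate gives the phase of one complex
    coordinate, and the base coordinate gives the other. *)
Lemma fixed_param_surj y : F y -> exists x, fixed_param x = y.
Proof.
rewrite -[y]reprK; case: (repr y) => c [u v] /fixed_chart[t [w [e [t0 -> ->]]]].
pose n := Num.sqrt (1 + t ^+ 2).
have n2 : n ^+ 2 = 1 + t ^+ 2 by rewrite sqr_sqrtr // addr_ge0 // sqr_ge0.
have n0 : 0 < n by rewrite sqrtr_gt0 ltr_wpDr // sqr_ge0.
have dn0 := d_neq0.
have unit a b : qnorm2 (polar (t / n) a n^-1 b) = 1 /\
    qnorm2 (polar n^-1 a (t / n) b) = 1.
  have E : n^-1 ^+ 2 + (t / n) ^+ 2 = 1.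
    rewrite exprMn exprVn n2 -[X in X + _]mul1r -mulrDl divff //.
    by rewrite gt_eqF // ltr_wpDr // sqr_ge0.
  by rewrite !qnorm2_polar [X in X = _ /\ _]addrC.
have tn0 : 0 <= t / n by rewrite divr_ge0 // ltW.
have in0 : 0 < n^-1 by rewrite invr_gt0.
case: c.
  pose a := e / d%:~R; pose x := mkS3 (unit a (a - w)).2; exists x.
  rewrite (@fixed_param2 x n^-1 a (t / n) (a - w)) //.
  congr (MP (_, (_ *: cis _, S3_cis_j _))); first by field; rewrite gt_eqF.
    by ring.
  by rewrite /a; field.
pose b := e / d%:~R; pose x := mkS3 (unit (b + w) b).1; exists x.
rewrite (@fixed_param1 x (t / n) (b + w) n^-1 b) //.
congr (MP (_, (_ *: cis _, S3_cis_j _))); first by field; rewrite gt_eqF.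
  by ring.
by rewrite /b; field.
Qed.

Lemma fixed_milnor_hausdorff : hausdorff_space (set_type F).
Proof.
apply: (@hausdorff_injective _ _ (set_val : set_type F -> M7 R d)).
- by move=> x y; exact: val_inj.
- exact: initial_continuous.
- exact: milnor_hausdorff.
Qed.

Lemma fixed_milnor_lens :
  homeomorphic (lens_space R `|d|%N 1) (set_type F).
Proof.
pose f (x : S3 R) : set_type F := 
  exist (fun z => z \in F) (fixed_param x) (mem_set (fixed_paramP x)).
apply: (@lens_of_fibres R _ _ f); first exact: fixed_milnor_hausdorff.
- by apply: continuous_set_type; exact: fixed_param_continuous.
- move=> y; have [x xy] := fixed_param_surj (set_valP y).
  by exists x; apply: val_inj.
- move=> x x'; split=> [/(congr1 set_val)|[m ->]]; first exact: fixed_param_fibre.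
  by apply: val_inj; rewrite /= fixed_param_zeta.
Qed.

End FixedMilnor.

(** * Quaternionic conjugation exchanges [d] and [-d] *)

Section Conjugation.
Variable R : realType.

Definition chart_conj (c : charts R) : charts R :=
  (c.1, (qconj c.2.1, S3_inv c.2.2)).

Lemma qnorm_conj (x : quat R) : qnorm (qconj x) = qnorm x.
Proof. by rewrite /qnorm qnorm2_conj. Qed.

Lemma qconjZ (a : R) (x : quat R) : qconj (a *: x) = a *: qconj x.
Proof. by apply/quatP; split=> //=; rewrite mulrN. Qed.

Lemma qconj_expz (x : quat R) (n : int) : x != 0 -> qconj (x ^ n) = qconj x ^ n.
Proof.
have X y (m : nat) : qconj (y ^+ m) = qconj y ^+ m.
  elim: m => [|m IHm]; first by rewrite !expr0 qconj1.
  by rewrite exprS qconjM IHm exprSr.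
case: n => n x0; first exact: X.
have cx0 : qconj x \is a GRing.unit.
  by rewrite quat_unitE -qnorm2_eq0 qnorm2_conj qnorm2_eq0.
have V : qconj x^-1 = (qconj x)^-1.
  by apply: (mulrI cx0); rewrite -qconjM mulVr // qconj1 divrr.
by rewrite NegzE -!exprnN -!exprVn X V.
Qed.

(** Conjugation reverses products, hence exchanges the exponents [k] and [l] of
    the gluing map. *)
Lemma chart_conj_rel k l x y :
  milnor_rel k l x y -> milnor_rel l k (chart_conj x) (chart_conj y).
Proof.
have G (z t : quat R * S3 R) : glued k l z t ->
    glued l k (qconj z.1, S3_inv z.2) (qconj t.1, S3_inv t.2).
  move=> [z0 t1 t2]; have n0 : (qnorm z.1)^-1 *: z.1 != 0.
    by rewrite -/(qdir _) -quat_unitE qdir_unit.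
  split=> /=.
  - by rewrite -qnorm2_eq0 qnorm2_conj qnorm2_eq0.
  - by rewrite t1 qconjZ qnorm_conj.
  - by rewrite t2 !qconjM !qconj_expz // qconjZ qnorm_conj mulrA.
case: x y => [a x] [b y] /asboolP; case: a b => -[] /= xy; apply/asboolP => /=;
  by [rewrite xy | exact: G].
Qed.

Definition milnor_conj k l (x : milnor R k l) : milnor R l k :=
  \pi_(milnor R l k) (chart_conj (repr x)).

Lemma milnor_conjE k l c : milnor_conj (\pi_(milnor R k l) c) =
  \pi_(milnor R l k) (chart_conj c).
Proof.
by apply/milnor_piP/chart_conj_rel/milnor_piP; rewrite reprK.
Qed.

Lemma milnor_conjK k l : cancel (@milnor_conj k l) (@milnor_conj l k).
Proof.
have chartK c : chart_conj (chart_conj c) = c.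
  case: c => a [u v]; congr (_, (_, _)); first exact: qconjK.
  by apply: val_inj; exact: qconjK.
by move=> x; rewrite {2}/milnor_conj milnor_conjE chartK reprK.
Qed.

Lemma milnor_conj_continuous k l : continuous (@milnor_conj k l).
Proof.
apply/quotient_continuous.
rewrite (_ : _ \o _ = fun c => \pi_(milnor R l k) (chart_conj c)).
  apply: (comp_continuous _ (@pi_continuous _ _)).
  apply: pair_continuous; first exact: fst_continuous.
  have c2 := @snd_continuous bool (quat R * S3 R)%type.
  apply: pair_continuous.
    apply: continuous_qconj.
    exact: (comp_continuous c2 (@fst_continuous _ _)).
  apply: S3_inv_continuous.
  exact: (comp_continuous c2 (@snd_continuous _ _)).
by apply/funext => c; exact: milnor_conjE.
Qed.

Lemma qJ_conj (q : S3 R) x : qconj (qJ q x) = qJ q (qconj x).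
Proof. by rewrite /qJ !qconjM qconjK mulrA. Qed.

Lemma milnor_conj_act k l g (x : milnor R k l) :
  milnor_conj (milnor_act g x) = milnor_act g (milnor_conj x).
Proof.
have E e q c : chart_conj (chart_act e q c) = chart_act e q (chart_conj c).
  case: c => a [u v]; congr (_, (_, _)); first exact: qJ_conj.
  apply: val_inj; rewrite /= qconjM [RHS]qsgnC; congr (_ * _).
    exact: qJ_conj.
  by case: e; rewrite /qsgn ?qconjN qconj1.
rewrite -[x]reprK; move: (repr x) => c; case: g => e q; rewrite -[q]reprK.
by rewrite milnor_actE !milnor_conjE milnor_actE E.
Qed.

Lemma milnor_conj_equivariant d :
  equivariantly_homeomorphic (@M7_act R d) (@M7_act R (- d)).
Proof.
have swap k l k' l' : k' = l -> l' = k ->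
    equivariantly_homeomorphic (@milnor_act R k l) (@milnor_act R k' l').
  move=> -> ->; exists (@milnor_conj _ _), (@milnor_conj _ _); split.
    by split; [exact: milnor_conj_continuous|exact: milnor_conj_continuous
      |exact: milnor_conjK|exact: milnor_conjK].
  by move=> g x; exact: milnor_conj_act.
by apply: swap => //; rewrite /milnor_l opprK.
Qed.

End Conjugation.

(** * The fixed point set in a generalized Gromoll-Meyer sphere *)

Lemma fixed_points_homeomorphic (G : Type) (X Y : topologicalType)
    (aX : G -> X -> X) (aY : G -> Y -> Y) a :
  equivariantly_homeomorphic aX aY ->
  homeomorphic (set_type (fixed_points aX a)) (set_type (fixed_points aY a)).
Proof.
move=> [f [g [[cf cg fK gK] fa]]].
have Ff x : fixed_points aX a x -> fixed_points aY a (f x).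
  by rewrite /fixed_points /= => E; rewrite -fa E.
have Fg y : fixed_points aY a y -> fixed_points aX a (g y).
  rewrite /fixed_points /= => E; apply: (can_inj fK).
  by rewrite fa gK.
pose F (x : set_type (fixed_points aX a)) : set_type (fixed_points aY a) :=
  exist (fun z => z \in fixed_points aY a) _ (mem_set (Ff _ (set_valP x))).
pose H (y : set_type (fixed_points aY a)) : set_type (fixed_points aX a) :=
  exist (fun z => z \in fixed_points aX a) _ (mem_set (Fg _ (set_valP y))).
exists F, H; split.
- apply: continuous_set_type.
  exact: (comp_continuous (@initial_continuous _ _ set_val) cf).
- apply: continuous_set_type.
  exact: (comp_continuous (@initial_continuous _ _ set_val) cg).
- by move=> x; apply: val_inj; exact: fK.
- by move=> y; apply: val_inj; exact: gK.
Qed.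

Section FixedGromollMeyer.
Variables (R : realType) (n : int).
Local Notation GP := (\pi_(gromoll_meyer R n) : set_type (@E10 R n) -> gromoll_meyer R n).
Local Notation F := (fixed_points (@gromoll_meyer_act R n) (neg_i R)).
Local Notation J := (quat_j R).
Implicit Types (r s t a b : R) (x : S3 R).

Lemma gromoll_meyer_piP (x y : set_type (@E10 R n)) :
  GP x = GP y <-> exists q, val y = star q (val x).
Proof. by split=> [/eqmodP/asboolP|xy]; last exact/eqmodP/asboolP. Qed.

Lemma cis_mulpi (m : int) : exists2 e : R, e ^+ 2 = 1 &
  cos (m%:~R * pi) = e /\ sin (m%:~R * pi) = 0 :> R.
Proof.
exists (cos (m%:~R * pi : R)); last split=> //.
  have : cis (m%:~R * pi + m%:~R * pi) = 1 :> quat R.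
    by rewrite -mulrDr -mulr2n -mulr_natl -cisXz cis2pi exp1rz.
  rewrite cisD => /quatP[/= E _ _ _].
  by have := cos2Dsin2 (m%:~R * pi : R); lra.
have : cis (m%:~R * pi + m%:~R * pi) = 1 :> quat R.
  by rewrite -mulrDr -mulr2n -mulr_natl -cisXz cis2pi exp1rz.
rewrite cisD => /quatP[/= E _ _ _].
have H := cos2Dsin2 (m%:~R * pi : R).
by apply/eqP; rewrite -sqrf_eq0; apply/eqP; lra.
Qed.

(** The elements with purely imaginary first coordinate lie at distance
    [pi / 2] from the pole, so that [rho n] rotates them by [n] right angles. *)
Lemma rho_equator (p w : quat R) : qre p = 0 -> qnorm2 p + qnorm2 w = 1 ->
  rho n (p, w) = S7_polar (n%:~R * (pi / 2)) p w.
Proof.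
move=> p0 pw; rewrite -rhoE //; congr (rho n _).
rewrite /S7_polar cos_pihalf sin_pihalf !scale1r; congr (_, _).
by apply/quatP; split=> /=; ring.
Qed.

Lemma rho_equator_odd : ~~ (2 %| n)%Z -> exists2 e : R, e ^+ 2 = 1 &
  forall p w, qre p = 0 -> qnorm2 p + qnorm2 w = 1 ->
    rho n (p, w) = (e *: p, e *: w).
Proof.
move=> n_odd; have [m nE] : exists m : int, n = 2 * m + 1.
  by exists (n %/ 2)%Z; lia.
have [e e1 [ce se]] := cis_mulpi m; exists e => // p w p0 pw.
have E : n%:~R * (pi / 2) = m%:~R * pi + pi / 2 :> R.
  by rewrite nE intrD intrM; field.
rewrite rho_equator // E /S7_polar cosDpihalf sinDpihalf ce se.
by congr (_, _); apply/quatP; split=> /=; ring.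
Qed.

Lemma rho_equator_even : (2 %| n)%Z -> exists2 e : R, e ^+ 2 = 1 &
  forall p w, qre p = 0 -> qnorm2 p + qnorm2 w = 1 -> rho n (p, w) = (e%:A, 0).
Proof.
move=> n_even; have [m nE] : exists m : int, n = 2 * m.
  by exists (n %/ 2)%Z; lia.
have [e e1 [ce se]] := cis_mulpi m; exists e => // p w p0 pw.
have E : n%:~R * (pi / 2) = m%:~R * pi :> R by rewrite nE intrM; field.
rewrite rho_equator // E /S7_polar ce se.
by congr (_, _); apply/quatP; split=> /=; ring.
Qed.

Definition equator_point x : quat R * quat R :=
  (cpart1 (val x) * J, cpart2 (val x) * J).

Lemma equator_point_unit x : qre (equator_point x).1 = 0 /\
  qnorm2 (equator_point x).1 + qnorm2 (equator_point x).2 = 1.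
Proof.
by split; [rewrite /=; ring|rewrite -(S3P x) /qnorm2 /=; ring].
Qed.

(** In both frames [u = (z j, w j)].  For odd [n], [rho n u] is [u] up to sign,
    and the complex unit vectors orthogonal to it are the multiples of
    [(- conj w, conj z)] by a phase; for even [n], [rho n u] is [(1, 0)] up to
    sign, and they are the multiples of [(0, 1)]. *)
Definition odd_frame x := (equator_point x,
  (- qconj (cpart2 (val x)), qconj (cpart1 (val x)))).

Definition even_frame x : (quat R * quat R) * (quat R * quat R) :=
  (equator_point x, (0, 1)).

Lemma odd_frameP x : ~~ (2 %| n)%Z -> E10 n (odd_frame x).
Proof.
move=> /rho_equator_odd[e e1 rhoE']; have [u0 u1] := equator_point_unit x.
split=> //.
  by rewrite /sphere7 /= -(S3P x) /qnorm2 /=; ring.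
rewrite [(odd_frame x).1]surjective_pairing rhoE' //.
by apply/quatP; split=> /=; ring.
Qed.

Lemma even_frameP x : (2 %| n)%Z -> E10 n (even_frame x).
Proof.
move=> /rho_equator_even[e e1 rhoE']; have [u0 u1] := equator_point_unit x.
split=> //.
  by rewrite /sphere7 /qnorm2 /=; ring.
rewrite [(even_frame x).1]surjective_pairing rhoE' //.
by apply/quatP; split=> /=; ring.
Qed.

Lemma equator_point_polar x r a s b : val x = polar r a s b ->
  equator_point x = (r *: (cis a * J), s *: (cis b * J)).
Proof.
by move=> xE; rewrite /equator_point xE cpart1_polar cpart2_polar !scalerAl.
Qed.

Lemma qJ_cis_j t r a : qJ (mkS3 (qnorm2_cis t)) (r *: (cis a * J)) =
  r *: (cis (2 * t + a) * J).
Proof.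
rewrite qJZ; congr (_ *: _).
change (cis t * (cis a * J) * qconj (cis t) = cis (2 * t + a) * J).
rewrite qconj_cis -!mulrA cis_jC opprK !mulrA -!cisD; congr (cis _ * _); ring.
Qed.

Definition quat_i : quat R := val (S3_i R).

Lemma commute_i (v : quat R) : quat_i * v = v * quat_i -> qj v = 0 /\ qk v = 0.
Proof. by move=> /quatP[/= _ _ h3 h4]; split; lra. Qed.

Lemma anticommute_i (u : quat R) : quat_i * u = - (u * quat_i) ->
  exists r a, 0 <= r /\ u = r *: (cis a * J).
Proof.
move=> /quatP[/= h1 h2 _ _].
have [r [a [r0 E]]] := @complex_polar R (cpart2 u) erefl erefl.
exists r, a; split=> //; rewrite scalerAl -E.
by apply/quatP; split=> /=; lra.
Qed.

(** The relation [q v = v i] says that conjugation by [v] takes [i] to [q]. *)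
Lemma conjugate_to_i (q : S3 R) (v : quat R) : v != 0 ->
  - v * qconj quat_i = val q * v -> exists g : S3 R, quat_i * val g = val g * val q.
Proof.
move=> v0 qv; exists (S3_inv (S3_dir v)).
have vu : v \is a GRing.unit by rewrite quat_unitE.
rewrite /= S3_dirE // /qdir qconjZ -scalerAr -scalerAl; congr (_ *: _).
apply: (mulIr vu); rewrite -!mulrA -qv mulCq.
rewrite [RHS]mulrA mulrN mulCq; apply/quatP; split=> /=; ring.
Qed.

Lemma conj_anticommute (q g : S3 R) (u : quat R) :
  quat_i * val g = val g * val q -> - u = qJ q u -> quat_i * qJ g u = - (qJ g u * quat_i).
Proof.
move=> gq uq; have qu : val q * u = - (u * val q).
  by rewrite -mulNr uq /qJ -!mulrA S3_Cmul mulr1.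
have qg : val q * qconj (val g) = qconj (val g) * quat_i.
  rewrite -[LHS]mul1r -(S3_Cmul g) -!mulrA (mulrA (val g)) -gq.
  by rewrite -!mulrA S3_mulC mulr1.
rewrite /qJ !mulrA gq -(mulrA (val g)) qu mulrN mulNr; congr (- _).
by rewrite -!mulrA qg.
Qed.

Lemma conj_commute (q g : S3 R) (v : quat R) :
  quat_i * val g = val g * val q -> - v * qconj quat_i = val q * v ->
  quat_i * (val g * v) = val g * v * quat_i.
Proof.
move=> gq vq; rewrite mulrA gq -mulrA -vq -[RHS]mulrA; congr (_ * _).
by apply/quatP; split=> /=; ring.
Qed.

(** A fixed point has a representative [(u, v)] for which the quaternion
    witnessing the invariance is [i] itself. *)
Lemma fixed_normal_form (y : set_type (@E10 R n)) : F (GP y) -> exists2 y' : set_type (@E10 R n),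
  GP y' = GP y & exists r a s b c d e f, [/\ 0 <= r, 0 <= s,
    r ^+ 2 + s ^+ 2 = 1, c ^+ 2 + d ^+ 2 + e ^+ 2 + f ^+ 2 = 1 & val y' =
    ((r *: (cis a * J), s *: (cis b * J)), (Quat c d 0 0, Quat e f 0 0))].
Proof.
rewrite /fixed_points /= /neg_i gromoll_meyer_actE => /esym/gromoll_meyer_piP[q qE].
have qE' : bullet true (S3_i R) (val y) = star q (val y) := qE.
have yE := set_valP y.
move: qE'; rewrite [val y]surjective_pairing [(val y).1]surjective_pairing.
rewrite [(val y).2]surjective_pairing.
set u1 := (val y).1.1; set u2 := (val y).1.2.
set v1 := (val y).2.1; set v2 := (val y).2.2.
rewrite /bullet /star /qsgn !mulN1r.
move=> /pair_equal_spec[/pair_equal_spec[qu1 qu2] /pair_equal_spec[qv1 qv2]].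
have [g gq] : exists g : S3 R, quat_i * val g = val g * val q.
  have [v10|v10] := eqVneq v1 0; last exact: conjugate_to_i qv1.
  have [v20|v20] := eqVneq v2 0; last exact: conjugate_to_i qv2.
  have [_ + _] := yE; rewrite /sphere7 /= -/v1 -/v2 v10 v20 /qnorm2 /=.
  by rewrite expr0n /= !addr0 => /eqP; rewrite eq_sym oner_eq0.
have gE := E10_star g yE.
exists (exist (fun z => z \in @E10 R n) _ (mem_set gE)).
  by apply/esym/gromoll_meyer_piP; exists g.
have [su sv _] := gE.
have [r [a [r0 rE]]] := anticommute_i (conj_anticommute gq qu1).
have [s [b [s0 sE]]] := anticommute_i (conj_anticommute gq qu2).
have [c3 c4] := commute_i (conj_commute gq qv1).
have [e3 e4] := commute_i (conj_commute gq qv2).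
have su' : qnorm2 (qJ g u1) + qnorm2 (qJ g u2) = 1 := su.
have sv' : qnorm2 (val g * v1) + qnorm2 (val g * v2) = 1 := sv.
exists r, a, s, b, (qre (val g * v1)), (qi (val g * v1)),
  (qre (val g * v2)), (qi (val g * v2)); split=> //.
- by rewrite -su' rE sE !qnorm2Z !(S3P (S3_cis_j _)) !mulr1.
- rewrite -sv' /qnorm2 c3 c4 e3 e4; ring.
change (star g (val y) = ((r *: (cis a * J), s *: (cis b * J)),
  (Quat (qre (val g * v1)) (qi (val g * v1)) 0 0,
   Quat (qre (val g * v2)) (qi (val g * v2)) 0 0))).
rewrite /star -rE -sE; congr (_, _, (_, _)).
- by apply/quatP; split.
- by apply/quatP; split.
Qed.

Definition odd_param (n_odd : ~~ (2 %| n)%Z) x : gromoll_meyer R n :=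
  GP (exist (fun z => z \in @E10 R n) _ (mem_set (odd_frameP x n_odd))).

Definition even_param (n_even : (2 %| n)%Z) x : gromoll_meyer R n :=
  GP (exist (fun z => z \in @E10 R n) _ (mem_set (even_frameP x n_even))).

Lemma odd_param_fixed n_odd x : F (odd_param n_odd x).
Proof.
rewrite /fixed_points /= /neg_i gromoll_meyer_actE.
apply/esym/gromoll_meyer_piP; exists (S3_i R).
change (bullet true (S3_i R) (odd_frame x) = star (S3_i R) (odd_frame x)).
rewrite /bullet /star /qsgn !mulN1r; congr (_, _, (_, _));
  by apply/quatP; split=> /=; ring.
Qed.

Lemma even_param_fixed n_even x : F (even_param n_even x).
Proof.
rewrite /fixed_points /= /neg_i gromoll_meyer_actE.
apply/esym/gromoll_meyer_piP; exists (S3_i R).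
change (bullet true (S3_i R) (even_frame x) = star (S3_i R) (even_frame x)).
rewrite /bullet /star /qsgn !mulN1r; congr (_, _, (_, _));
  by apply/quatP; split=> /=; ring.
Qed.

Lemma equator_point_continuous : continuous equator_point.
Proof.
apply: pair_continuous; apply: continuous_qM; try exact: cst_continuous.
- exact: (comp_continuous (@S3_val_continuous R) (@cpart1_continuous R)).
- exact: (comp_continuous (@S3_val_continuous R) (@cpart2_continuous R)).
Qed.

Lemma odd_param_continuous n_odd : continuous (odd_param n_odd).
Proof.
apply: (comp_continuous _ (@pi_continuous _ _)); apply: continuous_set_type.
apply: pair_continuous; first exact: equator_point_continuous.
apply: pair_continuous; first apply: continuous_qN; apply: continuous_qconj.
- exact: (comp_continuous (@S3_val_continuous R) (@cpart2_continuous R)).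
- exact: (comp_continuous (@S3_val_continuous R) (@cpart1_continuous R)).
Qed.

Lemma even_param_continuous n_even : continuous (even_param n_even).
Proof.
apply: (comp_continuous _ (@pi_continuous _ _)); apply: continuous_set_type.
apply: pair_continuous; first exact: equator_point_continuous.
exact: cst_continuous.
Qed.

Lemma qconj_Zcis r a : qconj (r *: cis a) = r *: cis (- a).
Proof. by rewrite qconjZ qconj_cis. Qed.

Lemma odd_frame_polar x r a s b : val x = polar r a s b -> odd_frame x =
  ((r *: (cis a * J), s *: (cis b * J)), (- (s *: cis (- b)), r *: cis (- a))).
Proof.
move=> xE; rewrite /odd_frame (equator_point_polar xE) xE.
by rewrite cpart1_polar cpart2_polar !qconj_Zcis.
Qed.

Definition S3_cis t : S3 R := mkS3 (qnorm2_cis t).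

Lemma star_cis t r a s b (v1 v2 : quat R) :
  star (S3_cis t) ((r *: (cis a * J), s *: (cis b * J)), (v1, v2)) =
  ((r *: (cis (2 * t + a) * J), s *: (cis (2 * t + b) * J)),
   (cis t * v1, cis t * v2)).
Proof. by rewrite /star !qJ_cis_j. Qed.

Lemma cis_ratio (q : S3 R) r a r' a' : 0 < r -> 0 <= r' ->
  r' *: cis a' = val q * (r *: cis a) -> exists t, q = S3_cis t.
Proof.
move=> r0 r'0 E; have rr : r' = r.
  have := congr1 (@qnorm2 R) E; rewrite qnorm2M S3P mul1r !qnorm2_Zcis => E2.
  by apply/eqP; rewrite -(@eqrXn2 _ 2) ?(ltW r0) // E2.
move: E; rewrite rr -scalerAr => /(scalerI (lt0r_neq0 r0)) E.
exists (a' - a); apply: val_inj; rewrite /= cisD E cisN -mulrA divrr ?mulr1 //.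
exact: cis_unit.
Qed.

Lemma J_unit : J \is a GRing.unit.
Proof.
by rewrite quat_unitE; apply/eqP => /quatP[_ _ /eqP]; rewrite oner_eq0.
Qed.

(** The form of [v] forces the quaternion [q] between two representatives to be
    a unit complex number [e^(it)] and to rotate [z] and [w] by [e^(-it)].  On
    [u = (z j, w j)] it acts by [e^(2it)], so [e^(3it) = 1]. *)
Lemma odd_param_fibre n_odd x x' : odd_param n_odd x = odd_param n_odd x' <->
  exists m, x' = zeta_act 3 m x.
Proof.
have [r [a [s [b [r0 s0 rs xE]]]]] := S3_polar x.
have frE := odd_frame_polar xE.
split=> [/gromoll_meyer_piP[q qE]|[m x'E]]; last first.
  apply/gromoll_meyer_piP; set w := lens_angle R 3 m; exists (S3_cis (- w)).
  change (odd_frame x' = star (S3_cis (- w)) (odd_frame x)).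
  have x'E' : val x' = polar r (w + a) s (w + b).
    by rewrite x'E /= xE cis_polar.
  rewrite (odd_frame_polar x'E') frE star_cis.
  have w3 t : cis (2 * - w + t) = cis (w + t) :> quat R.
    rewrite (_ : w + t = m%:~R * (2 * pi) + (2 * - w + t)); last first.
      by rewrite /w /lens_angle; field.
    by rewrite [RHS]cisD -cisXz cis2pi exp1rz mul1r.
  by rewrite !w3 mulrN -!scalerAr -!cisD !opprD.
have [r' [a' [s' [b' [r'0 s'0 rs' xE']]]]] := S3_polar x'.
have {}qE : odd_frame x' = star q (odd_frame x) := qE.
have rs_pos : 0 < r \/ 0 < s.
  have [sz|] := eq0_or_gt0 s0; last by right.
  by left; rewrite (polar_radius1 r0 rs sz).
move: (qE); rewrite frE (odd_frame_polar xE') /star.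
move=> /pair_equal_spec[_ /pair_equal_spec[E1 E2]].
have [t qt] : exists t, q = S3_cis t.
  case: rs_pos => pos; first exact: cis_ratio pos r'0 E2.
  apply: (cis_ratio pos s'0 (a' := - b') (a := - b)).
  by apply: oppr_inj; rewrite E1 mulrN.
move: E1 E2; rewrite qt mulrN /= -!scalerAr -!cisD => /oppr_inj E1 E2.
have c1 : r' *: cis a' = r *: cis (a - t).
  have := congr1 (@qconj R) E2; rewrite !qconj_Zcis opprK => ->.
  by congr (_ *: cis _); ring.
have c2 : s' *: cis b' = s *: cis (b - t).
  have := congr1 (@qconj R) E1; rewrite !qconj_Zcis opprK => ->.
  by congr (_ *: cis _); ring.
move: qE; rewrite frE (odd_frame_polar xE') qt star_cis.
move=> /pair_equal_spec[/pair_equal_spec[F1 F2] _].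
have {F1 F2} t3 : exists k : int, 3 * t = k%:~R * (2 * pi).
  case: rs_pos => pos.
    move: F1; rewrite !scalerAl c1 => /(mulIr J_unit).
    move=> /(scalerI (lt0r_neq0 pos)) /cis_eq[k kE]; exists k.
    by rewrite -kE; ring.
  move: F2; rewrite !scalerAl c2 => /(mulIr J_unit).
  move=> /(scalerI (lt0r_neq0 pos)) /cis_eq[k kE]; exists k.
  by rewrite -kE; ring.
have [k kE] := t3; exists (- k); apply: val_inj.
rewrite /= xE' xE /zeta.
have -> : lens_angle R 3 (- k) = - t.
  by rewrite /lens_angle mulrNz mulNr; congr (- _);
    apply: (mulfI (x := 3)); rewrite ?pnatr_eq0 // kE; field.
rewrite cis_polar /polar !scalerAl c1 c2.
by congr (_ *: cis _ + _ *: cis _ * _); ring.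
Qed.

(** Orthogonality gives [v = la (- conj w, conj z)] with [la] of norm 1, and a
    cube root of [la] is used to make [la] equal to 1. *)
Lemma odd_param_surj n_odd (z : gromoll_meyer R n) : F z ->
  exists x, odd_param n_odd x = z.
Proof.
rewrite -[z]reprK => /fixed_normal_form[y <-].
move=> [r [a [s [b [c [d [e [f [r0 s0 rs vn yE]]]]]]]]].
set V1 := Quat c d 0 0 in yE; set V2 := Quat e f 0 0 in yE.
have unit_u : qre (r *: (cis a * J)) = 0 /\
    qnorm2 (r *: (cis a * J)) + qnorm2 (s *: (cis b * J)) = 1.
  split; first by rewrite /=; ring.
  by rewrite !qnorm2Z !(S3P (S3_cis_j _)) !mulr1.
have K : V1 * (r *: cis (- a)) + V2 * (s *: cis (- b)) = 0.
  have yP : @E10 R n (val y) := set_valP y.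
  rewrite yE in yP; have [_ _] := yP; have [g g1 gE] := rho_equator_odd n_odd.
  rewrite gE ?unit_u.1 ?unit_u.2 // /hprod => H.
  have g0 : g != 0.
    by apply: contraTneq (oner_neq0 R) => g0; rewrite -g1 g0 expr0n eqxx.
  apply: (scalerI g0); rewrite scaler0.
  move: H => /quatP[/= h1 h2 h3 h4]; apply/quatP; rewrite /= cosN sinN cosN sinN.
  by split; lra.
set A' := r *: cis (- a) in K; set B' := s *: cis (- b) in K.
pose A := r *: cis a; pose B := s *: cis b; pose la := V2 * A - V1 * B.
have ZcisM t u v w : (t *: cis u) * (v *: cis w) = (t * v) *: cis (u + w).
  by rewrite -scalerAl -scalerAr scalerA -cisD.
have AA : A' * A = (r ^+ 2)%:A by rewrite ZcisM addNr cis0.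
have AA' : A * A' = (r ^+ 2)%:A by rewrite ZcisM subrr cis0.
have BB : B' * B = (s ^+ 2)%:A by rewrite ZcisM addNr cis0.
have BB' : B * B' = (s ^+ 2)%:A by rewrite ZcisM subrr cis0.
have AB : A * B' = B' * A by rewrite !ZcisM mulrC addrC.
have AB' : B * A' = A' * B by rewrite !ZcisM mulrC addrC.
have V1E : V1 = - (la * B').
  have /(congr1 ( *%R^~ A)) := K; rewrite mul0r mulrDl -!mulrA AA mulr_algr.
  move=> /eqP; rewrite addrC addr_eq0 => /eqP K'.
  rewrite /la mulrBl -!mulrA AB K' BB' mulr_algr -opprD -scalerDl rs.
  by rewrite scale1r opprK.
have V2E : V2 = la * A'.
  have /(congr1 ( *%R^~ B)) := K; rewrite mul0r mulrDl -!mulrA BB mulr_algr.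
  move=> /eqP; rewrite addr_eq0 => /eqP K'.
  rewrite /la mulrBl -!mulrA AB' K' AA' mulr_algr opprK -scalerDl rs.
  by rewrite scale1r.
have la1 : qnorm2 la = 1.
  have : qnorm2 V1 + qnorm2 V2 = 1 by rewrite -vn /qnorm2 /=; ring.
  by rewrite V1E V2E qnorm2N !qnorm2M !qnorm2_Zcis -mulrDr addrC rs mulr1.
have [p [tau [p0 laE]]] : exists p tau, 0 <= p /\ la = p *: cis tau.
  by apply: complex_polar; rewrite /= !(mulr0, mul0r, addr0, subr0).
have p1 : p = 1.
  by apply/eqP; rewrite -(@eqrXn2 _ 2) ?ler01 // -(qnorm2_Zcis p tau) -laE la1 expr1n.
(* [e^(it)] multiplies [v] by [e^(it)] and [conj u] by [e^(-2it)], hence [la]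
   by [e^(3it)]. *)
rewrite p1 scale1r in laE; pose t := - tau / 3.
have x1 : qnorm2 (polar r (2 * t + a) s (2 * t + b)) = 1.
  by rewrite qnorm2_polar.
exists (mkS3 x1); apply/esym/gromoll_meyer_piP; exists (S3_cis t).
change (odd_frame (mkS3 x1) = star (S3_cis t) (val y)).
rewrite yE star_cis (@odd_frame_polar (mkS3 x1) r (2 * t + a) s (2 * t + b)) //.
have M u v w g : cis u * (cis v * (w *: cis g)) = w *: cis (u + v + g) :> quat R.
  by rewrite -!scalerAr -!cisD addrA.
rewrite V1E V2E laE mulrN !M.
by congr (_, (- (_ *: cis _), _ *: cis _)); rewrite /t; field.
Qed.

Lemma even_param_fibre n_even x x' : even_param n_even x = even_param n_even x' <->
  exists m, x' = zeta_act 1 m x.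
Proof.
have act1 m : zeta_act 1 m x = x.
  by apply: val_inj; rewrite /= (zeta_eq1 _ _ _).2 ?mul1r // dvd1z.
split=> [/gromoll_meyer_piP[q qE]|[m ->]]; last by rewrite act1.
exists 0; rewrite act1; apply: val_inj.
have {}qE : even_frame x' = star q (even_frame x) := qE.
have := qE; rewrite /star /even_frame /equator_point.
move=> /pair_equal_spec[/pair_equal_spec[E1 E2] /pair_equal_spec[_ E4]].
have q1 : val q = 1 by rewrite E4 mulr1.
move: E1 E2; rewrite /qJ q1 qconj1 !mul1r !mulr1.
move=> /(mulIr J_unit)/quatP[/= h1 h2 _ _] /(mulIr J_unit)/quatP[/= h3 h4 _ _].
by apply/quatP.
Qed.

(** The first component of [v] vanishes, and multiplication by the inverse of
    the second one makes the latter equal to 1. *)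
Lemma even_param_surj n_even (z : gromoll_meyer R n) : F z ->
  exists x, even_param n_even x = z.
Proof.
rewrite -[z]reprK => /fixed_normal_form[y <-].
move=> [r [a [s [b [c [d [e [f [r0 s0 rs vn yE]]]]]]]]].
have unit_u : qre (r *: (cis a * J)) = 0 /\
    qnorm2 (r *: (cis a * J)) + qnorm2 (s *: (cis b * J)) = 1.
  split; first by rewrite /=; ring.
  by rewrite !qnorm2Z !(S3P (S3_cis_j _)) !mulr1.
have [c0 d0] : c = 0 /\ d = 0.
  have yP : @E10 R n (val y) := set_valP y.
  rewrite yE in yP; have [_ _] := yP; have [g g1 gE] := rho_equator_even n_even.
  rewrite gE ?unit_u.1 ?unit_u.2 // /hprod => H.
  have g0 : g != 0.
    by apply: contraTneq (oner_neq0 R) => g0; rewrite -g1 g0 expr0n eqxx.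
  move: H => /quatP[/= h1 h2 _ _].
  by split; apply: (mulfI g0); rewrite mulr0; lra.
have [|tau tauE] := @cis_surj R e f.
  by rewrite -vn c0 d0 expr0n /= !add0r.
pose t := - tau.
have x1 : qnorm2 (polar r (2 * t + a) s (2 * t + b)) = 1.
  by rewrite qnorm2_polar.
exists (mkS3 x1); apply/esym/gromoll_meyer_piP; exists (S3_cis t).
change (even_frame (mkS3 x1) = star (S3_cis t) (val y)).
rewrite yE star_cis c0 d0 tauE -cisD /t addNr cis0.
rewrite /even_frame (@equator_point_polar (mkS3 x1) r (2 * t + a) s (2 * t + b)) //.
by congr (_, (_, _)); apply/quatP; split=> /=; ring.
Qed.

(** After the normalization of [fixed_normal_form] there remains the action of
    the unit complex numbers [r].  On the phase of [v] relative to the frame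
    determined by [u] it has weight 1 for even [n] and weight 3 for odd [n], so
    that fixing this phase leaves a free action of the trivial group or of the
    cube roots of unity on the 3-sphere of all [u]. *)
Lemma fixed_gromoll_meyer_lens : hausdorff_space (set_type F) ->
  exists2 p, (0 < p <= 3)%N & homeomorphic (lens_space R p 1) (set_type F).
Proof.
move=> hF; have [n_even|n_odd] := boolP (2 %| n)%Z.
  exists 1%N => //.
  pose f x : set_type F :=
    exist (fun z => z \in F) _ (mem_set (even_param_fixed n_even x)).
  apply: (@lens_of_fibres R _ _ f) => //.
  - by apply: continuous_set_type; exact: even_param_continuous.
  - move=> y; have [x xy] := even_param_surj n_even (set_valP y).
    by exists x; apply: val_inj.
  - move=> x x'; rewrite -(even_param_fibre n_even).
    by split=> [/(congr1 set_val)|E] //; apply: val_inj.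
exists 3%N => //.
pose f x : set_type F :=
  exist (fun z => z \in F) _ (mem_set (odd_param_fixed n_odd x)).
apply: (@lens_of_fibres R _ _ f) => //.
- by apply: continuous_set_type; exact: odd_param_continuous.
- move=> y; have [x xy] := odd_param_surj n_odd (set_valP y).
  by exists x; apply: val_inj.
- move=> x x'; rewrite -(odd_param_fibre n_odd).
  by split=> [/(congr1 set_val)|E] //; apply: val_inj.
Qed.

End FixedGromollMeyer.

(** * The classification *)

Lemma lens_pi1 (R : realType) (p : nat) (l : lens_space R p 1) :
  (0 < p)%N -> pi1_cyclic R l p.
Proof. by move=> p0; have [x xl] := lens_pi_surj l; exact: (lens_pi1_cyclic p0 xl). Qed.

Lemma lens_homeomorphic_inj (R : realType) (p q : nat) : (0 < p)%N -> (0 < q)%N ->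
  homeomorphic (lens_space R p 1) (lens_space R q 1) -> p = q.
Proof.
move=> p0 q0 pq; pose l := lens_pi p (S3_one R).
apply: (@pi1_cyclic_inj R _ l); first exact: lens_pi1.
by apply: (pi1_cyclic_homeomorphic pq) => y; exact: lens_pi1.
Qed.

Unset Implicit Arguments.

Theorem theorem5 (R : realType) :
  (forall d : int, odd `|d|%N ->
     let F : set (M7 R d) := fixed_points (@M7_act R d) (neg_i R) in
     is_lens_space R (set_type F) /\
     forall x : set_type F, pi1_cyclic R x `|d|%N) /\
  (forall d d' : int, odd `|d|%N -> odd `|d'|%N ->
     equivariantly_homeomorphic (@M7_act R d) (@M7_act R d') <->
     (d = d' \/ d = - d')) /\
  (forall d : int, odd `|d|%N -> 3 < `|d| -> forall n : int,
     ~ equivariantly_homeomorphic (@M7_act R d) (@gromoll_meyer_act R n)).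
Proof.
split; [|split].
- move=> d d_odd F; have h := homeomorphic_sym (fixed_milnor_lens R d_odd).
  have d0 := absd_gt0 d_odd; split.
    by exists `|d|%N, 1%N; split=> //; exact: coprimen1.
  by apply: (pi1_cyclic_homeomorphic h) => y; exact: lens_pi1.
- move=> d d' d_odd d'_odd; split=> [/(fixed_points_homeomorphic (neg_i R)) h|].
    have : homeomorphic (lens_space R `|d|%N 1) (lens_space R `|d'|%N 1).
      apply: homeomorphic_trans (fixed_milnor_lens R d_odd) _.
      apply: homeomorphic_trans h _.
      exact: homeomorphic_sym (fixed_milnor_lens R d'_odd).
    move=> /(lens_homeomorphic_inj (absd_gt0 d_odd) (absd_gt0 d'_odd)).
    by lia.
  move=> [->|->].
    by exists id, id; split=> //; split=> // x; exact: cvg_id.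
  have := milnor_conj_equivariant R (- d'); rewrite opprK.
  exact.
- move=> d d_odd d3 n /(fixed_points_homeomorphic (neg_i R)) h.
  have hF := hausdorff_homeomorphic (homeomorphic_sym h)
    (@fixed_milnor_hausdorff R d).
  have [p /andP[p0 p3] pF] := fixed_gromoll_meyer_lens hF.
  have : homeomorphic (lens_space R p 1) (lens_space R `|d|%N 1).
    apply: homeomorphic_trans pF _.
    apply: homeomorphic_trans (homeomorphic_sym h) _.
    exact: homeomorphic_sym (fixed_milnor_lens R d_odd).
  move=> /(lens_homeomorphic_inj p0 (absd_gt0 d_odd)) pd.
  by lia.
Qed.
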